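(* Let $0<\alpha<1$ and $k\in\mathbb R$, let $g_{\alpha,k}$ be the $C^{1,\alpha}$ metric on $\mathbb S^2\times\mathbb S^1$ constructed in the context, let $q$ be the point with local coordinates $(r,\theta,\xi)=(0,0,0)$, and let $\Omega=\Omega_+\cup\Omega_-\subset T_q(\mathbb S^2\times\mathbb S^1)\cong\mathbb R^3$ be the wedge region defined in the context. Then, for all sufficiently small $t>0$, $$\mathrm{Vol}_{g_{\alpha,k}}\big(\exp_q^{g_{\alpha,k}}(t\Omega)\big)-t^3\,\mathrm{Vol}_{g_E}(\Omega)=\frac{\sqrt3\,\rho_0^5}{6}\Big[k\,\frac{1-\alpha^2}{1+\alpha^2}-\Big(\arctan\frac1\alpha-\arctan\alpha\Big)\Big]t^5+O(t^6),$$ where $g_E$ is the Euclidean metric. Therefore the coefficient of $t^5$ is positive if and only if $k>K_*(\alpha)$, where $$K_*(\alpha):=\frac{1+\alpha^2}{1-\alpha^2}\Big(\arctan\frac1\alpha-\arctan\alpha\Big).$$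
   Context: Construction of $g_{\alpha,k}$. Let $b\in C^\infty(\mathbb R)$ with $b(x)=0$ for $x\le\frac12$, $b(x)=1$ for $x\ge1$, $0\le b\le1$, $|b'|\le10$, $|b''|\le100$. Define $\psi_\alpha:[-1,1]^2\to\mathbb R$ by $\psi_\alpha(r,\theta)=|r\theta|\,b(|\theta|/|r|^{1/\alpha})\,b(|r|/|\theta|^{1/\alpha})$ if $r\theta\ne0$ and $\psi_\alpha=0$ if $r\theta=0$. Let $\chi\in C_c^\infty(\mathbb R^2)$ with $0\le\chi\le1$, $\chi\equiv1$ on $[-1,1]^2$, $\chi\equiv0$ outside $[-2,2]^2$; put $\chi_\rho(r,\theta)=\chi(r/\rho,\theta/\rho)$. Set $$\rho_*=\min\Big\{\tfrac14,\ \tfrac1{4(1+|k|)},\ \tfrac{1}{4(1+|k|)(15+\frac{10}\alpha)\sqrt{1+\sec^2(1/2)}}\Big\}.$$ Let $p\in\mathbb S^2$ (unit round sphere), with local coordinates $(r,\theta)$ centered at $p$ in which $g_{\mathbb S^2}=dr^2+\cos^2r\,d\theta^2$. Let $\varphi_{\alpha,k}=1+k\chi_{\rho_*}\psi_\alpha$, extended by $1$, and $g_{\alpha,k}=\varphi_{\alpha,k}^{-2}g_{\mathbb S^2}+\varphi_{\alpha,k}^2d\xi^2$, with $\xi$ the coordinate on $\mathbb S^1$. Exponential map: for $v=x\partial_r+y\partial_\theta+z\partial_\xi\in T_q$ with $xy\ne0$, the local geodesic of $g_{\alpha,k}$ with initial data $(q,v)$ exists and is unique, so $\exp_q^{g_{\alpha,k}}(tv)=\gamma_v(t)$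 is well defined for small $t>0$. Wedge region: fix $\rho_0>0$ with $\rho_0\le\min\{\frac12\rho_*,\ \sqrt{1+\alpha^2}\,\alpha^{\alpha/(1-\alpha)}\}$. Identify $T_q$ with $\mathbb R^3$ via $x\partial_r+y\partial_\theta+z\partial_\xi\leftrightarrow(x,y,z)$, and set $$\Omega_\pm=\Big\{(x,y)\in\mathbb R^2:\ \sqrt{x^2+y^2}\le\rho_0,\ \pm xy>0,\ \alpha|x|\le|y|\le\tfrac1\alpha|x|\Big\}\times\Big(-\tfrac{\sqrt3}2\rho_0,\tfrac{\sqrt3}2\rho_0\Big).$$ $t\Omega=\{tv:v\in\Omega\}$. *)

(* Defs.v *)
From HB Require Import structures.
From mathcomp Require Import all_boot all_order all_algebra.
From mathcomp Require Import all_classical all_reals all_analysis.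
Set Implicit Arguments.
Unset Strict Implicit.
Unset Printing Implicit Defensive.
Import Order.TTheory GRing.Theory Num.Theory.
Import numFieldNormedType.Exports.
Local Open Scope classical_set_scope.
Local Open Scope ring_scope.

(* On a finite-dimensional V, f is of class C^n iff it is continuous and all  *)
(* its directional derivatives exist everywhere and are of class C^(n-1).     *)
Fixpoint class_C (R : realType) (V : normedModType R) (n : nat)
    (f : V -> R) : Prop :=
  if n is n'.+1 then
    continuous f /\
    forall v : V, (forall u, derivable f u v) /\ class_C n' (fun u => 'D_v f u)
  else continuous f.

Definition smooth (R : realType) (V : normedModType R) (f : V -> R) : Prop :=
  forall n, class_C n f.

Definition cutoff1 (R : realType) (b : R -> R) : Prop :=
  [/\ smooth b,
      forall x, x <= 2^-1 -> b x = 0,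
      forall x, 1 <= x -> b x = 1,
      forall x, 0 <= b x <= 1 &
      forall x, `|derive1 b x| <= 10 /\ `|derive1n 2 b x| <= 100].

Definition cutoff2 (R : realType) (chi : R * R -> R) : Prop :=
  [/\ smooth chi,
      forall u, 0 <= chi u <= 1,
      forall u, `|u.1| <= 1 -> `|u.2| <= 1 -> chi u = 1 &
      forall u, ~ (`|u.1| <= 2 /\ `|u.2| <= 2) -> chi u = 0].

(* The formula is used on all of R^2; psi only ever appears multiplied by     *)
(* chi_rho with rho = rho_star <= 1/4, which vanishes outside [-1/2, 1/2]^2.  *)
Definition psi (R : realType) (alpha : R) (b : R -> R) (r theta : R) : R :=
  if r * theta == 0 then 0
  else `|r * theta| * b (`|theta| / (`|r| `^ (alpha^-1)))
                    * b (`|r| / (`|theta| `^ (alpha^-1))).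

Definition chi_rho (R : realType) (chi : R * R -> R) (rho r theta : R) : R :=
  chi (r / rho, theta / rho).

Definition rho_star (R : realType) (alpha k : R) : R :=
  Num.min (4^-1)
    (Num.min ((4 * (1 + `|k|))^-1)
       ((4 * (1 + `|k|) * (15 + 10 / alpha)
           * Num.sqrt (1 + (cos (2^-1))^-1 ^+ 2))^-1)).

Definition dot (R : realType) (n : nat) (v w : 'rV[R]_n) : R :=
  \sum_(i < n) v 0 i * w 0 i.

Definition orthonormal3 (R : realType) (p e1 e2 : 'rV[R]_3) : Prop :=
  [/\ dot p p = 1, dot e1 e1 = 1 & dot e2 e2 = 1] /\
  [/\ dot p e1 = 0, dot p e2 = 0 & dot e1 e2 = 0].

(* S^2 x S^1 is realized as the product of the unit spheres of R^3 and R^2,   *)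
(* with points x = (x.1, x.2).  An orthonormal frame (p, e1, e2) of R^3 gives *)
(* coordinates (r, theta) centered at p with g_{S^2} = dr^2 + cos^2 r         *)
(* dtheta^2; p is thus an arbitrary point of S^2.                             *)
Definition sphere_chart (R : realType) (p e1 e2 : 'rV[R]_3) (r theta : R) :
    'rV[R]_3 :=
  (cos r * cos theta) *: p + (cos r * sin theta) *: e1 + sin r *: e2.

Definition circle_chart (R : realType) (xi : R) : 'rV[R]_2 :=
  \row_(i < 2) (if i == 0 then cos xi else sin xi).

Definition chart (R : realType) (p e1 e2 : 'rV[R]_3) (u : 'rV[R]_3) :
    'rV[R]_3 * 'rV[R]_2 :=
  (sphere_chart p e1 e2 (u 0 0) (u 0 1), circle_chart (u 0 2)).

Definition sphere_dom (R : realType) : set (R * R) :=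
  [set u | `|u.1| < pi / 2 /\ `|u.2| < pi].

(* The chart is injective on this domain and its image is the complement of a *)
(* null set of S^2 x S^1 (a closed half-meridian of S^2, a point of S^1).     *)
Definition chart_dom (R : realType) : set 'rV[R]_3 :=
  [set u | sphere_dom (u 0 0, u 0 1) /\ `|u 0 2| < pi].

(* varphi_{alpha,k} as a function on S^2.  Off the image of the chart, xget   *)
(* returns the default (0, 0), where psi vanishes: this is the extension      *)
(* by 1.                                                                      *)
Definition varphi (R : realType) (alpha k : R) (b : R -> R)
    (chi : R * R -> R) (p e1 e2 : 'rV[R]_3) (x : 'rV[R]_3) : R :=
  let u := xget (0, 0) [set u : R * R |
             sphere_dom u /\ sphere_chart p e1 e2 u.1 u.2 = x] in
  1 + k * chi_rho chi (rho_star alpha k) u.1 u.2 * psi alpha b u.1 u.2.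

(* g_{alpha,k} at the point x, on vectors V, W of R^3 x R^2 tangent to        *)
(* S^2 x S^1 at x; g_{S^2} and dxi^2 are the metrics induced from R^3, R^2.   *)
Definition g_metric (R : realType) (alpha k : R) (b : R -> R)
    (chi : R * R -> R) (p e1 e2 : 'rV[R]_3)
    (x V W : 'rV[R]_3 * 'rV[R]_2) : R :=
  let f := varphi alpha k b chi p e1 e2 x.1 in
  f ^- 2 * dot V.1 W.1 + f ^+ 2 * dot V.2 W.2.

Definition e_ (R : realType) (i : 'I_3) : 'rV[R]_3 := delta_mx 0 i.

Definition chart_d (R : realType) (p e1 e2 : 'rV[R]_3) (u : 'rV[R]_3)
    (i : 'I_3) : 'rV[R]_3 * 'rV[R]_2 :=
  ('D_(e_ R i) (fun w => (chart p e1 e2 w).1) u,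
   'D_(e_ R i) (fun w => (chart p e1 e2 w).2) u).

Definition gram (R : realType) (alpha k : R) (b : R -> R)
    (chi : R * R -> R) (p e1 e2 : 'rV[R]_3) (u : 'rV[R]_3) : 'M[R]_3 :=
  \matrix_(i < 3, j < 3)
    g_metric alpha k b chi p e1 e2 (chart p e1 e2 u)
      (chart_d p e1 e2 u i) (chart_d p e1 e2 u j).

Definition christoffel (R : realType) (G : 'rV[R]_3 -> 'M[R]_3)
    (u : 'rV[R]_3) (l i j : 'I_3) : R :=
  2^-1 * \sum_(m < 3) invmx (G u) l m *
    ('D_(e_ R i) (fun w => G w m j) u + 'D_(e_ R j) (fun w => G w m i) u
     - 'D_(e_ R m) (fun w => G w i j) u).

(* c is the coordinate expression of a geodesic, defined on an open interval  *)
(* containing [0, 1], with initial point the origin of the coordinates and    *)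
(* initial velocity v 0 0 d_r + v 0 1 d_theta + v 0 2 d_xi.                   *)
Definition geodesic (R : realType) (G : 'rV[R]_3 -> 'M[R]_3)
    (v : 'rV[R]_3) (c : R -> 'rV[R]_3) : Prop :=
  [/\ c 0 = 0, derive1 c 0 = v &
      exists2 eps : R, 0 < eps & forall s, - eps < s < 1 + eps ->
        [/\ chart_dom (c s), derivable c s 1, derivable (derive1 c) s 1 &
            forall l, (derive1n 2 c s) 0 l =
              - \sum_(i < 3) \sum_(j < 3)
                  christoffel G (c s) l i j * (derive1 c s) 0 i * (derive1 c s) 0 j]].

Definition exp_defined (R : realType) (alpha k : R) (b : R -> R)
    (chi : R * R -> R) (p e1 e2 : 'rV[R]_3) (v : 'rV[R]_3) : Prop :=
  let G := gram alpha k b chi p e1 e2 in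
  (exists c, geodesic G v c) /\
  (forall c1 c2, geodesic G v c1 -> geodesic G v c2 ->
     forall s, 0 <= s <= 1 -> c1 s = c2 s).

(* exp_q v = gamma_v 1, so that exp_q (t v) = gamma_v t.                      *)
Definition exp_q (R : realType) (alpha k : R) (b : R -> R)
    (chi : R * R -> R) (p e1 e2 : 'rV[R]_3) (v : 'rV[R]_3) :
    'rV[R]_3 * 'rV[R]_2 :=
  chart p e1 e2
    (xget (fun=> 0) [set c | geodesic (gram alpha k b chi p e1 e2) v c] 1).

Definition row3 (R : realType) (u : R * R * R) : 'rV[R]_3 :=
  \row_(i < 3) [:: u.1.1; u.1.2; u.2]`_i.

Definition leb3 (R : realType) : set (R * R * R) -> \bar R :=
  (((@lebesgue_measure R \x @lebesgue_measure R) \x @lebesgue_measure R))%E.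

Definition volE (R : realType) (A : set 'rV[R]_3) : \bar R :=
  leb3 (@row3 R @^-1` A).

Definition vol_g (R : realType) (alpha k : R) (b : R -> R)
    (chi : R * R -> R) (p e1 e2 : 'rV[R]_3)
    (A : set ('rV[R]_3 * 'rV[R]_2)) : \bar R :=
  (\int[((@lebesgue_measure R \x @lebesgue_measure R) \x @lebesgue_measure R)]_(u in
      [set u | chart_dom (row3 u) /\ A (chart p e1 e2 (row3 u))])
    (Num.sqrt (\det (gram alpha k b chi p e1 e2 (row3 u))))%:E)%E.

(* Omega_+ is the case s = 1, Omega_- the case s = -1.                        *)
Definition Omega_pm (R : realType) (alpha rho0 s : R) : set 'rV[R]_3 :=
  [set v | let x := v 0 0 in let y := v 0 1 in let z := v 0 2 in
    [/\ Num.sqrt (x ^+ 2 + y ^+ 2) <= rho0,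
        0 < s * (x * y),
        alpha * `|x| <= `|y| <= alpha^-1 * `|x| &
        - (Num.sqrt 3 / 2 * rho0) < z < Num.sqrt 3 / 2 * rho0]].

Definition Omega (R : realType) (alpha rho0 : R) : set 'rV[R]_3 :=
  Omega_pm alpha rho0 1 `|` Omega_pm alpha rho0 (-1).

Definition scaled (R : realType) (t : R) (A : set 'rV[R]_3) : set 'rV[R]_3 :=
  [set t *: v | v in A].

Definition coef5 (R : realType) (alpha k rho0 : R) : R :=
  Num.sqrt 3 * rho0 ^+ 5 / 6 *
    (k * ((1 - alpha ^+ 2) / (1 + alpha ^+ 2))
     - (atan (alpha^-1) - atan alpha)).

Definition K_star (R : realType) (alpha : R) : R :=
  (1 + alpha ^+ 2) / (1 - alpha ^+ 2) * (atan (alpha^-1) - atan alpha).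

(* Main.v *)
(** On the quadrant with signs (s1, s2), inside the wedge, the conformal factor is
    1 + kappa r theta with kappa = s1 s2 k.  There the exponential map is the time-one
    map of a smooth second-order equation and equals v + P(v) + O(t^4), P being the
    cubic part of the geodesic acceleration divided by 6.  Three triangular shears, one
    per coordinate, invert v + P(v) up to O(t^4); an extra translation of size O(t^4)
    into the cone absorbs the error, so the image of a quarter of the wedge lies between
    the preimages under such maps of two quarter wedges of sizes t -+ K t^4.  The volume
    density cos r / (1 + kappa r theta) is the Jacobian of the shears times
    1 + (2 kappa x y - x^2 - y^2) / 6 + O(t^3), and the integral of this quadratic form
    over the quarter wedge is elementary in the coordinates (x, y / x). *)
Require Import Defs.
From HB Require Import structures.
From mathcomp Require Import all_boot all_order all_algebra.
From mathcomp Require Import all_classical all_reals all_analysis.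
From mathcomp Require Import measurable_realfun ring lra.
Import Order.TTheory GRing.Theory Num.Theory.
Import numFieldNormedType.Exports.
Local Open Scope classical_set_scope.
Local Open Scope ring_scope.

(** The metric is only C^{1,alpha}, so the Christoffel symbols are merely Hölder and the geodesic
    equation has no Lipschitz right-hand side near the axes r = 0 and theta = 0. It is not solved as
    such: on each quadrant the smooth field of 1 + kappa r theta is solved, its solution is shown to
    stay in a wider open cone of aperture alpha / 2, and uniqueness follows because any geodesic
    with the same data enters that cone at once and cannot leave it. As z may be much larger than x
    and y, deviations have to be measured against the horizontal velocity alone; comparison with
    vertical geodesics provides this. No derivative of exp in the initial velocity is taken.
    Lipschitz closeness to the identity and a pointwise cubic expansion suffice, since the change of
    variables is made with explicit polynomial shears, for which one-variable substitution and
    Tonelli are enough. The exponents match: an error K t^4 in the size of a block is a relative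
    error t^3, as is the error of the density, and against a volume of order t^3 both cost
    O(t^6). *)

Section Derivatives.
Context {R : realType}.
Implicit Types (f g : R -> R) (x a b : R).

(* A copy of [is_derive] that is not a class, to prevent the instance resolution
   that [apply:] would otherwise run while the derivative is still an evar. *)
Definition has_derive f x a : Prop := is_derive x 1 f a.

Lemma der_eq f x a b : has_derive f x a -> a = b -> is_derive x 1 f b.
Proof. by move=> h <-; exact: h. Qed.

Lemma derc k x : has_derive (fun=> k) x 0.
Proof. exact: is_derive_cst. Qed.

Lemma derid x : has_derive (fun t => t) x 1.
Proof. exact: is_derive_id. Qed.

Lemma derD f g x a b : has_derive f x a -> has_derive g x b ->
  has_derive (fun t => f t + g t) x (a + b).
Proof. by move=> hf hg; exact: is_deriveD. Qed.

Lemma derB f g x a b : has_derive f x a -> has_derive g x b ->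
  has_derive (fun t => f t - g t) x (a - b).
Proof. by move=> hf hg; exact: is_deriveB. Qed.

Lemma derN f x a : has_derive f x a -> has_derive (fun t => - f t) x (- a).
Proof. by move=> hf; exact: is_deriveN. Qed.

Lemma derM f g x a b : has_derive f x a -> has_derive g x b ->
  has_derive (fun t => f t * g t) x (f x * b + g x * a).
Proof. by move=> hf hg; exact: is_deriveM. Qed.

Lemma derX f (n : nat) x a : has_derive f x a ->
  has_derive (fun t => f t ^+ n) x (n%:R * f x ^+ n.-1 * a).
Proof.
move=> hf; have := @is_deriveX _ _ f n x 1 a hf.
rewrite (_ : f ^+ n = fun t => f t ^+ n) //.
by apply/funext => t; elim: n => [|n IH] //; rewrite !exprS -IH.
Qed.

Lemma derV f x a : f x != 0 -> has_derive f x a ->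
  has_derive (fun t => (f t)^-1) x (- f x ^- 2 * a).
Proof. by move=> hf df; exact: is_deriveV. Qed.

Lemma dercos f x a : has_derive f x a ->
  has_derive (fun t => cos (f t)) x (- sin (f x) * a).
Proof. by move=> hf; apply: (@is_derive1_comp R cos f). Qed.

Lemma dersin f x a : has_derive f x a ->
  has_derive (fun t => sin (f t)) x (cos (f x) * a).
Proof. by move=> hf; apply: (@is_derive1_comp R sin f). Qed.

End Derivatives.

(** Builds the derivative on an evar by the structure of the function and leaves its equality with
    the expected value as the goal. *)
Ltac der := apply: der_eq; [repeat first
  [ apply: derc | apply: derid | apply: derD | apply: derB | apply: derN
  | apply: derM | apply: derX | apply: dercos | apply: dersin | assumption ]
  | rewrite /= ].

(** * Contraction principle and Picard iteration for second-order systems *)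

Section FixedPoint.
Context {R : realType}.

(** Banach's principle in the sup distance for real functions on a bare type: the limit is taken
    pointwise, as a supremum. The predicate [P] has to survive uniform limits; it is continuity in
    the Picard iteration and trivial in the inversion of the time-one map. *)
Lemma contraction_fixpoint (S : Type) (P : (S -> R) -> Prop)
    (Phi : (S -> R) -> S -> R) (d0 : S -> R) (M0 : R) :
  P d0 -> (forall d, P d -> P (Phi d)) ->
  (forall d e M, P d -> P e -> 0 <= M -> (forall s, `|d s - e s| <= M) ->
     forall s, `|Phi d s - Phi e s| <= M / 2) ->
  0 <= M0 -> (forall s, `|Phi d0 s - d0 s| <= M0) ->
  (forall d, (forall e, 0 < e ->
     exists2 g, P g & forall s, `|d s - g s| <= e) -> P d) ->
  exists2 d, P d & forall s, Phi d s = d s.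
Proof.
move=> Pd0 PPhi ctr M00 hM0 Pcl.
pose x n := iter n Phi d0.
(* Tail of the geometric series of steps, the sum of M0 / 2^j over j >= n; this makes the intervals
   x n s -+ ep n nested in n. *)
pose ep n : R := 2 * M0 / 2 ^+ n.
have Px n : P (x n) by elim: n => //= n; exact: PPhi.
have ep0 n : 0 <= ep n by rewrite /ep divr_ge0 ?mulr_ge0 ?exprn_ge0.
have epS n : ep n - ep n.+1 = M0 / 2 ^+ n.
  rewrite /ep exprS invfM; have : (2 ^+ n : R) != 0 by rewrite expf_neq0.
  by move=> h; field.
have xS n s : `|x n.+1 s - x n s| <= M0 / 2 ^+ n.
  elim: n s => [|n IH] s; first by rewrite expr0 divr1; exact: hM0.
  rewrite exprSr invfM mulrA /=; apply: ctr => //; first exact: (Px n.+1).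
  by rewrite divr_ge0 // exprn_ge0.
have lo_nd n m s : (n <= m)%N -> x n s - ep n <= x m s - ep m.
  move=> /subnKC <-; elim: (m - n)%N => [|j IH]; first by rewrite addn0.
  apply: (le_trans IH); rewrite addnS.
  have := xS (n + j)%N s; have := epS (n + j)%N.
  by rewrite ler_norml => <- /andP[]; lra.
have hi_ni n m s : (n <= m)%N -> x m s + ep m <= x n s + ep n.
  move=> /subnKC <-; elim: (m - n)%N => [|j IH]; first by rewrite addn0.
  apply: le_trans IH; rewrite addnS.
  have := xS (n + j)%N s; have := epS (n + j)%N.
  by rewrite ler_norml => <- /andP[]; lra.
have lohi n m s : x n s - ep n <= x m s + ep m.
  have := lo_nd n (n + m)%N s (leq_addr _ _).
  have := hi_ni m (n + m)%N s (leq_addl _ _).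
  by have := ep0 (n + m)%N; lra.
(* Every upper end dominates every lower end, so this supremum lies in all the nested intervals. *)
pose d s := sup [set x n s - ep n | n in [set: nat]].
have dlo n s : x n s - ep n <= d s.
  apply: ub_le_sup; last by exists n.
  by exists (x 0%N s + ep 0%N) => _ [m _ <-].
have dhi n s : d s <= x n s + ep n.
  apply: ge_sup; first by exists (x 0%N s - ep 0%N); exists 0%N.
  by move=> _ [m _ <-].
have dx n s : `|d s - x n s| <= ep n.
  by rewrite ler_norml; have := dlo n s; have := dhi n s; lra.
have ep_small e : 0 < e -> exists n, ep n <= e.
  move=> e0; exists (Num.bound (2 * M0 / e)).
  have := upper_nthrootP (leqnn (Num.bound (2 * M0 / e))).
  move: (Num.bound _) => n.
  rewrite ltr_pdivrMr // => /ltW h; rewrite /ep.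
  by rewrite ler_pdivrMr ?exprn_gt0 // [leRHS]mulrC.
have Pd : P d.
  apply: Pcl => e /ep_small [n hn]; exists (x n) => // s.
  exact: le_trans (dx n s) hn.
(* The defect Phi d - d is at most ep n / 2 + ep n.+1 for every n: contraction from [x n], then
   approximation at rank n + 1. *)
exists d => // s; apply/eqP; rewrite -subr_eq0 -normr_le0.
apply/ler_addgt0Pr => e e0; rewrite add0r.
have [n hn] := ep_small (e / 2) ltac:(lra).
have h1 := ctr d (x n) (ep n) Pd (Px n) (ep0 n) (dx n) s.
have h2 := dx n.+1 s; rewrite /= -/(x n) in h2.
have h3 : ep n.+1 <= ep n.
  by have := epS n; have := divr_ge0 M00 (exprn_ge0 n (ler0n R 2)); lra.
have -> : Phi d s - d s = (Phi d s - Phi (x n) s) - (d s - Phi (x n) s) by ring.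
apply: (le_trans (ler_normB _ _)).
have := ep0 n; lra.
Qed.

End FixedPoint.

Section Primitive.
Context {R : realType}.
Implicit Types (f g : R -> R).

Lemma derive1_is_derive (f : R -> R) (x d : R) :
  derivable f x 1 -> derive1 f x = d -> is_derive x 1 f d.
Proof. by move=> h1 h2; split => //; rewrite -derive1E. Qed.

Lemma is_derive_continuous (f : R -> R) (x d : R) :
  is_derive x 1 f d -> {for x, continuous f}.
Proof.
by move=> h; apply/differentiable_continuous/derivable1_diffP; case: h.
Qed.

(** Anchored at 0 on an interval reaching to both sides, since geodesics are required at small
    negative times as well. *)
Lemma mean_value_ineq (f df : R -> R) (lo hi M : R) : lo <= 0 -> 0 <= hi ->
  (forall s, lo <= s <= hi -> is_derive s 1 f (df s)) ->
  (forall s, lo <= s <= hi -> `|df s| <= M) ->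
  forall s, lo <= s <= hi -> `|f s - f 0| <= M * `|s|.
Proof.
move=> lo0 hi0 hf hM s /andP[s1 s2].
have cf a b : lo <= a -> b <= hi -> {within `[a, b], continuous f}.
  move=> la bh; apply: derivable_within_continuous => x.
  rewrite in_itv /= => /andP[ax xb].
  by have [] : is_derive x 1 f (df x) by apply: hf; rewrite (le_trans la) ?(le_trans xb).
case: (leP 0 s) => s0.
  have [c cs ->] := @MVT_segment _ f df 0 s s0 (fun x hx => hf x
    ltac:(move: hx; rewrite in_itv /= => /andP[? ?]; apply/andP; split; lra)) (cf _ _ lo0 s2).
  move: cs; rewrite in_itv /= => /andP[? ?].
  rewrite subr0 normrM ler_wpM2r //; apply: hM; apply/andP; split; lra.
have [c cs e] := @MVT_segment _ f df s 0 (ltW s0) (fun x hx => hf x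
    ltac:(move: hx; rewrite in_itv /= => /andP[? ?]; apply/andP; split; lra)) (cf _ _ s1 hi0).
rewrite distrC e.
move: cs; rewrite in_itv /= => /andP[? ?].
rewrite sub0r normrM normrN ler_wpM2r //; apply: hM; apply/andP; split; lra.
Qed.

End Primitive.

Section ODE.
Context {R : realType} {I : finType}.
Implicit Types (a b v : I -> R) (c d : I -> R -> R).

Definition lipschitz_field (L : R) (f : (I -> R) -> (I -> R) -> I -> R) :=
  forall a a' b b' M, 0 <= M -> (forall i, `|a i - a' i| <= M) ->
    (forall i, `|b i - b' i| <= M) -> forall i, `|f a b i - f a' b' i| <= L * M.

Definition second_order_sol (f : (I -> R) -> (I -> R) -> I -> R) c d (s : R) :=
  forall i, is_derive s 1 (c i) (d i s) /\
            is_derive s 1 (d i) (f (c^~ s) (d^~ s) i).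

(** Used twice: on time, so that the Picard operator acts on functions on the whole line, and on
    phase space, so that the geodesic field becomes globally Lipschitz. *)
Definition clamp (m x : R) : R := Num.max (- m) (Num.min m x).

Lemma clampP m x : 0 <= m ->
  [\/ x < - m /\ clamp m x = - m, m < x /\ clamp m x = m |
      - m <= x /\ x <= m /\ clamp m x = x].
Proof.
move=> m0; rewrite /clamp !maxElt !minElt.
have [xm|mx] := ltrP m x.
  by apply: Or32; split => //; case: ltrP => // ?; lra.
have [xm'|mx'] := ltrP (- m) x; first by apply: Or33; split => //; exact: ltW.
have [<-|ne] := eqVneq (- m) x; last by apply: Or31; rewrite lt_neqAle eq_sym ne.
by apply: Or33; split => //; lra.
Qed.

Lemma clamp_lip m x y : 0 <= m -> `|clamp m x - clamp m y| <= `|x - y|.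
Proof.
move=> m0; have := ler_norm (x - y); have := ler_norm (- (x - y)); rewrite normrN ler_norml.
by case: (clampP m x m0) => [[? ->]|[? ->]|[? [? ->]]];
  case: (clampP m y m0) => [[? ->]|[? ->]|[? [? ->]]] => ? ?; apply/andP; split; lra.
Qed.

Lemma clamp_bound m x : 0 <= m -> `|clamp m x| <= m.
Proof.
move=> m0; rewrite ler_norml.
by case: (clampP m x m0) => [[? ->]|[? ->]|[? [? ->]]]; apply/andP; split; lra.
Qed.

Lemma clamp_id m x : `|x| <= m -> clamp m x = x.
Proof.
move=> h; have m0 : 0 <= m by exact: le_trans (normr_ge0 _) h.
by move: h; rewrite ler_norml; case: (clampP m x m0) => [[? ->]|[? ->]|[? [? ->]]] /andP[? ?]; lra.
Qed.

Lemma lip_continuous (g : R -> R) (K : R) :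
  (forall x y, `|g x - g y| <= K * `|x - y|) -> continuous g.
Proof.
move=> h x; apply/cvgrPdist_le => e e0.
near=> y; apply: (le_trans (h _ _)).
have K0 : 0 < `|K| + 1 by have := normr_ge0 K; lra.
have : `|x - y| <= e / (`|K| + 1).
  by near: y; apply: cvgr_dist_le => //; rewrite divr_gt0.
rewrite ler_pdivlMr // mulrC => /(le_trans _); apply.
by rewrite ler_wpM2r //; have := ler_norm K; lra.
Unshelve. all: by end_near. Qed.

Lemma lip_field_continuous L f c d i : lipschitz_field L f ->
  (forall i, continuous (c i)) -> (forall i, continuous (d i)) ->
  continuous (fun s => f (c^~ s) (d^~ s) i).
Proof.
move=> lf cc cd x; apply/cvgrPdist_le => e e0.
have L0 : 0 < `|L| + 1 by have := normr_ge0 L; lra.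
have e1 : 0 < e / (`|L| + 1) by rewrite divr_gt0.
have nc : \forall y \near x, forall j, `|c j x - c j y| <= e / (`|L| + 1).
  by apply: (@filter_forall R I (fun j y => `|c j x - c j y| <= e / (`|L| + 1)) (nbhs x) (nbhs_filter x)) => j; move/cvgrPdist_le : (cc j x) => /(_ _ e1).
have nd : \forall y \near x, forall j, `|d j x - d j y| <= e / (`|L| + 1).
  by apply: (@filter_forall R I (fun j y => `|d j x - d j y| <= e / (`|L| + 1)) (nbhs x) (nbhs_filter x)) => j; move/cvgrPdist_le : (cd j x) => /(_ _ e1).
near=> y; apply: (@le_trans _ _ (L * (e / (`|L| + 1)))).
  by apply: lf; [exact: ltW|near: y|near: y].
rewrite mulrA ler_pdivrMr // mulrC ler_wpM2l ?(ltW e0) //.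
by have := ler_norm L; lra.
Unshelve. all: by end_near. Qed.

Lemma uniform_limit_is_continuous (g : R -> R) :
  (forall e, 0 < e -> exists2 h : R -> R, continuous h & forall s, `|g s - h s| <= e) ->
  continuous g.
Proof.
move=> hg x; apply/cvgrPdist_le => e e0.
have [h ch gh] := hg (e / 3) ltac:(lra).
near=> y.
have h1 : `|h x - h y| <= e / 3.
  by near: y; apply: cvgr_dist_le; [exact: ch|lra].
have -> : g x - g y = (g x - h x) + (h x - h y) - (g y - h y) by ring.
apply: (le_trans (ler_normB _ _)).
have := ler_normD (g x - h x) (h x - h y).
have := gh x; have := gh y; lra.
Unshelve. all: by end_near. Qed.

(** Primitive vanishing at 0, written from the base point -3 so that one formula serves both signs
    of x; it is used for |x| <= 2, away from the end points. *)
Definition prim3 (g : R -> R) (x : R) : R :=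
  (\int[lebesgue_measure]_(t in `[(-3)%R, x]) g t)%R -
  (\int[lebesgue_measure]_(t in `[(-3)%R, 0%R]) g t)%R.

Lemma prim3_0 g : prim3 g 0 = 0. Proof. by rewrite /prim3 subrr. Qed.

Lemma is_derive_prim3 (g : R -> R) (x : R) : continuous g -> -3 < x < 3 ->
  is_derive x 1 (prim3 g) (g x).
Proof.
move=> cf /andP[x1 x2].
have fi : lebesgue_measure.-integrable `[(-3)%R, 3%R] (EFin \o g).
  apply: continuous_compact_integrable; first exact: segment_compact.
  exact: continuous_subspaceT.
have [h1 h2] := @continuous_FTC1_closed _ g (-3) x 3 x2 fi x1 (cf x).
rewrite -[g x]subr0; apply: is_deriveB.
exact: derive1_is_derive.
Qed.

Lemma prim3_dist (g h : R -> R) (M s : R) : continuous g -> continuous h ->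
  (forall s, `|g s - h s| <= M) -> `|s| <= 2 -> `|prim3 g s - prim3 h s| <= 2 * M.
Proof.
move=> cg ch gh; rewrite ler_norml => /andP[s1 s2].
have := @mean_value_ineq _ (fun x => prim3 g x - prim3 h x)
   (fun x => g x - h x) (-2) 2 M ltac:(lra) ltac:(lra) _ (fun x _ => gh x) s.
rewrite !prim3_0 subrr subr0 => H.
apply: (le_trans (H _ _)).
- move=> x /andP[x1 x2]; apply: is_deriveB; apply: is_derive_prim3 => //;
  apply/andP; split; lra.
- by rewrite s1 s2.
- rewrite mulrC ler_wpM2r //; last by rewrite ler_norml s1 s2.
  exact: le_trans (normr_ge0 _) (gh 0).
Qed.

Lemma continuous_prim3_clamp (g : R -> R) : continuous g ->
  continuous (fun s => prim3 g (clamp 2 s)).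
Proof.
move=> cg x.
have cl : `|clamp 2 x| <= 2 by apply: clamp_bound; lra.
apply: (@continuous_comp _ _ _ (clamp 2) (prim3 g)).
  apply: (@lip_continuous _ 1) => y z; rewrite mul1r; by apply: clamp_lip; lra.
have /(_ cg) h := @is_derive_prim3 g (clamp 2 x).
apply: is_derive_continuous; apply: h.
by move: cl; rewrite ler_norml => /andP[? ?]; apply/andP; split; lra.
Qed.

(** Picard iteration on the velocity alone, the position being its primitive. Time is clamped to
    [-2, 2], so each of the two primitives costs a factor 2 and the iteration contracts by 4 L <=
    1/4. *)
Theorem second_order_ode_exists (L : R) f (v : I -> R) : 0 <= L -> L <= 1 / 16 ->
  lipschitz_field L f ->
  exists c d, [/\ forall i, c i 0 = 0, forall i, d i 0 = v i &
    forall s, -2 < s < 2 -> second_order_sol f c d s].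
Proof.
move=> L0 L1 lf.
(* Time and coordinate are merged into one argument, so that the unknown is a real function on a
   type, as the fixed-point lemma wants. *)
pose pos (d : R * I -> R) (i : I) (u : R) := prim3 (fun w => d (w, i)) (clamp 2 u).
pose acc (d : R * I -> R) i u := f (pos d ^~ u) (fun j => d (u, j)) i.
pose Phi (d : R * I -> R) (z : R * I) := v z.2 + prim3 (acc d z.2) (clamp 2 z.1).
pose P (d : R * I -> R) := forall i, continuous (fun u => d (u, i)).
have Ppos (d : R * I -> R) : P d -> forall i, continuous (pos d i).
  by move=> Pd i; apply: continuous_prim3_clamp; exact: Pd.
have Pacc (d : R * I -> R) : P d -> forall i, continuous (acc d i).
  move=> Pd i; apply: (@lip_field_continuous L f (pos d) (fun i u => d (u, i))) => //.
  exact: Ppos.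
have cl2 u : `|clamp 2 u| <= 2 by apply: clamp_bound; lra.
have PPhi (d : R * I -> R) : P d -> P (Phi d).
  move=> Pd i u; rewrite /Phi /=; apply: cvgD; first exact: cvg_cst.
  apply: (@continuous_prim3_clamp (acc d i)); exact: Pacc.
have ctr (d e : R * I -> R) M : P d -> P e -> 0 <= M -> (forall s, `|d s - e s| <= M) ->
     forall s, `|Phi d s - Phi e s| <= M / 2.
  move=> Pd Pe M0 de [u i]; rewrite /Phi /= opprD addrACA subrr add0r.
  apply: (@le_trans _ _ (2 * (L * (2 * M)))).
    apply: prim3_dist => //; [exact: Pacc|exact: Pacc|].
    move=> s; apply: lf; first lra.
      by move=> j; apply: prim3_dist => //.
    by move=> j; apply: (le_trans (de _)); lra.
  by have : L * M <= 1 / 16 * M by [exact: ler_wpM2r]; lra.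
pose d0 (z : R * I) := v z.2.
have Pd0 : P d0 by move=> i u; rewrite /d0 /=; exact: cvg_cst.
have [M0 M00 hM0] : exists2 M0, 0 <= M0 & forall s, `|Phi d0 s - d0 s| <= M0.
  have vB : exists2 V : R, 0 <= V & forall i, `|v i| <= V.
    exists (\sum_i `|v i|); first exact: sumr_ge0.
    move=> i; rewrite (bigD1 i) //= lerDl; exact: sumr_ge0.
  have fB : exists2 V : R, 0 <= V & forall i, `|f (fun=> 0) (fun=> 0) i| <= V.
    exists (\sum_i `|f (fun=> 0) (fun=> 0) i|); first exact: sumr_ge0.
    move=> i; rewrite (bigD1 i) //= lerDl; exact: sumr_ge0.
  have [V V0 hV] := vB; have [F F0 hF] := fB.
  exists (2 * (L * (2 * V) + F)).
    by have : 0 <= L * V by [exact: mulr_ge0]; lra.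
  move=> [u i]; rewrite /Phi /d0 /= addrC addKr.
  have := @prim3_dist (acc d0 i) (fun=> 0) (L * (2 * V) + F) (clamp 2 u).
  have -> : prim3 (fun=> 0) (clamp 2 u) = 0 :> R.
    by rewrite /prim3 /Rintegral !integral0 subrr.
  rewrite subr0; apply => //; [exact: Pacc|by move=> ?; exact: cvg_cst|].
  move=> s; rewrite subr0.
  have -> : acc d0 i s = (acc d0 i s - f (fun=> 0) (fun=> 0) i) + f (fun=> 0) (fun=> 0) i by ring.
  apply: (le_trans (ler_normD _ _)); apply: lerD => //.
  apply: lf; first lra.
    move=> j; have := @prim3_dist (fun=> v j) (fun=> 0) V (clamp 2 s).
    have -> : prim3 (fun=> 0) (clamp 2 s) = 0 :> R.
      by rewrite /prim3 /Rintegral !integral0 subrr.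
    apply => //; [by move=> ?; exact: cvg_cst|by move=> ?; exact: cvg_cst|].
    by move=> _; rewrite subr0.
  by move=> j; rewrite subr0; apply: (le_trans (hV j)); lra.
have Pcl (d : R * I -> R) : (forall e, 0 < e -> exists2 g, P g & forall s, `|d s - g s| <= e) -> P d.
  move=> hd i; apply: uniform_limit_is_continuous => e /hd [g Pg dg].
  by exists (fun u => g (u, i)) => // s; exact: dg.
have [d Pd dE] := contraction_fixpoint _ P Phi d0 M0 Pd0 PPhi ctr M00 hM0 Pcl.
exists (pos d), (fun i u => d (u, i)); split.
- move=> i; rewrite /pos clamp_id ?prim3_0 // normr0; lra.
- move=> i; rewrite -dE /Phi /= clamp_id ?prim3_0 ?addr0 // normr0; lra.
move=> s s2.
have ncl : \forall u \near s, clamp 2 u = u.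
  have : \forall u \near s, u \in `](-2)%R, 2%R[ by apply: near_in_itvoo; rewrite in_itv.
  apply: filterS => u; rewrite in_itv /= => /andP[u1 u2].
  by apply: clamp_id; rewrite ler_norml (ltW u1) (ltW u2).
have s3 : -3 < s < 3 by move: s2 => /andP[? ?]; apply/andP; split; lra.
move=> i; split.
  apply: (@near_eq_is_derive _ _ _ (prim3 (fun w => d (w, i)))).
    by apply: filterS ncl => u hu; rewrite /pos hu.
  by apply: (@is_derive_prim3 (fun w => d (w, i))) => //; exact: Pd.
apply: (@near_eq_is_derive _ _ _ (fun u => v i + prim3 (acc d i) u)).
  by apply: filterS ncl => u hu; rewrite -[RHS]dE /Phi /= hu.
rewrite -[f _ _ _]add0r; apply: is_deriveD.
by apply: (@is_derive_prim3 (acc d i)) => //; exact: Pacc.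
Qed.

End ODE.

Section ODE_dist.
Context {R : realType} {I : finType}.
Implicit Types (c d : I -> R -> R).

(** The maximum runs over times and coordinates at once, so that the absorption argument below
    involves a single number. *)
Lemma exists_max (g : I -> R -> R) (lo hi : R) : lo <= hi -> I ->
  (forall i, {within `[lo, hi], continuous (g i)}) ->
  exists i s, lo <= s <= hi /\ forall j u, lo <= u <= hi -> g j u <= g i s.
Proof.
move=> lohi i0 cg.
have h i : exists s, lo <= s <= hi /\ forall u, lo <= u <= hi -> g i u <= g i s.
  have [s hs ms] := EVT_max lohi (cg i).
  by exists s; split; [move: hs; rewrite in_itv | move=> u hu; apply: ms; rewrite in_itv].
have [m hm] := choice h.
case: (@Order.TotalTheory.arg_maxP _ _ I i0 xpredT (fun i => g i (m i)) isT) => i _ im.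
exists i, (m i); split; first exact: (hm i).1.
move=> j u hu; apply: le_trans ((hm j).2 u hu) _; exact: im.
Qed.

(** Absorption in place of Gronwall: where the velocity difference attains its maximum M one has M
    <= D + 4 L M, and 4 L <= 1/4 gives M <= 4/3 D. With D = 0 this is uniqueness; against a vertical
    geodesic it controls the horizontal motion. *)
Lemma second_order_sol_dist (L D lo hi : R) f c d c' d' :
  0 <= L -> L <= 1 / 16 -> lipschitz_field L f ->
  - 2 <= lo -> lo <= 0 -> 0 <= hi -> hi <= 2 ->
  (forall s, lo <= s <= hi -> second_order_sol f c d s) ->
  (forall s, lo <= s <= hi -> second_order_sol f c' d' s) ->
  (forall i, c i 0 = 0) -> (forall i, c' i 0 = 0) ->
  (forall i, `|d i 0 - d' i 0| <= D) ->
  forall s i, lo <= s <= hi ->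
    [/\ `|d i s - d' i s| <= 2 * D,
        `|(d i s - d' i s) - (d i 0 - d' i 0)| <= 4 * L * D * `|s| &
        `|(c i s - c' i s) - s * (d i 0 - d' i 0)| <= 8 * L * D * `|s| ].
Proof.
move=> L0 L1 lf lo2 lo0 hi0 hi2 sol sol' c0 c'0 hD s i hs.
have lohi : lo <= hi by lra.
have in0 : lo <= 0 <= hi by rewrite lo0 hi0.
pose g i u := `|d i u - d' i u|.
have cg j : {within `[lo, hi], continuous (g j)}.
  apply: continuous_in_subspaceT => u /set_mem; rewrite /= in_itv /= => hu.
  apply: cvg_norm; apply: cvgB.
    exact: (is_derive_continuous _ _ _ (sol u hu j).2).
  exact: (is_derive_continuous _ _ _ (sol' u hu j).2).
have [im [sm [hsm maxM]]] := exists_max g lo hi lohi i cg.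
pose M := g im sm.
have M0 : 0 <= M by exact: normr_ge0.
have abs2 u : lo <= u <= hi -> `|u| <= 2.
  by rewrite ler_norml => /andP[? ?]; apply/andP; split; lra.
have cdist u j : lo <= u <= hi -> `|c j u - c' j u| <= 2 * M.
  move=> hu; have := @mean_value_ineq _ (fun x => c j x - c' j x)
    (fun x => d j x - d' j x) lo hi M lo0 hi0 _ (fun x => maxM j x) u hu.
  rewrite c0 c'0 subrr subr0 => H; apply: (le_trans (H _)).
    by move=> x hx; apply: is_deriveB; [exact: (sol x hx j).1|exact: (sol' x hx j).1].
  by rewrite mulrC ler_wpM2r // abs2.
have ddist u j : lo <= u <= hi ->
    `|(d j u - d' j u) - (d j 0 - d' j 0)| <= 2 * L * M * `|u|.
  move=> hu; apply: (@mean_value_ineq _ (fun x => d j x - d' j x) (fun x =>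
     f (c^~ x) (d^~ x) j - f (c'^~ x) (d'^~ x) j) lo hi) => // x hx.
    by apply: is_deriveB; [exact: (sol x hx j).2|exact: (sol' x hx j).2].
  have -> : 2 * L * M = L * (2 * M) by ring.
  apply: lf; first lra.
    by move=> j'; exact: cdist.
  by move=> j'; apply: (le_trans (maxM j' x hx)); rewrite -/M; lra.
have LM : L * M <= 1 / 16 * M by exact: ler_wpM2r.
have MD : M <= 4 / 3 * D.
  have h1 := ddist sm im hsm.
  have h2 : 2 * L * M * `|sm| <= 2 * L * M * 2.
    by rewrite ler_wpM2l ?abs2 // !mulr_ge0.
  have h3 := ler_normD (d im 0 - d' im 0)
    ((d im sm - d' im sm) - (d im 0 - d' im 0)).
  rewrite addrC subrK -/(g im sm) -/M in h3.
  have := hD im; lra.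
have D0 : 0 <= D by exact: le_trans (normr_ge0 _) (hD i).
have LMD : L * M <= L * (4 / 3 * D) by exact: ler_wpM2l.
have dd u j : lo <= u <= hi ->
    `|(d j u - d' j u) - (d j 0 - d' j 0)| <= 4 * L * D * `|u|.
  move=> hu; apply: (le_trans (ddist u j hu)); rewrite ler_wpM2r //.
  have := mulr_ge0 L0 D0; lra.
split; last first.
- have := @mean_value_ineq _ (fun x => (c i x - c' i x) - x * (d i 0 - d' i 0))
    (fun x => (d i x - d' i x) - (d i 0 - d' i 0)) lo hi (8 * L * D) lo0 hi0 _ _ s hs.
  rewrite c0 c'0 mul0r !subr0; apply.
    move=> x hx; apply: is_deriveB.
      by apply: is_deriveB; [exact: (sol x hx i).1|exact: (sol' x hx i).1].
    by der; ring.
  move=> x hx; apply: (le_trans (dd x i hx)).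
  have -> : 8 * L * D = 4 * L * D * 2 by ring.
  by rewrite ler_wpM2l ?abs2 // !mulr_ge0.
- exact: dd.
- by apply: (le_trans (maxM i s hs)); rewrite -/M; lra.
Qed.

End ODE_dist.

(** * Elementary bounds for sine and cosine *)

Section Trig.
Context {R : realType}.
Implicit Types x y : R.

Lemma lip_of_derive (f df : R -> R) (m K : R) :
  (forall x, is_derive x 1 f (df x)) -> (forall x, `|x| <= m -> `|df x| <= K) ->
  forall x y, `|x| <= m -> `|y| <= m -> `|f x - f y| <= K * `|x - y|.
Proof.
move=> hf hK x y hx hy.
wlog xy : x y hx hy / y <= x.
  move=> H; case: (leP y x) => [|/ltW] h; first exact: H.
  by rewrite distrC [`|x - y|]distrC; exact: H.
have [c cs ->] := @MVT_segment _ f df y x xy (fun x _ => hf x)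
  (derivable_within_continuous (fun x _ => @ex_derive _ _ _ _ _ _ _ (hf x))).
rewrite normrM ler_wpM2r //; apply: hK.
move: cs hx hy; rewrite in_itv /= !ler_norml => /andP[? ?] /andP[? ?] /andP[? ?].
by apply/andP; split; lra.
Qed.

Lemma cos_norm_le1 x : `|cos x| <= 1.
Proof. by rewrite ler_norml cos_geN1 cos_le1. Qed.

Lemma sin_norm_le1 x : `|sin x| <= 1.
Proof. by rewrite ler_norml sin_geN1 sin_le1. Qed.

Lemma sin_lip x y : `|sin x - sin y| <= `|x - y|.
Proof.
have [m [hx hy]] : exists m, `|x| <= m /\ `|y| <= m.
  by exists (`|x| + `|y|); rewrite lerDl lerDr !normr_ge0.
rewrite -[leRHS]mul1r; apply: (@lip_of_derive sin cos m) => // z _.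
exact: cos_norm_le1.
Qed.

Lemma cos_lip x y : `|cos x - cos y| <= `|x - y|.
Proof.
have [m [hx hy]] : exists m, `|x| <= m /\ `|y| <= m.
  by exists (`|x| + `|y|); rewrite lerDl lerDr !normr_ge0.
rewrite -[leRHS]mul1r; apply: (@lip_of_derive cos (fun z => - sin z) m) => // z _.
by rewrite normrN sin_norm_le1.
Qed.

Lemma cos_sub1_le x : `|cos x - 1| <= `|x|.
Proof. by have := cos_lip x 0; rewrite cos0 subr0. Qed.

(** The derivative cos z - 1 is at most |z|. The difference form is what gives [sin r - r] order 2
    in the sense of [order_at0]. *)
Lemma sin_sub_lip m x y : `|x| <= m -> `|y| <= m ->
  `|(sin x - x) - (sin y - y)| <= m * `|x - y|.
Proof.
move=> hx hy.
apply: (@lip_of_derive (fun z => sin z - z) (fun z => cos z - 1) m) => // z.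
exact/le_trans/cos_sub1_le.
Qed.

Lemma sin_sub_le x : `|sin x - x| <= `|x| ^+ 2.
Proof.
have := sin_sub_lip `|x| x 0 (lexx _); rewrite normr0 sin0 !subr0 expr2; exact.
Qed.

(** The derivative is - (sin z - z), at most x^2 between 0 and x. The constant is not sharp; the
    exponent is what counts. *)
Lemma cos_taylor2 x : `|cos x - 1 + x ^+ 2 / 2| <= `|x| ^+ 3.
Proof.
have d1 (z : R) : is_derive z 1 (fun z : R => cos z + z ^+ 2 / 2) (- (sin z - z)).
  by der; field.
have d2 (z : R) : `|z| <= `|x| -> `|- (sin z - z)| <= `|x| ^+ 2.
  move=> hz; rewrite normrN; apply: le_trans (sin_sub_le z) _.
  by rewrite lerXn2r ?nnegrE.
have := @lip_of_derive _ _ _ _ d1 d2 x 0 (lexx _).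
rewrite normr0 => /(_ (normr_ge0 _)).
by rewrite subr0 cos0 expr0n /= mul0r addr0 -exprSr addrAC.
Qed.

End Trig.

(** * Orders of vanishing in phase space *)

Section Weighted.
Context {R : realType} {I : finType}.
Variable delta0 : R.
Hypothesis delta0_le1 : delta0 <= 1.
Notation phase := ((I -> R) * (I -> R))%type.

Definition in_ball (d : R) (p : phase) := forall i, `|p.1 i| <= d /\ `|p.2 i| <= d.

Definition close (M : R) (p q : phase) :=
  forall i, `|p.1 i - q.1 i| <= M /\ `|p.2 i - q.2 i| <= M.

(* [F] is of order [n] at the origin of phase space, and its differences behave
   as those of a homogeneous function of degree [n]. *)
Definition order_at0 (n : nat) (F : phase -> R) := exists2 C : R, 0 <= C &
  forall d : R, 0 < d -> d <= delta0 ->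
    (forall p, in_ball d p -> `|F p| <= C * d ^+ n) /\
    (forall p q (M : R), in_ball d p -> in_ball d q -> 0 <= M -> close M p q ->
       d * `|F p - F q| <= C * d ^+ n * M).

Lemma order_le n m F : order_at0 n F -> (m <= n)%N -> order_at0 m F.
Proof.
move=> [C C0 h] mn; exists C => // d d0 d1; have [h1 h2] := h d d0 d1.
have dnm : d ^+ n <= d ^+ m by apply: ler_wiXn2l ; [exact: ltW|exact: le_trans d1 delta0_le1|].
have Cnm : C * d ^+ n <= C * d ^+ m by exact: ler_wpM2l.
split=> [p /h1|p q M hp hq M0 /(h2 _ _ _ hp hq M0)] H; apply: le_trans H _ => //.
exact: ler_wpM2r.
Qed.

(** Agreement on the ball is enough, so identities may divide by [cos r] and by the conformal
    factor, which may vanish elsewhere. *)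
Lemma order_ext n F G : order_at0 n F ->
  (forall p, in_ball delta0 p -> G p = F p) -> order_at0 n G.
Proof.
move=> [C C0 h] e; exists C => // d d0 d1; have [h1 h2] := h d d0 d1.
have e' p : in_ball d p -> G p = F p.
  by move=> hp; apply: e => i; have [? ?] := hp i; split; lra.
by split=> [p hp|p q M hp hq]; rewrite !e' //; [exact: h1|exact: h2].
Qed.

Lemma order_cst c : order_at0 0 (fun=> c).
Proof.
exists `|c| => // d d0 d1; split=> [p _|p q M _ _ M0 _].
  by rewrite expr0 mulr1.
by rewrite subrr normr0 mulr0 expr0 mulr1 mulr_ge0.
Qed.

Lemma order_add n m F G : order_at0 n F -> order_at0 m G ->
  order_at0 (minn n m) (fun p => F p + G p).
Proof.
move=> hF hG.
have [C C0 h] := order_le _ _ _ hF (geq_minl n m).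
have [D D0 g] := order_le _ _ _ hG (geq_minr n m).
exists (C + D); first exact: addr_ge0.
move=> d d0 d1; have [h1 h2] := h d d0 d1; have [g1 g2] := g d d0 d1.
split=> [p hp|p q M hp hq M0 cl].
  by rewrite mulrDl (le_trans (ler_normD _ _)) // lerD ?h1 ?g1.
have := h2 p q M hp hq M0 cl; have := g2 p q M hp hq M0 cl.
rewrite opprD addrACA; have := ler_normD (F p - F q) (G p - G q).
move=> /(ler_wpM2l (ltW d0)); rewrite mulrDr; nra.
Qed.

Lemma order_opp n F : order_at0 n F -> order_at0 n (fun p => - F p).
Proof.
move=> [C C0 h]; exists C => // d d0 d1; have [h1 h2] := h d d0 d1.
split=> [p hp|p q M hp hq M0 cl]; first by rewrite normrN; exact: h1.
by rewrite -opprD normrN; exact: h2.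
Qed.

(** Leibniz rule for differences. It makes orders additive, so that estimating the acceleration
    becomes a matter of counting factors. *)
Lemma order_mul n m F G : order_at0 n F -> order_at0 m G ->
  order_at0 (n + m) (fun p => F p * G p).
Proof.
move=> [C C0 h] [D D0 g]; exists (2 * C * D); first by rewrite !mulr_ge0.
move=> d d0 d1; have [h1 h2] := h d d0 d1; have [g1 g2] := g d d0 d1.
have dn : 0 <= d ^+ n by rewrite exprn_ge0 // ltW.
have dm : 0 <= d ^+ m by rewrite exprn_ge0 // ltW.
have Cn : 0 <= C * d ^+ n by rewrite mulr_ge0.
have Dm : 0 <= D * d ^+ m by rewrite mulr_ge0.
rewrite exprD.
split=> [p hp|p q M hp hq M0 cl].
  have : `|F p * G p| <= (C * d ^+ n) * (D * d ^+ m).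
    by rewrite normrM ler_pM ?h1 ?g1.
  have : 0 <= (C * d ^+ n) * (D * d ^+ m) by rewrite mulr_ge0.
  lra.
have -> : F p * G p - F q * G q = (F p - F q) * G p + F q * (G p - G q) by ring.
have := ler_normD ((F p - F q) * G p) (F q * (G p - G q)).
rewrite !normrM => /(ler_wpM2l (ltW d0)) H; apply: le_trans H _.
have e1 : d * `|F p - F q| * `|G p| <= (C * d ^+ n * M) * (D * d ^+ m).
  apply: ler_pM => //; [by rewrite mulr_ge0 // ltW|exact: h2|exact: g1].
have e2 : `|F q| * (d * `|G p - G q|) <= (C * d ^+ n) * (D * d ^+ m * M).
  by apply: ler_pM => //; [by rewrite mulr_ge0 // ltW|exact: h1|exact: g2].
lra.
Qed.

(** 1 / F p - 1 / F q = (F q - F p) / (F p F q), and each inverse is at most 2, whence the factor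
    4. *)
Lemma order_inv F : order_at0 0 F ->
  (forall p, in_ball delta0 p -> 2^-1 <= F p) -> order_at0 0 (fun p => (F p)^-1).
Proof.
move=> [C C0 h] hF; exists (4 * C + 2); first lra.
move=> d d0 d1; have [_ h2] := h d d0 d1.
have hF' p : in_ball d p -> 2^-1 <= F p.
  by move=> hp; apply: hF => i; have [? ?] := hp i; split; lra.
have inv2 p : in_ball d p -> 0 <= (F p)^-1 <= 2.
  move=> /hF' hp; have F0 : 0 < F p by lra.
  by rewrite invr_ge0 (ltW F0) /= -[2]invrK lef_pV2 // posrE invr_gt0.
rewrite expr0; split=> [p hp|p q M hp hq M0 cl].
  by have /andP[i1 i2] := inv2 p hp; rewrite ger0_norm //; lra.
have F1 := hF' p hp; have F2 := hF' q hq.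
have -> : (F p)^-1 - (F q)^-1 = (F q - F p) * ((F p)^-1 * (F q)^-1).
  by field; apply/andP; split; apply/eqP; lra.
rewrite normrM distrC mulrA.
have := h2 p q M hp hq M0 cl; rewrite expr0 mulr1 => H.
have /andP[i1 i2] := inv2 p hp; have /andP[j1 j2] := inv2 q hq.
have CM : 0 <= C * M by rewrite mulr_ge0.
apply: (@le_trans _ _ (C * M * 4)); last by nra.
apply: ler_pM => //; first by rewrite mulr_ge0 // ltW.
rewrite ger0_norm ?mulr_ge0 // (_ : 4 = 2 * 2); last by ring.
exact: ler_pM.
Qed.

Lemma order_fst i : order_at0 1 (fun p => p.1 i).
Proof.
exists 1 => // d d0 d1; split=> [p hp|p q M hp hq M0 cl].
  by rewrite mul1r; have [] := hp i.
by rewrite mul1r expr1 ler_pM2l //; have [] := cl i.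
Qed.

Lemma order_snd i : order_at0 1 (fun p => p.2 i).
Proof.
exists 1 => // d d0 d1; split=> [p hp|p q M hp hq M0 cl].
  by rewrite mul1r; have [] := hp i.
by rewrite mul1r expr1 ler_pM2l //; have [] := cl i.
Qed.

Lemma order_sin i : order_at0 1 (fun p => sin (p.1 i)).
Proof.
exists 1 => // d d0 d1; split=> [p hp|p q M hp hq M0 cl].
  by rewrite mul1r; have [? _] := hp i; have := sin_lip (p.1 i) 0; rewrite sin0 !subr0; lra.
rewrite mul1r expr1 ler_pM2l //; have [? _] := cl i.
exact: le_trans (sin_lip _ _) _.
Qed.

Lemma order_sin_sub i : order_at0 2 (fun p => sin (p.1 i) - p.1 i).
Proof.
exists 1 => // d d0 d1; split=> [p hp|p q M hp hq M0 cl].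
  have [? _] := hp i; rewrite mul1r (le_trans (sin_sub_le _)) //.
  by rewrite lerXn2r ?nnegrE // ltW.
have [? _] := hp i; have [? _] := hq i; have [? _] := cl i.
rewrite mul1r expr2 -mulrA ler_pM2l //.
apply: le_trans (sin_sub_lip d _ _ _ _) _ => //.
by rewrite ler_pM2l.
Qed.

(** Order 1 instead of the true order 2 suffices: in the remainder of the acceleration this term
    always comes with three more small factors. *)
Lemma order_cos_sub1 i : order_at0 1 (fun p => cos (p.1 i) - 1).
Proof.
exists 1 => // d d0 d1; split=> [p hp|p q M hp hq M0 cl].
  by have [? _] := hp i; rewrite mul1r (le_trans (cos_sub1_le _)).
have [? _] := cl i; rewrite mul1r expr1 ler_pM2l //.
by rewrite opprD addrACA subrr addr0 (le_trans (cos_lip _ _)).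
Qed.

Lemma order_cos i : order_at0 0 (fun p => cos (p.1 i)).
Proof.
have := order_add _ _ _ _ (order_cos_sub1 i) (order_cst 1).
by move/order_ext; apply => p _; rewrite subrK.
Qed.

End Weighted.

(** * Geodesic flow near the origin *)

Ltac order_at0_tac := repeat first
  [ eassumption | apply: order_cst | apply: order_fst | apply: order_snd
  | apply: order_sin_sub | apply: order_cos_sub1
  | apply: order_sin | apply: order_cos
  | apply: order_add | apply: order_mul | apply: order_opp ].

Lemma ord3_case (P : 'I_3 -> Prop) : P 0 -> P 1 -> P 2 -> forall i, P i.
Proof.
move=> h0 h1 h2 [[|[|[|//]]] hi].
- by rewrite (_ : Ordinal hi = 0) //; exact: val_inj.
- by rewrite (_ : Ordinal hi = 1) //; exact: val_inj.
- by rewrite (_ : Ordinal hi = 2) //; exact: val_inj.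
Qed.

Section GeodesicField.
Context {R : realType}.
Variable k : R.
Implicit Types a b : 'I_3 -> R.

(* The geodesic acceleration of the metric phi^-2 (dr^2 + cos^2 r dtheta^2)
   + phi^2 dxi^2 with phi = 1 + k r theta, at position [a] and velocity [b]. *)
Definition geo_acc a b (i : 'I_3) : R :=
  let r := a 0 in let th := a 1 in
  let u := b 0 in let v := b 1 in let w := b 2 in
  let ph := 1 + k * (r * th) in let c := cos r in let s := sin r in
  if i == 0 then
    k * ph^-1 * (2 * (th * u + r * v) * u - th * (u * u + c * c * (v * v)))
    - c * s * (v * v) + k * th * (ph * ph * ph) * (w * w)
  else if i == 1 then
    k * ph^-1 * (2 * (th * u + r * v) * v - r * (u * u * (c^-1 * c^-1) + v * v))
    + 2 * (s * c^-1) * (u * v) + k * r * (ph * ph * ph) * (w * w) * (c^-1 * c^-1)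
  else - 2 * k * ph^-1 * (th * u + r * v) * w.

(** Third-order part of [geo_acc] at the origin: the conformal factor and [cos r] become 1, [sin r]
    becomes r. It is linear in the position and quadratic in the velocity. *)
Definition geo_acc_cubic a b (i : 'I_3) : R :=
  let r := a 0 in let th := a 1 in
  let u := b 0 in let v := b 1 in let w := b 2 in
  if i == 0 then
    k * (2 * (th * u + r * v) * u - th * (u * u + v * v) + th * (w * w)) - r * (v * v)
  else if i == 1 then
    k * (2 * (th * u + r * v) * v - r * (u * u + v * v) + r * (w * w)) + 2 * r * (u * v)
  else - 2 * k * (th * u + r * v) * w.

(** For coordinates below this radius the conformal factor and [cos r] are both at least 1/2. It
    depends on |k| alone, hence is the same for k and for every kappa. *)
Definition geo_radius : R := (2 * (1 + `|k|))^-1.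

Lemma geo_radius_gt0 : 0 < geo_radius.
Proof. by rewrite invr_gt0 mulr_gt0 // ltr_pwDl. Qed.

Lemma geo_radius_le : geo_radius <= 2^-1.
Proof.
by rewrite lef_pV2 ?posrE ?mulr_gt0 ?ltr_pwDl // ler_peMr // lerDl.
Qed.

Lemma geo_radius_k : `|k| * geo_radius <= 2^-1.
Proof.
rewrite /geo_radius ler_pdivrMr ?mulr_gt0 ?ltr_pwDl //.
by have := normr_ge0 k; lra.
Qed.

Lemma phi_ge_half (r th : R) : `|r| <= geo_radius -> `|th| <= geo_radius ->
  2^-1 <= 1 + k * (r * th).
Proof.
move=> hr ht; suff : `|k * (r * th)| <= 2^-1.
  by rewrite ler_norml => /andP[? _]; lra.
rewrite normrM normrM mulrA.
have h1 : `|k| * `|r| <= 2^-1.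
  by apply: le_trans geo_radius_k; exact: ler_wpM2l.
have h2 : `|th| <= 1 by have := geo_radius_le; lra.
by rewrite -[2^-1]mulr1; apply: ler_pM => //; rewrite mulr_ge0.
Qed.

Lemma cos_ge_half (r : R) : `|r| <= geo_radius -> 2^-1 <= cos r.
Proof.
move=> hr; have := cos_sub1_le r; rewrite ler_norml => /andP[? _].
by have := geo_radius_le; lra.
Qed.

Notation order := (@order_at0 R 'I_3 geo_radius).

Lemma geo_radius_le1 : geo_radius <= 1.
Proof. by have := geo_radius_le; lra. Qed.

Lemma order_invphi : order 0 (fun p => (1 + k * (p.1 0 * p.1 1))^-1).
Proof.
have h3 := geo_radius_le1.
apply: order_inv; first by apply: (order_le _ geo_radius_le1); [order_at0_tac|].
by move=> p hp; apply: phi_ge_half; [exact: (hp 0).1|exact: (hp 1).1].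
Qed.

Lemma order_invcos : order 0 (fun p => (cos (p.1 0))^-1).
Proof.
have h3 := geo_radius_le1.
apply: order_inv; first by order_at0_tac.
by move=> p hp; apply: cos_ge_half; exact: (hp 0).1.
Qed.

Lemma order_geo_acc i : order 3 (fun p => geo_acc p.1 p.2 i).
Proof.
have h1 := order_invphi; have h2 := order_invcos; have h3 := geo_radius_le1.
move: i; apply: ord3_case; rewrite /geo_acc /=; 
  by (apply: (order_le _ geo_radius_le1); [order_at0_tac|]).
Qed.

(** Each simplification leaves a factor of positive order: 1/ph - 1 = - k r theta / ph, ph^3 - 1 = k
    r theta (ph^2 + ph + 1), c s - r = (c - 1) s + (s - r), while c^2 - 1 and c^-2 - 1 are multiples
    of c - 1. The explicit expressions in the proof group the difference in this way, and the order
    is then read off the factors. *)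
Lemma order_geo_acc_cubic i :
  order 4 (fun p => geo_acc p.1 p.2 i - geo_acc_cubic p.1 p.2 i).
Proof.
have h1 := order_invphi; have h2 := order_invcos; have h3 := geo_radius_le1.
have nz p : in_ball geo_radius p ->
    1 + k * (p.1 0 * p.1 1) != 0 /\ cos (p.1 0) != 0.
  move=> hp; have := phi_ge_half _ _ (hp 0).1 (hp 1).1.
  by have := cos_ge_half _ (hp 0).1; split; apply/eqP; lra.
pose ph (p : ('I_3 -> R) * ('I_3 -> R)) := 1 + k * (p.1 0 * p.1 1).
pose c (p : ('I_3 -> R) * ('I_3 -> R)) := cos (p.1 0).
pose s (p : ('I_3 -> R) * ('I_3 -> R)) := sin (p.1 0).
pose sr (p : ('I_3 -> R) * ('I_3 -> R)) := sin (p.1 0) - p.1 0.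
pose c1 (p : ('I_3 -> R) * ('I_3 -> R)) := cos (p.1 0) - 1.
move: i; apply: ord3_case.
- apply: (@order_ext _ _ _ _ (fun p =>
    k * (- (k * (p.1 0 * p.1 1)) * (ph p)^-1) *
      (2 * (p.1 1 * p.2 0 + p.1 0 * p.2 1) * p.2 0
       - p.1 1 * (p.2 0 * p.2 0 + c p * c p * (p.2 1 * p.2 1)))
    - k * p.1 1 * (c1 p * (c p + 1)) * (p.2 1 * p.2 1)
    - (c1 p * s p + sr p) * (p.2 1 * p.2 1)
    + k * p.1 1 * (k * (p.1 0 * p.1 1) * (ph p * ph p + ph p + 1)) *
        (p.2 2 * p.2 2))); last first.
    move=> p /nz [n1 n2]; rewrite /geo_acc /geo_acc_cubic /= /c1 /sr /ph /c /s.
    by field.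
  rewrite /ph /c /s /sr /c1.
  by apply: (order_le _ geo_radius_le1); [order_at0_tac|].
- apply: (@order_ext _ _ _ _ (fun p =>
    k * (- (k * (p.1 0 * p.1 1)) * (ph p)^-1) *
      (2 * (p.1 1 * p.2 0 + p.1 0 * p.2 1) * p.2 1
       - p.1 0 * (p.2 0 * p.2 0 * ((c p)^-1 * (c p)^-1) + p.2 1 * p.2 1))
    + k * p.1 0 * (p.2 0 * p.2 0) * (c1 p * (c p)^-1 * ((c p)^-1 + 1))
    + 2 * (sr p - s p * (c1 p) * (c p)^-1) * (p.2 0 * p.2 1)
    + k * p.1 0 * (p.2 2 * p.2 2) *
      (k * (p.1 0 * p.1 1) * (ph p * ph p + ph p + 1) * ((c p)^-1 * (c p)^-1)
       - c1 p * (c p)^-1 * ((c p)^-1 + 1)))); last first.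
    move=> p /nz [n1 n2]; rewrite /geo_acc /geo_acc_cubic /= /c1 /sr /ph /c /s.
    by field; apply/andP.
  rewrite /ph /c /s /sr /c1.
  by apply: (order_le _ geo_radius_le1); [order_at0_tac|].
- apply: (@order_ext _ _ _ _ (fun p =>
    - 2 * k * (- (k * (p.1 0 * p.1 1)) * (ph p)^-1) *
      (p.1 1 * p.2 0 + p.1 0 * p.2 1) * p.2 2)); last first.
    move=> p /nz [n1 n2]; rewrite /geo_acc /geo_acc_cubic /= /ph.
    by field.
  rewrite /ph.
  by apply: (order_le _ geo_radius_le1); [order_at0_tac|].
Qed.

End GeodesicField.

Section Flow.
Context {R : realType}.
Variable k : R.
Implicit Types (v w : 'I_3 -> R).

(** Dividing the difference estimate by d turns order 3 into a Lipschitz constant C d^2, small with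
    d; this is how the truncated field can meet the bound 1/16 of the existence theorem. *)
Lemma geo_acc_bounds : exists2 C : R, 0 <= C &
  forall d : R, 0 < d -> d <= geo_radius k -> forall i p q M,
    in_ball d p -> in_ball d q -> 0 <= M -> close M p q ->
    [/\ `|geo_acc k p.1 p.2 i| <= C * d ^+ 3,
        `|geo_acc k p.1 p.2 i - geo_acc k q.1 q.2 i| <= C * d ^+ 2 * M &
        `|geo_acc k p.1 p.2 i - geo_acc_cubic k p.1 p.2 i| <= C * d ^+ 4].
Proof.
have h3 i := order_geo_acc k i; have h4 i := order_geo_acc_cubic k i.
have [C0 C00 H0] := h3 0; have [C1 C10 H1] := h3 1; have [C2 C20 H2] := h3 2.
have [D0 D00 G0] := h4 0; have [D1 D10 G1] := h4 1; have [D2 D20 G2] := h4 2.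
pose C := C0 + C1 + C2 + D0 + D1 + D2.
exists C; first by rewrite /C !addr_ge0.
move=> d d0 d1 i p q M hp hq M0 cl.
have H : exists2 B, B <= C & `|geo_acc k p.1 p.2 i| <= B * d ^+ 3 /\
    d * `|geo_acc k p.1 p.2 i - geo_acc k q.1 q.2 i| <= B * d ^+ 3 * M.
  move: i; apply: ord3_case; [exists C0|exists C1|exists C2]; rewrite /C; try lra.
  - by have [h h'] := H0 d d0 d1; split; [exact: h|exact: h'].
  - by have [h h'] := H1 d d0 d1; split; [exact: h|exact: h'].
  - by have [h h'] := H2 d d0 d1; split; [exact: h|exact: h'].
have G : exists2 B, B <= C &
    `|geo_acc k p.1 p.2 i - geo_acc_cubic k p.1 p.2 i| <= B * d ^+ 4.
  move: i {H}; apply: ord3_case; [exists D0|exists D1|exists D2]; rewrite /C; try lra.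
  - exact: (G0 d d0 d1).1.
  - exact: (G1 d d0 d1).1.
  - exact: (G2 d d0 d1).1.
have dn n : 0 <= d ^+ n by rewrite exprn_ge0 // ltW.
have [B BC [B1 B2]] := H; have [E EC E1] := G; split.
- by apply: le_trans B1 _; exact: ler_wpM2r.
- rewrite -(ler_pM2l d0); apply: le_trans B2 _.
  have -> : d * (C * d ^+ 2 * M) = C * d ^+ 3 * M by ring.
  by rewrite ler_wpM2r // ler_wpM2r.
- by apply: le_trans E1 _; exact: ler_wpM2r.
Qed.

(** Truncation at m of positions and velocities; a solution that stays below m solves the original
    equation. *)
Definition geo_field (m : R) (a b : 'I_3 -> R) :=
  geo_acc k (fun j => clamp m (a j)) (fun j => clamp m (b j)).

Lemma geo_field_id m a b : (forall i, `|a i| <= m) -> (forall i, `|b i| <= m) ->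
  geo_field m a b = geo_acc k a b.
Proof.
move=> ha hb; rewrite /geo_field; congr geo_acc; apply/funext => j; exact: clamp_id.
Qed.

(** Every term of the acceleration contains r, theta or one of their velocities, so the xi-line
    through the origin is a geodesic. It is the reference curve for the horizontal motion. *)
Lemma geo_field_vertical m (z s : R) : 0 <= m -> 
  geo_field m (fun i => if i == 2 then s else 0) (fun i => if i == 2 then z else 0)
  = fun=> 0.
Proof.
move=> m0; have cl0 : clamp m 0 = 0 by rewrite clamp_id // normr0.
by apply/funext; apply: ord3_case; rewrite /geo_field /geo_acc /= !cl0; ring.
Qed.

Lemma second_order_sol_field m (c d : 'I_3 -> R -> R) s : (forall i, `|c i s| <= m) ->
  (forall i, `|d i s| <= m) ->
  second_order_sol (geo_acc k) c d s <-> second_order_sol (geo_field m) c d s.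
Proof. by move=> hc hd; rewrite /second_order_sol geo_field_id. Qed.

(** Linearity in the position; integrating s twice in time gives s^3 / 6, the origin of the divisor
    6. *)
Lemma cubic_scale s v i :
  geo_acc_cubic k (fun j => s * v j) v i = s * geo_acc_cubic k v v i.
Proof. by move: i; apply: ord3_case; rewrite /geo_acc_cubic /=; ring. Qed.

(** Bootstrap: an acceleration of at most C (4 tau)^3 = 64 C tau^3 keeps velocity and position that
    close to v and s v. The Lipschitz bound C (4 tau)^2 then gives an error 1024 C^2 tau^5, the part
    beyond the cubic one C (4 tau)^4 = 256 C tau^4, and two integrations over [0, 1] do not increase
    the sum. *)
Lemma cubic_flow_expansion (C tau : R) v (c d : 'I_3 -> R -> R) :
  0 <= C -> 0 < tau -> 4 * tau <= geo_radius k ->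
  (forall d : R, 0 < d -> d <= geo_radius k -> forall i p q M,
    in_ball d p -> in_ball d q -> 0 <= M -> close M p q ->
    [/\ `|geo_acc k p.1 p.2 i| <= C * d ^+ 3,
        `|geo_acc k p.1 p.2 i - geo_acc k q.1 q.2 i| <= C * d ^+ 2 * M &
        `|geo_acc k p.1 p.2 i - geo_acc_cubic k p.1 p.2 i| <= C * d ^+ 4]) ->
  (forall i, `|v i| <= tau) -> (forall i, c i 0 = 0) -> (forall i, d i 0 = v i) ->
  (forall s, 0 <= s <= 1 -> second_order_sol (geo_acc k) c d s) ->
  (forall s i, 0 <= s <= 1 -> `|c i s| <= 4 * tau /\ `|d i s| <= 4 * tau) ->
  forall i, `|c i 1 - v i - geo_acc_cubic k v v i / 6| <=
    (1024 * C ^+ 2 + 256 * C) * tau ^+ 4.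
Proof.
move=> C0 t0 t1 HC hv c0 d0 sol bd i.
have t4 : 0 < 4 * tau by lra.
have tn n : 0 <= tau ^+ n by rewrite exprn_ge0 // ltW.
have in01 : (0 : R) <= 1 by [].
pose P s := (c^~ s, d^~ s).
have ballP s : 0 <= s <= 1 -> in_ball (4 * tau) (P s) by move=> hs j; exact: bd.
have abs01 (s : R) : 0 <= s <= 1 -> `|s| <= 1.
  by move=> /andP[? ?]; rewrite ger0_norm.
have M0 : 0 <= 64 * C * tau ^+ 3 by rewrite mulr_ge0 ?tn // mulr_ge0.
have close0 (p : ('I_3 -> R) * ('I_3 -> R)) : close 0 p p by move=> j; rewrite !subrr normr0.
have accb s j : 0 <= s <= 1 -> `|geo_acc k (c^~ s) (d^~ s) j| <= 64 * C * tau ^+ 3.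
  move=> hs.
  have [h _ _] := HC _ t4 t1 j (P s) (P s) 0 (ballP s hs) (ballP s hs) (lexx _) (close0 _).
  by apply: le_trans h _; rewrite exprMn; lra.
have dv s j : 0 <= s <= 1 -> `|d j s - v j| <= 64 * C * tau ^+ 3.
  move=> hs; have := @mean_value_ineq _ (d j) (fun s => geo_acc k (c^~ s) (d^~ s) j)
    0 1 (64 * C * tau ^+ 3) (lexx _) in01 (fun s hs => (sol s hs j).2)
    (fun s => accb s j) s hs.
  rewrite d0 => h; apply: le_trans h _; by apply: ler_piMr; [exact: M0|exact: abs01].
have csv s j : 0 <= s <= 1 -> `|c j s - s * v j| <= 64 * C * tau ^+ 3.
  move=> hs; have := @mean_value_ineq _ (fun s => c j s - s * v j) (fun s => d j s - v j)
    0 1 (64 * C * tau ^+ 3) (lexx _) in01 _ (fun s => dv s j) s hs.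
  rewrite c0 mul0r !subr0 => h; apply: le_trans (h _) _.
    move=> x hx; have hcx := (sol x hx j).1.
    by apply: der_eq; [apply: derB; [exact: hcx|apply: derM; [exact: derid|exact: derc]]
                      |rewrite /=; ring].
  by apply: ler_piMr; [exact: M0|exact: abs01].
have tau1 : tau <= 1 by have := geo_radius_le1 k; lra.
pose B := (1024 * C ^+ 2 + 256 * C) * tau ^+ 4.
have acc2 s : 0 <= s <= 1 ->
    `|geo_acc k (c^~ s) (d^~ s) i - s * geo_acc_cubic k v v i| <= B.
  move=> hs; pose q : ('I_3 -> R) * ('I_3 -> R) := (fun j => s * v j, v).
  have hq : in_ball (4 * tau) q.
    move=> j; split => /=; last by have := hv j; lra.
    rewrite normrM; have := hv j; have := normr_ge0 (v j).
    by move: hs => /andP[s0 s1]; rewrite (ger0_norm s0); nra.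
  have hcl : close (64 * C * tau ^+ 3) (P s) q.
    by move=> j; split; [exact: csv|exact: dv].
  have [_ h1 _] := HC _ t4 t1 i (P s) q _ (ballP s hs) hq M0 hcl.
  have [_ _ h2] := HC _ t4 t1 i q q 0 hq hq (lexx _) (close0 _).
  rewrite -cubic_scale.
  have -> : geo_acc k (c^~ s) (d^~ s) i - geo_acc_cubic k (fun j => s * v j) v i =
    (geo_acc k (c^~ s) (d^~ s) i - geo_acc k q.1 q.2 i) +
    (geo_acc k q.1 q.2 i - geo_acc_cubic k q.1 q.2 i) by rewrite /q /=; ring.
  apply: le_trans (ler_normD _ _) _.
  have e : C * (4 * tau) ^+ 2 * (64 * C * tau ^+ 3) = 1024 * C ^+ 2 * tau ^+ 4 * tau by ring.
  have : 1024 * C ^+ 2 * tau ^+ 4 * tau <= 1024 * C ^+ 2 * tau ^+ 4.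
    have X0 : 0 <= C ^+ 2 * tau ^+ 4 by rewrite mulr_ge0 ?sqr_ge0.
    have := ler_piMr X0 tau1; lra.
  move: h1 h2; rewrite /P /= e exprMn /B => h1 h2; lra.
have B0 : 0 <= B.
  rewrite /B; apply: mulr_ge0; last exact: tn.
  by have := sqr_ge0 C; lra.
have h1 s : 0 <= s <= 1 ->
    `|d i s - v i - s ^+ 2 * geo_acc_cubic k v v i / 2| <= B.
  move=> hs; have := @mean_value_ineq _
    (fun s => d i s - v i - s ^+ 2 * geo_acc_cubic k v v i / 2)
    (fun s => geo_acc k (c^~ s) (d^~ s) i - s * geo_acc_cubic k v v i)
    0 1 B (lexx _) in01 _ acc2 s hs.
  rewrite d0 subrr expr0n /= !mul0r !subr0 => h; apply: le_trans (h _) _.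
    move=> x hx; have hcx := (sol x hx i).2.
    by apply: der_eq; [apply: derB; [apply: derB; [exact: hcx|exact: derc]|
      apply: derM; [apply: derM; [apply: derX; exact: derid|exact: derc]|exact: derc]]
      |rewrite /=; field].
  by apply: ler_piMr; [exact: B0|exact: abs01].
have := @mean_value_ineq _
    (fun s => c i s - s * v i - s ^+ 3 * geo_acc_cubic k v v i / 6)
    (fun s => d i s - v i - s ^+ 2 * geo_acc_cubic k v v i / 2)
    0 1 B (lexx _) in01 _ h1 1.
rewrite c0 expr0n /= !mul0r !subr0 expr1n !mul1r normr1 mulr1; apply.
  move=> x hx; have hcx := (sol x hx i).1.
  by apply: der_eq; [apply: derB; [apply: derB; [exact: hcx|
      apply: derM; [exact: derid|exact: derc]]|
      apply: derM; [apply: derM; [apply: derX; exact: derid|exact: derc]|exact: derc]]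
      |rewrite /=; field].
by rewrite in01 /=.
Qed.


End Flow.

Section FlowExistence.
Context {R : realType}.
Variable k : R.
Implicit Types (v w : 'I_3 -> R).

(** Here [c] and [d] are position and velocity as functions of the initial velocity. [flow_dist]
    makes the time-one map a Lipschitz perturbation of the identity. Times up to 3/2 on both sides
    leave room around [0, 1]. [flow_horizontal] bounds the deviation by the horizontal velocity D
    however large [v 2] is, which keeps directions close to the xi-axis inside the cone. *)
Record is_flow (eps m C : R) (c d : ('I_3 -> R) -> 'I_3 -> R -> R) : Prop := IsFlow {
  flow_lip : lipschitz_field eps (geo_field k m);
  flow_pos0 : forall v i, c v i 0 = 0;
  flow_vel0 : forall v i, d v i 0 = v i;
  flow_sol : forall v s, -2 < s < 2 -> second_order_sol (geo_field k m) (c v) (d v) s;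
  flow_dist : forall v w D, (forall i, `|v i - w i| <= D) ->
    forall i, `|c v i 1 - c w i 1 - (v i - w i)| <= D / 2;
  flow_small : forall v tau s i, (forall i, `|v i| <= tau) -> `|s| <= 3 / 2 ->
    `|c v i s| <= 4 * tau /\ `|d v i s| <= 4 * tau;
  flow_cubic : forall v tau, 0 < tau -> 4 * tau <= m -> (forall i, `|v i| <= tau) ->
    forall i, `|c v i 1 - v i - geo_acc_cubic k v v i / 6| <= C * tau ^+ 4;
  flow_horizontal : forall v D s i, `|v 0| <= D -> `|v 1| <= D -> i != 2 ->
    `|s| <= 3 / 2 -> `|c v i s - s * v i| <= 8 * eps * D * `|s| }.

Lemma vertical_sol m z s : 0 <= m ->
  second_order_sol (geo_field k m) (fun i s => if i == 2 then s * z else 0)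
    (fun i _ => if i == 2 then z else 0) s.
Proof.
move=> m0 i; rewrite geo_field_vertical //; split; last exact: derc.
move: i; apply: ord3_case => /=; [exact: derc|exact: derc|].
by apply: der_eq; [apply: derM; [exact: derid|exact: derc]|rewrite /=; ring].
Qed.

Theorem geo_flow_exists eps : 0 < eps -> eps <= 1 / 16 ->
  exists m C c d, [/\ 0 < m, m <= geo_radius k, 0 <= C & is_flow eps m C c d].
Proof.
move=> e0 e1; have [C C0 HC] := geo_acc_bounds k.
(* The Lipschitz constant at radius m <= 1 is C m^2 <= C m <= eps. *)
pose m := Num.min (geo_radius k) (eps / (C + 1)).
have m0 : 0 < m by rewrite lt_min geo_radius_gt0 divr_gt0 // ltr_wpDl.
have mr : m <= geo_radius k by rewrite ge_min lexx.
have m1 : m <= 1 by exact: le_trans mr (geo_radius_le1 k).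
have Cm : C * m ^+ 2 <= eps.
  have : m <= eps / (C + 1) by rewrite ge_min lexx orbT.
  rewrite ler_pdivlMr ?ltr_wpDl // => h.
  have : m * m <= m by rewrite ler_piMr // ltW.
  by rewrite expr2; nra.
have lip : lipschitz_field eps (geo_field k m).
  move=> a a' b b' M M0 ha hb i.
  have hball (x y : 'I_3 -> R) :
      in_ball m (fun j => clamp m (x j), fun j => clamp m (y j)).
    by move=> j; split; apply: clamp_bound; exact: ltW.
  have hcl : close M (fun j => clamp m (a j), fun j => clamp m (b j))
                     (fun j => clamp m (a' j), fun j => clamp m (b' j)).
    by move=> j; split; apply: le_trans (clamp_lip _ _ _ (ltW m0)) _; [exact: ha|exact: hb].
  have [_ h _] := HC m m0 mr i _ _ M (hball a b) (hball a' b') M0 hcl.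
  by apply: le_trans h _; rewrite ler_wpM2r.
have ex v : exists cd : ('I_3 -> R -> R) * ('I_3 -> R -> R),
    [/\ forall i, cd.1 i 0 = 0, forall i, cd.2 i 0 = v i &
    forall s, -2 < s < 2 -> second_order_sol (geo_field k m) cd.1 cd.2 s].
  have [c [d h]] := second_order_ode_exists eps (geo_field k m) v (ltW e0) e1 lip.
  by exists (c, d).
have [cd hcd] := choice ex.
pose c v := (cd v).1; pose d v := (cd v).2.
have in2 (s : R) : - (3 / 2) <= s <= 3 / 2 -> -2 < s < 2.
  by move=> /andP[? ?]; apply/andP; split; lra.
have [h1 h2 h3] : [/\ (- 2 : R) <= - (3 / 2), - (3 / 2) <= (0 : R) & 3 / 2 <= (2 : R)].
  by split; lra.
have h4 : 0 <= (3 / 2 : R) by lra.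
have c0 v i : c v i 0 = 0 by have [h _ _] := hcd v; exact: h.
have d0 v i : d v i 0 = v i by have [_ h _] := hcd v; exact: h.
have sol v s : -2 < s < 2 -> second_order_sol (geo_field k m) (c v) (d v) s.
  by have [_ _ h] := hcd v; exact: h.
(* Comparison with the vertical geodesic of speed z: z = 0 bounds the size of the solution, z =
   [v 2] isolates its horizontal part. *)
have distV v z D s i : `|v 0| <= D -> `|v 1| <= D -> `|v 2 - z| <= D -> `|s| <= 3 / 2 ->
    `|d v i s - (if i == 2 then z else 0)| <= 2 * D /\
    `|c v i s - (if i == 2 then s * z else 0) - s * (v i - (if i == 2 then z else 0))|
      <= 8 * eps * D * `|s|.
  move=> v0 v1 v2; rewrite ler_norml => hs.
  have [] := second_order_sol_dist eps D (- (3 / 2)) (3 / 2) _ (c v) (d v)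
    (fun i s => if i == 2 then s * z else 0) (fun i _ => if i == 2 then z else 0)
    (ltW e0) e1 lip h1 h2 h4 h3 (fun s hs => sol v s (in2 s hs))
    (fun s _ => vertical_sol m z s (ltW m0)) (c0 v) _ _ s i hs.
  - by move=> j; case: ifP => //; rewrite mul0r.
  - by move=> j; rewrite d0; move: j; apply: ord3_case; rewrite /= ?subr0.
  by rewrite d0.
have small v tau s i : (forall i, `|v i| <= tau) -> `|s| <= 3 / 2 ->
    `|c v i s| <= 4 * tau /\ `|d v i s| <= 4 * tau.
  move=> hv hs; have v2 : `|v 2 - 0| <= tau by rewrite subr0.
  have [] := distV v 0 tau s i (hv 0) (hv 1) v2 hs.
  have t0 : 0 <= tau by exact: le_trans (normr_ge0 _) (hv 0).
  rewrite mulr0 !if_same !subr0 => dd cc; split; last lra.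
  have := ler_normD (c v i s - s * v i) (s * v i); rewrite subrK normrM.
  have := hv i; have := normr_ge0 (v i); have := normr_ge0 s.
  have : eps * tau <= 1 / 16 * tau by exact: ler_wpM2r.
  have : 0 <= eps * tau by rewrite mulr_ge0 // ltW.
  nra.
have [K K0 hK] : exists2 K, 0 <= K & K = 1024 * C ^+ 2 + 256 * C.
  by exists (1024 * C ^+ 2 + 256 * C); [have := sqr_ge0 C; lra|].
exists m, K, c, d; split => //; split => //.
- move=> v w D hD i.
  have in1 : - (3 / 2) <= (1 : R) <= 3 / 2 by apply/andP; split; lra.
  have [] := second_order_sol_dist eps D (- (3 / 2)) (3 / 2) _ (c v) (d v) (c w) (d w)
    (ltW e0) e1 lip h1 h2 h4 h3 (fun s hs => sol v s (in2 s hs))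
    (fun s hs => sol w s (in2 s hs)) (c0 v) (c0 w) _ 1 i in1.
    by move=> j; rewrite !d0.
  rewrite !d0 mul1r normr1 mulr1 => _ _ h; apply: le_trans h _.
  have D0 : 0 <= D by exact: le_trans (normr_ge0 _) (hD 0).
  have : eps * D <= 1 / 16 * D by exact: ler_wpM2r.
  lra.
- move=> v tau t0 t4 hv i.
  have in32 (s : R) : 0 <= s <= 1 -> `|s| <= 3 / 2.
    by move=> /andP[? ?]; rewrite ger0_norm //; lra.
  rewrite hK; apply: (@cubic_flow_expansion _ k C tau v (c v) (d v)) => //.
  + exact: le_trans t4 mr.
  + move=> s hs; have hb j := small v tau s j hv (in32 s hs).
    apply/(second_order_sol_field k m).
    * by move=> j; apply: le_trans (hb j).1 _.
    * by move=> j; apply: le_trans (hb j).2 _.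
    by apply: sol; move: hs => /andP[? ?]; apply/andP; split; lra.
  + by move=> s j hs; apply: small => //; exact: in32.
- move=> v D s i v0 v1 i2 hs.
  have D0 : 0 <= D by exact: le_trans (normr_ge0 _) v0.
  have v2 : `|v 2 - v 2| <= D by rewrite subrr normr0.
  have [_] := distV v (v 2) D s i v0 v1 v2 hs.
  by rewrite (negbTE i2) !subr0.
Qed.

End FlowExistence.

(** * The chart and the metric on the wedge *)

Section Chart.
Context {R : realType}.
Variables (p e1 e2 : 'rV[R]_3).
Hypothesis frame : orthonormal3 p e1 e2.

Lemma dot_comb (a b c a' b' c' : R) :
  dot (a *: p + b *: e1 + c *: e2) (a' *: p + b' *: e1 + c' *: e2) =
  a * a' + b * b' + c * c'.
Proof.
have [[pp e11 e22] [p1 p2 e12]] := frame.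
transitivity (a * a' * dot p p + b * b' * dot e1 e1 + c * c' * dot e2 e2
  + (a * b' + b * a') * dot p e1 + (a * c' + c * a') * dot p e2
  + (b * c' + c * b') * dot e1 e2); last by rewrite pp e11 e22 p1 p2 e12; ring.
by rewrite /dot !big_ord_recl !big_ord0 !mxE; ring.
Qed.

(** On (-pi, pi) the cosine fixes the absolute value and the sine the sign. *)
Lemma angle_inj (x y : R) : `|x| < pi -> `|y| < pi ->
  cos x = cos y -> sin x = sin y -> x = y.
Proof.
rewrite !ltr_norml => /andP[x1 x2] /andP[y1 y2] hc hs.
have cosn (z : R) : cos `|z| = cos z by case: (ger0P z) => // _; rewrite cosN.
have : `|x| = `|y|.
  apply: cos_inj; rewrite ?in_itv /= ?normr_ge0 ?cosn //= ltW // ltr_norml; apply/andP; split; lra.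
have sgp (z : R) : 0 < z -> z < pi -> 0 < sin z.
  by move=> z0 z1; apply: sin_gt0_pi; rewrite z0 z1.
case: (ltgtP 0 x) => hu; case: (ltgtP 0 y) => hv.
- by rewrite !gtr0_norm.
- rewrite gtr0_norm // ltr0_norm // => ev.
  have := sgp _ hu x2; have := sgp (- y) ltac:(lra) ltac:(lra); rewrite sinN; lra.
- by rewrite -hv normr0 => /normr0_eq0.
- rewrite ltr0_norm // gtr0_norm // => ev.
  have := sgp _ hv y2; have := sgp (- x) ltac:(lra) ltac:(lra); rewrite sinN; lra.
- by rewrite !ltr0_norm // => /oppr_inj.
- by rewrite -hv normr0 => /normr0_eq0.
- by rewrite -hu normr0 => /esym /normr0_eq0.
- by rewrite -hu normr0 => /esym /normr0_eq0.
- by rewrite -hu -hv.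
Qed.

(** Products with p, e1, e2 give cos r cos theta, cos r sin theta and sin r. The sine is injective
    on the range of r, where cos r > 0 can be cancelled. *)
Lemma sphere_chart_inj (u v : R * R) : sphere_dom u -> sphere_dom v ->
  sphere_chart p e1 e2 u.1 u.2 = sphere_chart p e1 e2 v.1 v.2 -> u = v.
Proof.
move=> [u1 u2] [v1 v2] e.
have co a b c : dot (sphere_chart p e1 e2 u.1 u.2) (a *: p + b *: e1 + c *: e2) =
    dot (sphere_chart p e1 e2 v.1 v.2) (a *: p + b *: e1 + c *: e2) by rewrite e.
have h0 := co 1 0 0; have h1 := co 0 1 0; have h2 := co 0 0 1.
rewrite !dot_comb !mulr0 !mulr1 ?addr0 ?add0r in h0 h1 h2.
move: u1 v1 u2 v2; rewrite !ltr_norml => /andP[u1 u1'] /andP[v1 v1'] /andP[u2 u2'] /andP[v2 v2'].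
have er : u.1 = v.1.
  by apply: sin_inj; rewrite // in_itv /=; apply/andP; split; lra.
have cp : 0 < cos u.1 by apply: cos_gt0_pihalf; rewrite u1 u1'.
have hc : cos u.2 = cos v.2.
  by apply: (mulfI (lt0r_neq0 cp)); rewrite h0 er.
have hs : sin u.2 = sin v.2.
  by apply: (mulfI (lt0r_neq0 cp)); rewrite h1 er.
have et : u.2 = v.2 by apply: angle_inj; rewrite ?ltr_norml ?u2 ?v2.
by move: er et; case: (u) (v) => [? ?] [? ?] /= -> ->.
Qed.

Lemma circle_chart_inj (x y : R) : `|x| < pi -> `|y| < pi ->
  circle_chart x = circle_chart y -> x = y.
Proof.
move=> hx hy e.
have hc : cos x = cos y.
  by have := congr1 (fun M : 'rV[R]_2 => M 0 0) e; rewrite !mxE.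
have hs : sin x = sin y.
  by have := congr1 (fun M : 'rV[R]_2 => M 0 1) e; rewrite !mxE.
exact: angle_inj.
Qed.

End Chart.

Section LineDerivative.
Context {R : realType}.

(** Reduces the partial derivatives of the definitions to one-variable derivatives at 0, where [der]
    applies. *)
Lemma deriveE_line (W : normedModType R) (f : 'rV[R]_3 -> W) (v a : 'rV[R]_3) :
  'D_v f a = 'D_1 (fun h : R => f (h *: v + a)) 0.
Proof.
rewrite /derive.
have E : (fun h => h^-1 *: ((f \o shift a) (h *: v) - f a)) =
  (fun h : R => h^-1 *: (((fun h : R => f (h *: v + a)) \o shift (0 : R)) (h *: (1 : R))
     - f (0 *: v + a))).
  by apply/funext => h /=; rewrite addr0 scale0r add0r [h%:A]mulr1.
by rewrite E.
Qed.

Lemma line_derive (f : 'rV[R]_3 -> R) (v a : 'rV[R]_3) (d : R) :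
  has_derive (fun h : R => f (h *: v + a)) 0 d -> 'D_v f a = d.
Proof. by rewrite deriveE_line => -[]. Qed.

Lemma is_derive_row (n : nat) (f : R -> 'rV[R]_n) (x : R) (d : 'rV[R]_n) :
  (forall j, is_derive x 1 (fun h => f h 0 j) (d 0 j)) -> is_derive x 1 f d.
Proof.
move=> hf; have df : derivable f x 1.
  by apply/derivable_mxP => i j; rewrite ord1; case: (hf j).
split => //; rewrite derive_mx //; apply/matrixP => i j; rewrite mxE ord1.
by case: (hf j).
Qed.

Lemma is_derive_row_coord (n : nat) (f : R -> 'rV[R]_n) (x : R) (d : 'rV[R]_n) j :
  is_derive x 1 f d -> is_derive x 1 (fun h => f h 0 j) (d 0 j).
Proof.
move=> [df <-]; split; first exact: (derivable_mxP _ _ _).1 df 0 j.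
by rewrite derive_mx // mxE.
Qed.

Lemma line_derive_row (n : nat) (f : 'rV[R]_3 -> 'rV[R]_n) (v a : 'rV[R]_3)
    (d : 'rV[R]_n) :
  (forall j, has_derive (fun h : R => f (h *: v + a) 0 j) 0 (d 0 j)) -> 'D_v f a = d.
Proof. by rewrite deriveE_line => /is_derive_row[]. Qed.

Lemma e_line (h : R) (i j : 'I_3) (u : 'rV[R]_3) :
  (h *: e_ R i + u) 0 j = h * (j == i)%:R + u 0 j.
Proof. by rewrite !mxE eqxx. Qed.

End LineDerivative.

Section Metric.
Context {R : realType}.
Variables (alpha k : R) (b : R -> R) (chi : R * R -> R) (p e1 e2 : 'rV[R]_3).
Hypothesis frame : orthonormal3 p e1 e2.

Let phi (r th : R) : R :=
  1 + k * chi_rho chi (rho_star alpha k) r th * psi alpha b r th.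

Definition gram_diag (f r : R) (i : 'I_3) : R :=
  if i == 0 then f ^- 2 else if i == 1 then f ^- 2 * cos r ^+ 2 else f ^+ 2.

(** Injectivity of the chart makes the point chosen by [xget] the expected one. *)
Lemma varphi_chart r th : sphere_dom (r, th) ->
  varphi alpha k b chi p e1 e2 (sphere_chart p e1 e2 r th) = phi r th.
Proof.
move=> dom; rewrite /varphi; case: xgetP => [u _ [hu eu]|/(_ (r, th))].
  by have -> : u = (r, th) by exact: (sphere_chart_inj _ _ _ frame _ _ hu dom eu).
by move=> /(_ (conj dom erefl)).
Qed.

Definition chart_frame (r th xi : R) (i : 'I_3) : 'rV[R]_3 * 'rV[R]_2 :=
  if i == 0 then ((- sin r * cos th) *: p + (- sin r * sin th) *: e1 + cos r *: e2, 0)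
  else if i == 1 then
    ((- cos r * sin th) *: p + (cos r * cos th) *: e1 + 0 *: e2, 0)
  else (0 *: p + 0 *: e1 + 0 *: e2, \row_(i < 2) (if i == 0 then - sin xi else cos xi)).

Lemma chart_dE (u : 'rV[R]_3) i :
  chart_d p e1 e2 u i = chart_frame (u 0 0) (u 0 1) (u 0 2) i.
Proof.
move: i; apply: ord3_case; rewrite /chart_d /chart_frame /chart /=; congr pair;
  apply: line_derive_row => j; rewrite /sphere_chart /circle_chart;
  under eq_fun do rewrite !mxE ?e_line; rewrite ?mxE;
  try case: (j == 0); der; rewrite ?mul0r ?mulr0 ?add0r ?mulr1; ring.
Qed.

Lemma gramE (u : 'rV[R]_3) : sphere_dom (u 0 0, u 0 1) ->
  gram alpha k b chi p e1 e2 u = \matrix_(i < 3, j < 3)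
    (if i == j then gram_diag (phi (u 0 0) (u 0 1)) (u 0 0) i else 0).
Proof.
move=> dom; apply/matrixP => i j; rewrite !mxE /g_metric !chart_dE.
rewrite varphi_chart //; set f := phi _ _.
have dot0 n (w : 'rV[R]_n) : dot 0 w = 0 by rewrite /dot big1 // => l _; rewrite mxE mul0r.
have d0 n (w : 'rV[R]_n) : dot w 0 = 0 by rewrite /dot big1 // => l _; rewrite mxE mulr0.
have sc2 := cos2Dsin2.
move: i j; apply: ord3_case; apply: ord3_case; rewrite /gram_diag /chart_frame /=
  ?dot0 ?d0 ?(dot_comb _ _ _ frame) ?mulr0 ?addr0; try ring.
- rewrite -[RHS]mulr1; congr (_ * _).
  have := sc2 R (u 0 0); have := sc2 R (u 0 1); nra.
- congr (_ * _).
  have := sc2 R (u 0 1) => h; transitivity (cos (u 0 0) ^+ 2 * (cos (u 0 1) ^+ 2 + sin (u 0 1) ^+ 2)).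
    by ring.
  by rewrite h mulr1.
- have -> : dot (\row_(i < 2) (if i == 0 then - sin (u 0 2) else cos (u 0 2)))
      (\row_(i < 2) (if i == 0 then - sin (u 0 2) else cos (u 0 2))) = 1.
    by rewrite /dot !big_ord_recl big_ord0 !mxE /= -(sc2 R (u 0 2)); ring.
  ring.
Qed.

End Metric.

Section Wedge.
Context {R : realType}.
Variables (alpha k : R) (b : R -> R) (chi : R * R -> R).
Hypothesis (alpha01 : 0 < alpha < 1).
Hypothesis (hb : cutoff1 b) (hchi : cutoff2 chi).

(** Open, with alpha / 2 in place of the alpha of [Omega]: trajectories starting in the narrower
    closed cone have room to bend, and openness allows the formula for the metric to be
    differentiated. *)
Definition wedge (eta s1 s2 x y : R) :=
  [/\ 0 < s1 * x /\ s1 * x < eta, 0 < s2 * y /\ s2 * y < eta,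
      alpha / 2 * (s1 * x) < s2 * y & alpha / 2 * (s2 * y) < s1 * x].

Lemma rho_star_gt0 : 0 < rho_star alpha k.
Proof.
move: alpha01 => /andP[a0 a1].
rewrite /rho_star !lt_min; apply/and3P; split.
- by rewrite invr_gt0.
- by rewrite invr_gt0 mulr_gt0 // ltr_pwDl.
- rewrite invr_gt0 !mulr_gt0 //.
    by have : 0 < 10 / alpha by [rewrite divr_gt0]; lra.
  by rewrite sqrtr_gt0 ltr_pwDl // sqr_ge0.
Qed.

(** The threshold eta solves X^(1/alpha - 1) = alpha / 2. Below it Y > alpha / 2 X implies Y >=
    X^(1/alpha), and symmetrically, so both cutoffs are evaluated at arguments at least 1. *)
Lemma psi_wedge : exists2 eta, 0 < eta & forall s1 s2 x y, `|s1| = 1 -> `|s2| = 1 ->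
  wedge eta s1 s2 x y -> psi alpha b x y = s1 * s2 * (x * y).
Proof.
move: alpha01 => /andP[a0 a1]; have [_ _ b1 _ _] := hb.
pose eta := (alpha / 2) `^ (alpha / (1 - alpha)).
have a20 : 0 < alpha / 2 by rewrite divr_gt0.
have eta0 : 0 < eta by exact: powR_gt0.
have key (X Y : R) : 0 < X -> X < eta -> alpha / 2 * X < Y -> b (Y / X `^ alpha^-1) = 1.
  move=> X0 Xe XY; apply: b1; rewrite ler_pdivlMr ?powR_gt0 // mul1r.
  apply: le_trans (ltW XY).
  have -> : alpha^-1 = (alpha^-1 - 1) + 1 by ring.
  rewrite powRD ?(gt_eqF X0) ?implybT // powRr1 ?(ltW X0) // ler_pM2r //.
  have e : eta `^ (alpha^-1 - 1) = alpha / 2.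
    rewrite /eta -powRrM (_ : alpha / (1 - alpha) * (alpha^-1 - 1) = 1) ?powRr1 ?(ltW a20) //.
    by field; apply/andP; split; apply/eqP; lra.
  rewrite -e; apply: ge0_ler_powR; rewrite ?nnegrE ?(ltW X0) ?(ltW eta0) ?(ltW Xe) //.
  by rewrite subr_ge0 invr_ge1 ?(ltW a1) // unitfE gt_eqF.
exists eta => // s1 s2 x y hs1 hs2 [[x1 x2] [y1 y2] xy yx].
have nx : `|x| = s1 * x by rewrite -[`|x|]mul1r -hs1 -normrM gtr0_norm.
have ny : `|y| = s2 * y by rewrite -[`|y|]mul1r -hs2 -normrM gtr0_norm.
have xy0 : x * y != 0.
  rewrite mulf_neq0 //; apply/eqP => h; [move: x1|move: y1]; rewrite h mulr0; lra.
rewrite /psi (negbTE xy0) normrM nx ny !key // !mulr1; ring.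
Qed.

Lemma phi_wedge : exists eta, [/\ 0 < eta, eta <= 1, eta <= geo_radius k &
  forall s1 s2 x y, `|s1| = 1 -> `|s2| = 1 -> wedge eta s1 s2 x y ->
    1 + k * chi_rho chi (rho_star alpha k) x y * psi alpha b x y =
    1 + s1 * s2 * k * (x * y)].
Proof.
have [eta eta0 h] := psi_wedge.
have r0 := rho_star_gt0.
have g0 := geo_radius_gt0 k.
(* Below [rho_star] the cutoff chi equals 1; the last two terms serve the estimates on the field and
   the domain of the chart. *)
pose e := Num.min eta (Num.min (rho_star alpha k) (Num.min (geo_radius k) 1)).
have e1 : e <= eta by rewrite /e ge_min lexx.
have e2 : e <= rho_star alpha k by rewrite /e; move: (rho_star _ _) (geo_radius _) => ? ?; rewrite !ge_min lexx ?orbT.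
have e3 : e <= geo_radius k by rewrite /e; move: (rho_star _ _) (geo_radius _) => ? ?; rewrite !ge_min lexx ?orbT.
have e4 : e <= 1 by rewrite /e; move: (rho_star _ _) (geo_radius _) => ? ?; rewrite !ge_min lexx ?orbT.
exists e; split => //; first by rewrite lt_min eta0 lt_min r0 lt_min g0 ltr01.
move=> s1 s2 x y hs1 hs2 [[x1 x2] [y1 y2] xy yx].
rewrite (h s1 s2) //; last by split => //; split => //; lra.
have nx : `|x| = s1 * x by rewrite -[`|x|]mul1r -hs1 -normrM gtr0_norm.
have ny : `|y| = s2 * y by rewrite -[`|y|]mul1r -hs2 -normrM gtr0_norm.
have [_ _ chi1 _] := hchi.
rewrite /chi_rho chi1 /=; first by ring.
- by rewrite normrM normfV (gtr0_norm r0) ler_pdivrMr // nx mul1r; lra.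
- by rewrite normrM normfV (gtr0_norm r0) ler_pdivrMr // ny mul1r; lra.
Qed.

(** The six conditions are strict linear inequalities in (x, y), which [pos] treats uniformly. *)
Lemma wedge_near eta s1 s2 (x y : R -> R) (t : R) :
  {for t, continuous x} -> {for t, continuous y} -> wedge eta s1 s2 (x t) (y t) ->
  \forall s \near t, wedge eta s1 s2 (x s) (y s).
Proof.
move=> cx cy [[w1 w2] [w3 w4] w5 w6].
have cl (z w : R) : {for t, continuous (fun s => z * x s + w * y s)}.
  by apply: cvgD; [apply: cvgM; [exact: cvg_cst|exact: cx]|apply: cvgM; [exact: cvg_cst|exact: cy]].
have pos (z w c : R) : c < z * x t + w * y t -> \forall s \near t, c < z * x s + w * y s.
  by move=> h; exact: (cvgr_gt (z * x t + w * y t) (cl z w)).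
have h1 := pos s1 0 0; have h2 := pos (- s1) 0 (- eta).
have h3 := pos 0 s2 0; have h4 := pos 0 (- s2) (- eta).
have h5 := pos (- (alpha / 2 * s1)) s2 0; have h6 := pos s1 (- (alpha / 2 * s2)) 0.
near=> s; split; [split|split| |].
- have : 0 < s1 * x s + 0 * y s by near: s; apply: h1; lra.
  by rewrite mul0r addr0.
- have : - eta < - s1 * x s + 0 * y s by near: s; apply: h2; lra.
  by rewrite mul0r addr0 mulNr ltrN2.
- have : 0 < 0 * x s + s2 * y s by near: s; apply: h3; lra.
  by rewrite mul0r add0r.
- have : - eta < 0 * x s + - s2 * y s by near: s; apply: h4; lra.
  by rewrite mul0r add0r mulNr ltrN2.
- have : 0 < - (alpha / 2 * s1) * x s + s2 * y s by near: s; apply: h5; lra.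
  by rewrite mulNr addrC subr_gt0 mulrA.
- have : 0 < s1 * x s + - (alpha / 2 * s2) * y s by near: s; apply: h6; lra.
  by rewrite mulNr subr_gt0 mulrA.
Unshelve. all: by end_near. Qed.

End Wedge.

(** * Christoffel symbols and the geodesic equation *)

Section Christoffel.
Context {R : realType}.

Lemma sum3 (F : 'I_3 -> R) : \sum_(i < 3) F i = F 0 + F 1 + F 2.
Proof.
rewrite !big_ord_recl big_ord0 addr0 addrA.
by congr (_ + F _ + F _); apply: val_inj.
Qed.

Definition diag3 (g : 'I_3 -> R) : 'M[R]_3 :=
  \matrix_(i < 3, j < 3) (if i == j then g i else 0).

Lemma invmx_diag3 (g : 'I_3 -> R) : (forall i, g i != 0) ->
  invmx (diag3 g) = diag3 (fun i => (g i)^-1).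
Proof.
move=> g0; have e : diag3 g *m diag3 (fun i => (g i)^-1) = 1%:M.
  apply/matrixP => i j; rewrite !mxE (bigD1 i) //= big1 => [|l li].
    by rewrite !mxE eqxx addr0; case: eqP => [->|_]; rewrite ?divff ?mulr0.
  by rewrite !mxE eq_sym (negbTE li) mul0r.
have [u _] := mulmx1_unit e.
by rewrite -[LHS]mulmx1 -e mulmxA mulVmx // mul1mx.
Qed.

(** The right-hand side is the Euler-Lagrange form of the acceleration for the energy with density
    1/2 sum g_i V_i^2. *)
Lemma christoffel_diag (G : 'rV[R]_3 -> 'M[R]_3) (u : 'rV[R]_3)
    (g : 'I_3 -> R) (dg : 'I_3 -> 'I_3 -> R) :
  G u = diag3 g -> (forall i, g i != 0) ->
  (forall i m j, 'D_(e_ R i) (fun w => G w m j) u = if m == j then dg i m else 0) ->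
  forall (V : 'rV[R]_3) l,
  - \sum_(i < 3) \sum_(j < 3) christoffel G u l i j * V 0 i * V 0 j =
  (g l)^-1 * (2^-1 * (\sum_i dg l i * V 0 i ^+ 2) - (\sum_i dg i l * V 0 i) * V 0 l).
Proof.
move=> Gu g0 hD V l.
have cE i j : christoffel G u l i j = 2^-1 * ((g l)^-1 *
    ((if l == j then dg i l else 0) + (if l == i then dg j l else 0)
     - (if i == j then dg l i else 0))).
  rewrite /christoffel Gu invmx_diag3 //; congr (_ * _).
  rewrite (bigD1 l) //= big1 ?addr0 => [|m ml].
    by rewrite !hD mxE eqxx.
  by rewrite mxE eq_sym (negbTE ml) mul0r.
under eq_bigr do under eq_bigr do rewrite cE.
by rewrite !sum3; move: l {cE}; apply: ord3_case => /=; field; exact: g0.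
Qed.

End Christoffel.

Section GeodesicEquation.
Context {R : realType}.
Variables (alpha k : R) (b : R -> R) (chi : R * R -> R) (p e1 e2 : 'rV[R]_3).
Hypothesis frame : orthonormal3 p e1 e2.
Notation G := (gram alpha k b chi p e1 e2).
Let phi (r th : R) : R :=
  1 + k * chi_rho chi (rho_star alpha k) r th * psi alpha b r th.
Let acc (u V : 'rV[R]_3) l :=
  - \sum_(i < 3) \sum_(j < 3) christoffel G u l i j * V 0 i * V 0 j.

Lemma sphere_dom_le1 (x y : R) : `|x| < 1 -> `|y| < 1 -> sphere_dom (x, y).
Proof. by move=> hx hy; have := @pi_ge2 R; rewrite /sphere_dom /=; split; lra. Qed.

Lemma gram_diag_derive (f r f' r' : R) (X P : R -> R) i :
  P 0 = f -> X 0 = r -> f != 0 -> has_derive P 0 f' -> has_derive X 0 r' ->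
  has_derive (fun h => gram_diag (P h) (X h) i) 0
   (if i == 0 then - 2 * f ^- 3 * f' else if i == 1 then
      - 2 * f ^- 3 * f' * cos r ^+ 2 - 2 * f ^- 2 * cos r * sin r * r'
    else 2 * f * f').
Proof.
move=> P0 X0 f0 dP dX; rewrite -P0 in f0; have f20 : P 0 ^+ 2 != 0 by rewrite expf_neq0.
have dP2 := derX _ 2 _ _ dP; have dV := derV (fun t => P t ^+ 2) 0 _ f20 dP2.
move: i; apply: ord3_case; rewrite /gram_diag /=.
- apply: der_eq; first exact: dV.
  by rewrite P0 -P0; field.
- apply: der_eq; first by apply: derM; [exact: dV|apply: derX; apply: dercos; exact: dX].
  by rewrite P0 X0 /= -P0; field.
- apply: der_eq; first exact: dP2.
  by rewrite P0 /=; ring.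
Qed.

(** Christoffel symbols see partial derivatives at u alone, so the conformal factor has to be 1 +
    kappa r theta on the coordinate lines through u, not on a neighbourhood. This makes the singular
    points over r = theta = 0 accessible. *)
Lemma geodesic_acc_of_phi (u : 'rV[R]_3) (kappa : R) (V : 'rV[R]_3) l :
  (forall i, \forall h \near (0 : R), `|u 0 0 + h * (0 == i :> 'I_3)%:R| < 1 /\
     `|u 0 1 + h * (1 == i :> 'I_3)%:R| < 1 /\
     phi (u 0 0 + h * (0 == i :> 'I_3)%:R) (u 0 1 + h * (1 == i :> 'I_3)%:R) =
     1 + kappa * ((u 0 0 + h * (0 == i :> 'I_3)%:R) * (u 0 1 + h * (1 == i :> 'I_3)%:R))) ->
  1 + kappa * (u 0 0 * u 0 1) != 0 -> cos (u 0 0) != 0 ->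
  acc u V l = geo_acc kappa (fun i => u 0 i) (fun i => V 0 i) l.
Proof.
move=> hnear f0 c0.
pose F := 1 + kappa * (u 0 0 * u 0 1).
pose df (i : 'I_3) := kappa * ((0 == i)%:R * u 0 1 + u 0 0 * (1 == i)%:R).
pose dg (i m : 'I_3) := if m == 0 then - 2 * F ^- 3 * df i else if m == 1 then
      - 2 * F ^- 3 * df i * cos (u 0 0) ^+ 2
      - 2 * F ^- 2 * cos (u 0 0) * sin (u 0 0) * (0 == i)%:R
    else 2 * F * df i.
have Gu : G u = diag3 (gram_diag F (u 0 0)).
  have [h0 [h1 h2]] := nbhs_singleton (hnear 0).
  rewrite !mul0r !addr0 in h0 h1 h2.
  by rewrite (gramE _ _ _ _ _ _ _ frame) //; [rewrite -/(phi (u 0 0) (u 0 1)) h2|exact: sphere_dom_le1].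
have gn0 i : gram_diag F (u 0 0) i != 0.
  by move: i; apply: ord3_case; rewrite /gram_diag /= ?invr_eq0 ?mulf_neq0 ?invr_eq0 ?expf_neq0.
have hD i m j : 'D_(e_ R i) (fun w => G w m j) u = if m == j then dg i m else 0.
  apply: line_derive.
  apply: (@near_eq_is_derive _ _ _ (fun h : R => if m == j then gram_diag
     (1 + kappa * ((u 0 0 + h * (0 == i)%:R) * (u 0 1 + h * (1 == i)%:R)))
     (u 0 0 + h * (0 == i)%:R) m else 0)).
    apply: filterS (hnear i) => h [h0 [h1 h2]].
    have ec j' : (h *: e_ R i + u) 0 j' = u 0 j' + h * (j' == i)%:R by rewrite e_line addrC.
    rewrite (gramE _ _ _ _ _ _ _ frame) ?ec ?mxE; last exact: sphere_dom_le1.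
    by rewrite -/(phi (u 0 0 + h * (0 == i)%:R) (u 0 1 + h * (1 == i)%:R)) h2.
  case: (m == j) => /=; last exact: derc.
  apply: (gram_diag_derive F (u 0 0) (df i) (0 == i)%:R) => //.
  - by rewrite !mul0r !addr0.
  - by rewrite mul0r addr0.
  - by der; rewrite !mul0r !addr0 /df; ring.
  - by der; ring.
rewrite /acc (christoffel_diag _ _ _ _ Gu gn0 hD) !sum3.
move: l; apply: ord3_case; rewrite /geo_acc /gram_diag /dg /df /F /=; field.
all: rewrite ?c0 ?f0 //.
Qed.

Hypothesis (alpha01 : 0 < alpha < 1).

(** On a coordinate line through such a point r or theta stays 0, so [psi] and r theta both vanish
    along it: the symbols are those of every [kappa], hence of each quadrant. *)
Lemma geodesic_acc_axis (u V : 'rV[R]_3) kappa l : u 0 0 = 0 -> u 0 1 = 0 ->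
  acc u V l = geo_acc kappa (fun i => u 0 i) (fun i => V 0 i) l.
Proof.
move=> u0 u1.
apply: (geodesic_acc_of_phi u kappa V l); last 2 first.
- by rewrite u0 mul0r mulr0 addr0 oner_eq0.
- by rewrite u0 cos0 oner_eq0.
move=> i; rewrite u0 u1.
have h1 : \forall h \near (0 : R), `|h| < 1.
  by exists 1 => //= h; rewrite /ball_ /= sub0r normrN.
apply: filterS h1 => h h1; rewrite !add0r.
have n b' : `|h * (nat_of_bool b')%:R| < 1 by case: b'; rewrite ?mulr1 ?mulr0 ?normr0.
split; first exact: n. split; first exact: n.
have z : h * (0 == i)%:R * (h * (1 == i)%:R) = 0.
  by move: i; apply: ord3_case; rewrite /= ?mulr0 ?mul0r.
by rewrite /phi /psi z eqxx !mulr0.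
Qed.

Lemma geodesic_acc_wedge (eta s1 s2 : R) (u V : 'rV[R]_3) l :
  eta <= 1 -> eta <= geo_radius (s1 * s2 * k) -> `|s1| = 1 -> `|s2| = 1 ->
  (forall x y, wedge alpha eta s1 s2 x y -> phi x y = 1 + s1 * s2 * k * (x * y)) ->
  wedge alpha eta s1 s2 (u 0 0) (u 0 1) ->
  acc u V l = geo_acc (s1 * s2 * k) (fun i => u 0 i) (fun i => V 0 i) l.
Proof.
move=> he1 he2 hs1 hs2 hphi hu.
have nrm x y : wedge alpha eta s1 s2 x y -> `|x| < eta /\ `|y| < eta.
  move=> [[x1 x2] [y1 y2] _ _].
  have -> : `|x| = s1 * x by rewrite -[`|x|]mul1r -hs1 -normrM gtr0_norm.
  by have -> : `|y| = s2 * y by rewrite -[`|y|]mul1r -hs2 -normrM gtr0_norm.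
have [u0 u1] := nrm _ _ hu.
apply: geodesic_acc_of_phi.
- move=> i.
  have cx j : {for 0, continuous (fun h : R => u 0 j + h * (j == i)%:R)}.
    apply: (@is_derive_continuous _ _ _ (j == i)%:R).
    by der; ring.
  have := @wedge_near R alpha eta s1 s2 _ _ 0 (cx 0) (cx 1).
  rewrite !mul0r !addr0 => /(_ hu); apply: filterS => h hw.
  have [? ?] := nrm _ _ hw.
  by split; [lra|split; [lra|exact: hphi]].
- have := @phi_ge_half R (s1 * s2 * k) (u 0 0) (u 0 1) ltac:(lra) ltac:(lra).
  by move=> h; apply/eqP; lra.
- have := @cos_ge_half R (s1 * s2 * k) (u 0 0) ltac:(lra).
  by move=> h; apply/eqP; lra.
Qed.

End GeodesicEquation.

(** * The exponential map on the wedge *)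

Section RealInduction.
Context {R : realType}.

(** The infimum t of the counterexamples satisfies the hypothesis on [0, t), so P holds on some [t,
    t + e), against the definition of t. *)
Lemma real_induction01 (P : R -> Prop) :
  (forall s, 0 <= s <= 1 -> (forall u, 0 <= u < s -> P u) ->
     exists2 e, 0 < e & forall u, s <= u < s + e -> P u) ->
  forall s, 0 <= s <= 1 -> P s.
Proof.
move=> step s /andP[s0 s1]; apply: contrapT => nPs.
pose A := [set u | 0 <= u <= 1 /\ ~ P u].
have As : A s by split; rewrite ?s0 ?s1.
have lbA : has_lbound A by exists 0 => u [/andP[]].
have hinf : has_inf A by split; [exists s|].
pose t := inf A.
have ts : t <= s by exact: ge_inf.
have t0 : 0 <= t by apply: lb_le_inf; [exists s|move=> u [/andP[]]].
have hlt u : 0 <= u < t -> P u.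
  move=> /andP[u0 ut]; apply: contrapT => nPu.
  have : t <= u by apply: ge_inf => //; split => //; rewrite u0 ltW // (lt_le_trans ut) // (le_trans ts).
  by rewrite leNgt ut.
have t01 : 0 <= t <= 1 by rewrite t0 (le_trans ts).
have [e e0 he] := step t t01 hlt.
have [u [hu nPu] ute] := inf_adherent e0 hinf.
apply: (nPu); apply: he; rewrite -/t in ute; rewrite ute andbT.
by apply: ge_inf => //; split.
Qed.

Lemma continuous_eq0_left (g : R -> R) (s : R) : 0 < s -> {for s, continuous g} ->
  (forall u, 0 <= u < s -> g u = 0) -> g s = 0.
Proof.
move=> s0 cg gu; apply/eqP; rewrite -normr_le0; apply/ler_addgt0Pr => e e0.
rewrite add0r; have /cvgrPdist_le /(_ e e0) [r /= r0 hr] := cg.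
pose u := Num.max 0 (s - r / 2).
have us : u < s by rewrite gt_max s0 /=; lra.
have u0 : 0 <= u by rewrite le_max lexx.
have hru : `|s - u| < r -> `|g s - g u| <= e := hr u.
rewrite (gu u) ?u0 ?us // subr0 in hru; apply: hru.
rewrite gtr0_norm ?subr_gt0 //.
have : s - r / 2 <= u by rewrite le_max lexx orbT.
by lra.
Qed.

End RealInduction.

Section ExpQuadrant.
Context {R : realType}.
Variables (alpha k : R) (b : R -> R) (chi : R * R -> R) (p e1 e2 : 'rV[R]_3).
Hypothesis frame : orthonormal3 p e1 e2.
Hypothesis alpha01 : 0 < alpha < 1.
Variables (s1 s2 eta : R).
Hypotheses (hs1 : `|s1| = 1) (hs2 : `|s2| = 1).
Hypotheses (eta0 : 0 < eta) (eta1 : eta <= 1) (etak : eta <= geo_radius k).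
Hypothesis phiE : forall t1 t2 x y, `|t1| = 1 -> `|t2| = 1 ->
  wedge alpha eta t1 t2 x y ->
  1 + k * chi_rho chi (rho_star alpha k) x y * psi alpha b x y =
  1 + t1 * t2 * k * (x * y).
Notation kappa := (s1 * s2 * k).
Notation G := (gram alpha k b chi p e1 e2).
Variables (m C : R) (c d : ('I_3 -> R) -> 'I_3 -> R -> R).
Hypotheses (m0 : 0 < m) (fl : is_flow kappa (alpha / 32) m C c d).
Variable tau : R.
Hypotheses (tau0 : 0 < tau) (tau_m : 4 * tau < m) (tau_eta : 4 * tau < eta).

(** Initial velocities of one quarter of the wedge; for the flow only a sup bound tau on the
    components matters, in place of the Euclidean radius and the height. *)
Definition cone_pt (v : 'I_3 -> R) :=
  [/\ 0 < s1 * v 0, alpha * (s1 * v 0) <= s2 * v 1, alpha * (s2 * v 1) <= s1 * v 0 &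
      forall i, `|v i| <= tau].

Let D (v : 'I_3 -> R) := Num.max `|v 0| `|v 1|.

Lemma sign_sq (s : R) : `|s| = 1 -> s * s = 1.
Proof. by move=> h; rewrite -expr2 -real_normK ?num_real // h expr1n. Qed.

(** In the cone both s1 v_0 and s2 v_1 are at least alpha D v. An error of a quarter of this per
    unit of time cannot leave the wider cone alpha / 2. *)
Lemma cone_pt_wedge v t x y : cone_pt v -> 0 < t ->
  `|x - t * v 0| <= alpha / 4 * D v * t -> `|y - t * v 1| <= alpha / 4 * D v * t ->
  `|x| < eta -> `|y| < eta -> wedge alpha eta s1 s2 x y.
Proof.
move: alpha01 => /andP[a0 a1] [v0 v01 v10 _] t0 hx hy xe ye.
have v1 : 0 < s2 * v 1 by apply: lt_le_trans v01; rewrite mulr_gt0.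
have nv (s z : R) : `|s| = 1 -> `|z| = `|s * z| by move=> h; rewrite normrM h mul1r.
have DE : D v = Num.max (s1 * v 0) (s2 * v 1).
  by rewrite /D (nv s1) // (nv s2 (v 1)) // !gtr0_norm.
have hx' : `|s1 * x - t * (s1 * v 0)| <= alpha / 4 * D v * t.
  by rewrite (_ : _ - _ = s1 * (x - t * v 0)) ?normrM ?hs1 ?mul1r //; ring.
have hy' : `|s2 * y - t * (s2 * v 1)| <= alpha / 4 * D v * t.
  by rewrite (_ : _ - _ = s2 * (y - t * v 1)) ?normrM ?hs2 ?mul1r //; ring.
have ex : s1 * x < eta by apply: le_lt_trans (ler_norm _) _; rewrite -nv.
have ey : s2 * y < eta by apply: le_lt_trans (ler_norm _) _; rewrite -nv.
move: hx' hy' DE; rewrite /wedge !ler_norml.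
move: (s1 * v 0) (s2 * v 1) (D v) (s1 * x) (s2 * y) v0 v1 v01 v10 ex ey.
move=> X Y M x' y' X0 Y0 XY YX ex ey /andP[x1 x2] /andP[y1 y2] ME.
have MX : alpha * M <= X.
  by rewrite ME; case: (leP X Y) => _; [exact: YX|apply: ler_piMl; exact: ltW].
have MY : alpha * M <= Y.
  by rewrite ME; case: (leP X Y) => _; [apply: ler_piMl; exact: ltW|exact: XY].
have XM : X <= M by rewrite ME le_max lexx.
have YM : Y <= M by rewrite ME le_max lexx orbT.
have M0 : 0 < M by exact: lt_le_trans XM.
have aM : 0 < alpha * M by exact: mulr_gt0.
have tX : t * (alpha * M) <= t * X by rewrite ler_pM2l.
have tY : t * (alpha * M) <= t * Y by rewrite ler_pM2l.
have taM : 0 < t * (alpha * M) by exact: mulr_gt0.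
have e : alpha / 4 * M * t = t * (alpha * M) / 4 by field.
rewrite e in x1 x2 y1 y2.
have k1 : alpha * (t * X) <= t * Y.
  by rewrite mulrCA ler_pM2l.
have k2 : alpha * (t * Y) <= t * X.
  by rewrite mulrCA ler_pM2l.
have b1 : alpha * x' <= alpha * (t * X + t * (alpha * M) / 4).
  by rewrite ler_pM2l //; lra.
have b2 : alpha * y' <= alpha * (t * Y + t * (alpha * M) / 4).
  by rewrite ler_pM2l //; lra.
have b3 : alpha * (t * (alpha * M) / 4) <= t * (alpha * M) / 4.
  by apply: ler_piMl; lra.
by split; [split|split| |]; lra.
Qed.

Lemma flow_le v s i : cone_pt v -> `|s| <= 3 / 2 ->
  `|c v i s| <= 4 * tau /\ `|d v i s| <= 4 * tau.
Proof. by move=> [_ _ _ hv] hs; exact: (flow_small _ _ _ _ _ _ fl). Qed.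

(** At negative times the curve runs in the opposite quadrant (t = -1): both signs flip, their
    product and therefore kappa do not. *)
Lemma flow_wedge v s : cone_pt v -> s != 0 -> `|s| <= 3 / 2 ->
  exists2 t, `|t| = 1 & wedge alpha eta (t * s1) (t * s2) (c v 0 s) (c v 1 s).
Proof.
move=> hv s0 hs.
have lt_eta i : `|c v i s| < eta by apply: le_lt_trans tau_eta; exact: (flow_le _ _ _ hv hs).1.
have cl i : i != 2 -> `|c v i s - s * v i| <= alpha / 4 * D v * `|s|.
  move=> i2; rewrite (_ : alpha / 4 = 8 * (alpha / 32)); last by field.
  by apply: (flow_horizontal _ _ _ _ _ _ fl) => //; rewrite /D le_max lexx ?orbT.
have [sp|sn|//] := ltgtP 0 s; last by move=> z; rewrite -z eqxx in s0.
  exists 1; first exact: normr1.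
  rewrite !mul1r; apply: (cone_pt_wedge v s) => //.
    by have := cl 0 isT; rewrite (gtr0_norm sp).
  by have := cl 1 isT; rewrite (gtr0_norm sp).
exists (- 1); first by rewrite normrN1.
have : wedge alpha eta s1 s2 (- c v 0 s) (- c v 1 s).
  apply: (cone_pt_wedge v (- s)); rewrite ?normrN ?oppr_gt0 //.
    by have := cl 0 isT; rewrite (ltr0_norm sn) mulNr -opprD normrN.
  by have := cl 1 isT; rewrite (ltr0_norm sn) mulNr -opprD normrN.
by rewrite /wedge => -[[h1 h2] [h3 h4] h5 h6]; split; [split|split| |]; lra.
Qed.

Lemma geodesic_acc_flow v (s : R) (u V : 'rV[R]_3) l : cone_pt v -> `|s| <= 3 / 2 ->
  (forall i, u 0 i = c v i s) ->
  - \sum_(i < 3) \sum_(j < 3) christoffel G u l i j * V 0 i * V 0 j =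
  geo_acc kappa (c v ^~ s) (fun i => V 0 i) l.
Proof.
move=> hv hs hu; have -> : c v ^~ s = (fun i => u 0 i) by apply/funext.
have [s0|s0] := eqVneq s 0.
  apply: geodesic_acc_axis => //.
    by rewrite hu s0 (flow_pos0 _ _ _ _ _ _ fl).
  by rewrite hu s0 (flow_pos0 _ _ _ _ _ _ fl).
have [t ht hw] := flow_wedge v s hv s0 hs.
have tt := sign_sq t ht.
have e : t * s1 * (t * s2) * k = kappa.
  by rewrite mulrACA tt mul1r.
rewrite -e; apply: (geodesic_acc_wedge _ _ _ _ _ _ _ frame eta (t * s1) (t * s2) u V l) => //.
- rewrite e /geo_radius !normrM hs1 hs2 !mul1r; exact: etak.
- by rewrite normrM ht hs1 mulr1.
- by rewrite normrM ht hs2 mulr1.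
- by move=> x y; apply: phiE; rewrite normrM ht ?hs1 ?hs2 mulr1.
- by rewrite !hu.
Qed.

Lemma chart_dom_lt1 (u : 'rV[R]_3) : (forall i, `|u 0 i| < 1) -> chart_dom u.
Proof.
move=> hu; split; first exact: sphere_dom_le1.
by have := @pi_ge2 R; have := hu 2; rewrite /=; lra.
Qed.

Definition flow_curve (v : 'rV[R]_3) (s : R) : 'rV[R]_3 := \row_i c (v 0) i s.

Lemma flow_curve_derive (v : 'rV[R]_3) (s : R) : -2 < s < 2 ->
  is_derive s 1 (flow_curve v) (\row_i d (v 0) i s) /\
  is_derive s 1 (derive1 (flow_curve v))
    (\row_i geo_field kappa m (c (v 0) ^~ s) (d (v 0) ^~ s) i).
Proof.
move=> hs.
have dc (u : R) : -2 < u < 2 -> is_derive u 1 (flow_curve v) (\row_i d (v 0) i u).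
  move=> hu; apply: is_derive_row => j; rewrite mxE.
  rewrite (_ : (fun h => _) = c (v 0) j); last by apply/funext => h; rewrite mxE.
  exact: (flow_sol _ _ _ _ _ _ fl _ _ hu j).1.
split; first exact: dc.
apply: (@near_eq_is_derive _ _ _ (fun u => \row_i d (v 0) i u)).
  have : \forall u \near s, u \in `](-2)%R, 2%R[ by apply: near_in_itvoo; rewrite in_itv.
  apply: filterS => u; rewrite in_itv /= => hu.
  by rewrite derive1E; case: (dc u hu).
apply: is_derive_row => j; rewrite mxE.
rewrite (_ : (fun h => _) = d (v 0) j); last by apply/funext => h; rewrite mxE.
exact: (flow_sol _ _ _ _ _ _ fl _ _ hs j).2.
Qed.

Lemma flow_is_geodesic (v : 'rV[R]_3) : cone_pt (v 0) -> geodesic G v (flow_curve v).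
Proof.
move=> hv; have in0 : -2 < (0 : R) < 2 by apply/andP; split; lra.
split.
- by apply/rowP => i; rewrite !mxE (flow_pos0 _ _ _ _ _ _ fl).
- rewrite derive1E; have [_ ->] := (flow_curve_derive v 0 in0).1.
  by apply/rowP => i; rewrite !mxE (flow_vel0 _ _ _ _ _ _ fl).
(* Times in (-1/2, 3/2) stay within the range |s| <= 3/2 of the flow estimates. *)
exists 2^-1; first by rewrite invr_gt0.
move=> s /andP[sl sr].
have si : -2 < s < 2 by apply/andP; split; lra.
have hs : `|s| <= 3 / 2 by rewrite ler_norml; apply/andP; split; lra.
have [dc dd] := flow_curve_derive v s si.
have [dc1 dc2] := dc; have [dd1 dd2] := dd.
split; [|exact: dc1|exact: dd1|].
  apply: chart_dom_lt1 => i; rewrite mxE; have [h _] := flow_le _ s i hv hs.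
  exact: le_lt_trans h (lt_le_trans tau_eta eta1).
move=> l; rewrite derive1nS derive1n1 [in LHS]derive1E dd2 mxE.
rewrite derive1E dc2 (geodesic_acc_flow (v 0) s) //; last by move=> i; rewrite mxE.
rewrite geo_field_id.
- by congr geo_acc; apply/funext => i; rewrite mxE.
- by move=> i; have [h _] := flow_le _ s i hv hs; apply: le_trans h (ltW _).
- by move=> i; have [_ h] := flow_le _ s i hv hs; apply: le_trans h (ltW _).
Qed.

End ExpQuadrant.

Section SmallO.
Context {R : realType}.

(** Used to see that a geodesic leaves q into the wedge. *)
Lemma is_derive0_small (g : R -> R) : is_derive (0 : R) 1 g 0 -> g 0 = 0 ->
  forall e, 0 < e -> \forall u \near (0 : R), `|g u| <= e * `|u|.
Proof.
move=> [dg g0'] g0 e e0; have h := dg; rewrite /derivable in h.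
have cg : h^-1 *: ((g \o shift (0 : R)) (h *: (1 : R)) - g 0) @[h --> 0^'] --> (0 : R).
  by rewrite -[X in _ --> X]g0'; exact: h.
move/cvgrPdist_le : cg => /(_ e e0) [r /= r0 hr].
exists r => //= u; rewrite /ball_ /= sub0r normrN => ur.
have [->|u0] := eqVneq u 0; first by rewrite g0 !normr0 mulr0.
have := hr u; rewrite /ball_ /= sub0r normrN => /(_ ur u0).
rewrite g0 subr0 addr0 sub0r normrN [u%:A]mulr1 normrM normfV.
by rewrite mulrC ler_pdivrMr // normr_gt0.
Qed.

End SmallO.

(** * Uniqueness of the geodesic and inversion of the time-one map *)

Section ExpUnique.
Context {R : realType}.
Variables (alpha k : R) (b : R -> R) (chi : R * R -> R) (p e1 e2 : 'rV[R]_3).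
Hypothesis frame : orthonormal3 p e1 e2.
Hypothesis alpha01 : 0 < alpha < 1.
Variables (s1 s2 eta : R).
Hypotheses (hs1 : `|s1| = 1) (hs2 : `|s2| = 1).
Hypotheses (eta0 : 0 < eta) (eta1 : eta <= 1) (etak : eta <= geo_radius k).
Hypothesis phiE : forall t1 t2 x y, `|t1| = 1 -> `|t2| = 1 ->
  wedge alpha eta t1 t2 x y ->
  1 + k * chi_rho chi (rho_star alpha k) x y * psi alpha b x y =
  1 + t1 * t2 * k * (x * y).
Notation kappa := (s1 * s2 * k).
Notation G := (gram alpha k b chi p e1 e2).
Variables (m C : R) (c d : ('I_3 -> R) -> 'I_3 -> R -> R).
Hypotheses (m0 : 0 < m) (fl : is_flow kappa (alpha / 32) m C c d).
Variable tau : R.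
Hypotheses (tau0 : 0 < tau) (tau_m : 4 * tau < m) (tau_eta : 4 * tau < eta).

Notation cone_pt := (cone_pt alpha s1 s2 tau).

Lemma geodesic_acc_region (u V : 'rV[R]_3) l :
  (u 0 0 = 0 /\ u 0 1 = 0) \/
  (exists2 t, `|t| = 1 & wedge alpha eta (t * s1) (t * s2) (u 0 0) (u 0 1)) ->
  - \sum_(i < 3) \sum_(j < 3) christoffel G u l i j * V 0 i * V 0 j =
  geo_acc kappa (fun i => u 0 i) (fun i => V 0 i) l.
Proof.
move=> [[u0 u1]|[t ht hw]]; first exact: geodesic_acc_axis.
have tt := sign_sq t ht.
have e : t * s1 * (t * s2) * k = kappa by rewrite mulrACA tt mul1r.
rewrite -e; apply: (geodesic_acc_wedge _ _ _ _ _ _ _ frame eta (t * s1) (t * s2) u V l) => //.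
- rewrite e /geo_radius !normrM hs1 hs2 !mul1r; exact: etak.
- by rewrite normrM ht hs1 mulr1.
- by rewrite normrM ht hs2 mulr1.
- by move=> x y; apply: phiE; rewrite normrM ht ?hs1 ?hs2 mulr1.
Qed.

(** The property carried along [0, 1] is that the given geodesic solves the truncated smooth system.
    Where this holds before s, the curve is the flow by the estimate with D = 0, and by continuity
    also at s; so at s it lies in the open wedge and strictly below m, and both persist for a while.
    At s = 0 the curve is at the vertex of the wedge instead, and its initial velocity sends it
    inside. *)
Lemma geodesic_unique (v : 'rV[R]_3) (c1 : R -> 'rV[R]_3) :
  cone_pt (v 0) -> geodesic G v c1 ->
  forall s, 0 <= s <= 1 -> c1 s = flow_curve c v s.
Proof.
move=> hv [c10 dv [eps eps0 H]].
pose x i s := c1 s 0 i; pose y i s := derive1 c1 s 0 i.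
have dx i s : - eps < s < 1 + eps -> is_derive s 1 (x i) (y i s).
  move=> /H [_ h _ _]; apply: is_derive_row_coord.
  exact: (DeriveDef h (esym (derive1E _ _))).
have dy i s : - eps < s < 1 + eps -> is_derive s 1 (y i) (derive1n 2 c1 s 0 i).
  move=> /H [_ _ h _]; apply: (is_derive_row_coord 3 (derive1 c1)).
  by rewrite derive1nS derive1n1; exact: (DeriveDef h (esym (derive1E _ _))).
have x0 i : x i 0 = 0 by rewrite /x c10 mxE.
have y0 i : y i 0 = v 0 i by rewrite /y dv.
have flc0 := flow_pos0 _ _ _ _ _ _ fl (v 0).
have fld0 := flow_vel0 _ _ _ _ _ _ fl (v 0).
pose P s := second_order_sol (geo_field kappa m) x y s.
have solat s : - eps < s < 1 + eps ->
    (x 0 s = 0 /\ x 1 s = 0) \/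
    (exists2 t, `|t| = 1 & wedge alpha eta (t * s1) (t * s2) (x 0 s) (x 1 s)) ->
    (forall i, `|x i s| <= m /\ `|y i s| <= m) -> P s.
  move=> hs reg bd i; split; first exact: dx.
  rewrite geo_field_id; [|by move=> j; exact: (bd j).1|by move=> j; exact: (bd j).2].
  have := dy i s hs; have [_ _ _ ->] := H s hs.
  by rewrite geodesic_acc_region.
have in01 s : 0 <= s <= 1 -> - eps < s < 1 + eps.
  by move=> /andP[? ?]; apply/andP; split; lra.
have abs32 (s : R) : 0 <= s <= 1 -> `|s| <= 3 / 2.
  by move=> /andP[? ?]; rewrite ger0_norm //; lra.
have agree s : 0 <= s <= 1 -> (forall u, 0 <= u <= s -> P u) ->
    forall i, x i s = c (v 0) i s /\ y i s = d (v 0) i s.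
  move=> /andP[sl sr] hP i; have [a0 a1] := andP alpha01.
  have [h1 _ h2] := second_order_sol_dist (alpha / 32) 0 0 s (geo_field kappa m) x y
    (c (v 0)) (d (v 0)) ltac:(lra) ltac:(lra) (flow_lip _ _ _ _ _ _ fl) ltac:(lra) (lexx 0) sl
    ltac:(lra) hP (fun s hs => flow_sol _ _ _ _ _ _ fl (v 0) s ltac:(lra)) x0 flc0
    (fun i => ltac:(by rewrite y0 fld0 subrr normr0)) s i ltac:(by rewrite sl lexx).
  move: h1 h2; rewrite y0 fld0 subrr !mulr0 mul0r subr0 !normr_le0 !subr_eq0.
  by move=> /eqP -> /eqP ->.
have allP : forall s, 0 <= s <= 1 -> P s.
  apply: real_induction01 => s hs hP.
  have cx i : {for s, continuous (x i)} by exact: is_derive_continuous (dx i s (in01 s hs)).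
  have cy i : {for s, continuous (y i)} by exact: is_derive_continuous (dy i s (in01 s hs)).
  have si : -2 < s < 2 by move: hs => /andP[? ?]; apply/andP; split; lra.
  have ag i : x i s = c (v 0) i s /\ y i s = d (v 0) i s.
    have [s0|s0] := ltP 0 s; last first.
      have -> : s = 0 by apply/eqP; move: hs => /andP[? _]; rewrite eq_le s0.
      by rewrite x0 y0 flc0 fld0.
    have agu u : 0 <= u < s -> x i u = c (v 0) i u /\ y i u = d (v 0) i u.
      move=> /andP[u0 us]; apply: agree.
        by rewrite u0 (le_trans (ltW us)) //; case/andP: hs.
      by move=> w /andP[w0 wu]; apply: hP; rewrite w0 (le_lt_trans wu us).
    have [fc fd] := flow_sol _ _ _ _ _ _ fl (v 0) s si i.
    split; apply/eqP; rewrite -subr_eq0; apply/eqP.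
      apply: (@continuous_eq0_left _ (fun s => x i s - c (v 0) i s) s s0).
        by apply: cvgB; [exact: cx|exact: (is_derive_continuous _ _ _ fc)].
      by move=> u /agu [-> _]; rewrite subrr.
    apply: (@continuous_eq0_left _ (fun s => y i s - d (v 0) i s) s s0).
      by apply: cvgB; [exact: cy|exact: (is_derive_continuous _ _ _ fd)].
    by move=> u /agu [_ ->]; rewrite subrr.
  have bds i : `|x i s| < m /\ `|y i s| < m.
    have [-> ->] := ag i.
    have [h1 h2] := flow_le _ _ _ _ _ _ _ _ fl tau (v 0) s i hv (abs32 s hs).
    by split; [exact: le_lt_trans h1 tau_m|exact: le_lt_trans h2 tau_m].
  have nbx : \forall u \near s, forall i, `|x i u| <= m.
    apply: (@filter_forall R _ (fun i u => `|x i u| <= m) (nbhs s) (nbhs_filter s)) => i.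
    exact: (cvgr_norm_le _ (cx i) m (bds i).1).
  have nby : \forall u \near s, forall i, `|y i u| <= m.
    apply: (@filter_forall R _ (fun i u => `|y i u| <= m) (nbhs s) (nbhs_filter s)) => i.
    exact: (cvgr_norm_le _ (cy i) m (bds i).2).
  have nbe : \forall u \near s, - eps < u < 1 + eps.
    have : \forall u \near s, u \in `](- eps), (1 + eps)[.
      by apply: near_in_itvoo; rewrite in_itv /=; exact: in01.
    by apply: filterS => u; rewrite in_itv.
  have nbw : \forall u \near s, s <= u -> (x 0 u = 0 /\ x 1 u = 0) \/
    (exists2 t, `|t| = 1 & wedge alpha eta (t * s1) (t * s2) (x 0 u) (x 1 u)).
    have [s0|s0] := eqVneq s 0; last first.
      have [t ht] := flow_wedge _ _ alpha01 _ _ _ hs1 hs2 _ _ _ _ fl tau tau_eta (v 0) s hv s0 (abs32 s hs).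
      rewrite -(ag 0).1 -(ag 1).1 => hw.
      have := wedge_near _ _ _ _ _ _ _ (cx 0) (cx 1) hw.
      by apply: filterS => u huw _; right; exists t.
    (* Case s = 0: each coordinate is u v_i + o(u), while [cone_pt_wedge] tolerates a fixed positive
       multiple of u because the horizontal velocity is nonzero. *)
    have [w0 _ _ _] := hv.
    have v00 : 0 < Num.max `|v 0 0| `|v 0 1|.
      rewrite lt_max normr_gt0; apply/orP; left; apply/eqP => z.
      by move: w0; rewrite z mulr0 ltxx.
    have D0 : 0 < alpha / 4 * Num.max `|v 0 0| `|v 0 1|.
      by rewrite mulr_gt0 // divr_gt0 //; case/andP: alpha01.
    have sm i : \forall u \near (0 : R), `|x i u - u * v 0 i| <=
        alpha / 4 * Num.max `|v 0 0| `|v 0 1| * `|u|.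
      apply: (@is_derive0_small _ (fun u => x i u - u * v 0 i)) => //; last first.
        by rewrite x0 mul0r subr0.
      have := dx i 0 ltac:(by apply: in01; rewrite lexx ler01); rewrite y0 => h.
      by apply: der_eq; [apply: derB; [exact: h|apply: derM; [exact: derid|exact: derc]]
         |rewrite /=; ring].
    have lte i : \forall u \near (0 : R), `|x i u| < eta.
      apply: (@cvgr_norm_lt _ _ _ _ _ _ _ (_ : x i u @[u --> (0 : R)] --> x i 0)).
        by have := cx i; rewrite s0.
      by rewrite x0 normr0.
    rewrite s0; near=> u => u0.
    have [<-|un] := eqVneq 0 u; first by left; rewrite !x0.
    have up : 0 < u by rewrite lt_neqAle un.
    right; exists 1; rewrite ?normr1 // !mul1r.
    apply: (cone_pt_wedge _ alpha01 _ _ _ hs1 hs2 tau (v 0) u) => //.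
    - by have : `|x 0 u - u * v 0 0| <= alpha / 4 * Num.max `|v 0 0| `|v 0 1| * `|u|; [near: u; exact: (sm 0)|rewrite (gtr0_norm up)].
    - by have : `|x 1 u - u * v 0 1| <= alpha / 4 * Num.max `|v 0 0| `|v 0 1| * `|u|; [near: u; exact: (sm 1)|rewrite (gtr0_norm up)].
    - by near: u; exact: (lte 0).
    - by near: u; exact: (lte 1).
  have : \forall u \near s, s <= u -> P u.
    near=> u => su; apply: solat.
    - by near: u.
    - by move: su; near: u.
    - by move=> i; split; move: i; near: u.
  move=> [r r0 hr]; exists r => // u /andP[u1 u2]; apply: hr => //=.
  by rewrite distrC ger0_norm ?subr_ge0 // ltrBlDl.
move=> s hs; apply/rowP => i; rewrite mxE.
apply: (agree s hs _ i).1 => u /andP[u0 us]; apply: allP; rewrite u0 (le_trans us) //.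
by case/andP: hs.
Unshelve. all: by end_near. Qed.

Theorem exp_flow (v : 'rV[R]_3) : cone_pt (v 0) ->
  [/\ exp_defined alpha k b chi p e1 e2 v, chart_dom (flow_curve c v 1) &
      exp_q alpha k b chi p e1 e2 v = chart p e1 e2 (flow_curve c v 1)].
Proof.
move=> hv.
have hg : geodesic G v (flow_curve c v) by exact: (flow_is_geodesic _ _ _ _ _ _ _ frame alpha01 _ _ _ hs1 hs2 eta1 etak phiE _ _ _ _ fl tau tau_m tau_eta).
have hu := geodesic_unique v.
have in1 : 0 <= (1 : R) <= 1 by rewrite ler01 lexx.
split.
- split; first by exists (flow_curve c v).
  by move=> c1 c2 g1 g2 s hs; rewrite (hu c1) // (hu c2).
- have [_ _ [eps eps0 h]] := hg.
  by have [] := h 1 ltac:(apply/andP; split; lra).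
- rewrite /exp_q; congr chart; case: xgetP => [c1 _ /= g1|]; first exact: hu.
  by move=> /(_ (flow_curve c v)).
Qed.

(** Fixed point of v -> w - (E v - v), where E is the time-one map; this contracts by 1/2 thanks to
    [flow_dist]. Since E 0 = 0, |v| <= |w| + |v| / 2. It supplies preimages for the lower half of
    the sandwich. *)
Lemma flow_surjective (w : 'I_3 -> R) : exists2 v, (forall i, c v i 1 = w i) &
  forall t, (forall i, `|w i| <= t) -> forall i, `|v i| <= 2 * t.
Proof.
have dist := flow_dist _ _ _ _ _ _ fl.
have [W W0 hW] : exists2 W, 0 <= W & forall i, `|w i - (c w i 1 - w i) - w i| <= W.
  exists (\sum_i `|w i - (c w i 1 - w i) - w i|); first exact: sumr_ge0.
  by move=> i; rewrite (bigD1 i) //= lerDl; exact: sumr_ge0.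
have [v _ hv] := @contraction_fixpoint R 'I_3 (fun _ => True)
   (fun v i => w i - (c v i 1 - v i)) w W I (fun _ _ => I)
   (fun v u M _ _ M0 h i => ltac:(
     have -> : w i - (c v i 1 - v i) - (w i - (c u i 1 - u i)) =
       - (c v i 1 - c u i 1 - (v i - u i)) by [ring];
     rewrite normrN; exact: dist)) W0 hW (fun _ _ => I).
have cv i : c v i 1 = w i by have := hv i; lra.
exists v => // t ht.
have c0 i : c (fun=> 0) i 1 = 0.
  have [h _] := flow_small _ _ _ _ _ _ fl (fun=> 0) 0 1 i
    (fun _ => ltac:(by rewrite normr0)) ltac:(rewrite normr1; lra).
  by apply/eqP; rewrite -normr_le0; apply: le_trans h _; rewrite mulr0.
have [i hi] : exists i, forall j, `|v j| <= `|v i|.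
  have [i _ hi] := @Order.TotalTheory.arg_maxP _ _ 'I_3 0 xpredT (fun i => `|v i|) isT.
  by exists i => j; exact: hi.
suff : `|v i| <= 2 * t by move=> h j; exact: le_trans (hi j) h.
have := dist v (fun=> 0) `|v i| _ i.
rewrite c0 cv !subr0 => /(_ (fun j => ltac:(by rewrite subr0; exact: hi))).
have := ht i; have := ler_normB (w i) (w i - v i).
by rewrite subKr; lra.
Qed.

End ExpUnique.

(** * Change of variables by shears *)

Lemma measurable_bool_set {d} {S : measurableType d} (B : S -> bool) :
  measurable_fun [set: S] B -> measurable [set z | B z].
Proof. by move=> mB; rewrite -[X in measurable X]setTI; exact: (mB measurableT [set true]). Qed.


Section PullbackMeasure.
Context {R : realType}.
Variables (T w : R -> R).
Hypotheses (mT : measurable_fun [set: R] T) (mw : measurable_fun [set: R] w).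
Hypothesis w0 : forall x, 0 <= w x.
Notation mu := (@lebesgue_measure R).

(** For increasing T and w = T', change of variables says that this is Lebesgue measure on the range
    of T. *)
Definition pullback_measure (A : set (measurableTypeR R)) : \bar R :=
  (\int[mu]_(x in T @^-1` A) (w x)%:E)%E.

Let pullback0 : pullback_measure set0 = 0%E.
Proof. by rewrite /pullback_measure preimage_set0 integral_set0. Qed.

Let pullback_ge0 A : (0 <= pullback_measure A)%E.
Proof. by apply: integral_ge0 => x _; rewrite lee_fin. Qed.

Let pullback_sigma_additive : semi_sigma_additive pullback_measure.
Proof.
move=> F mF tF mUF; rewrite /pullback_measure; apply: cvg_toP.
  apply: ereal_nondecreasing_is_cvgn => m n mn.
  apply: lee_sum_nneg_natr => // k _ _; apply: integral_ge0 => /= x _.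
  by rewrite lee_fin.
rewrite preimage_bigcup ge0_integral_bigcup //=.
- by move=> n; rewrite -[X in measurable X]setTI; apply: mT => //; exact: mF.
- by apply: (measurable_funS measurableT) => //; apply/measurable_EFinP; exact: mw.
- by move=> x _; rewrite lee_fin.
- apply/trivIsetP => i j _ _ ij; rewrite -preimage_setI.
  by move/trivIsetP : tF => /(_ _ _ I I ij) ->; rewrite preimage_set0.
Qed.

HB.instance Definition _ := isMeasure.Build _ _ _
  pullback_measure pullback0 pullback_ge0 pullback_sigma_additive.

Definition pullback_measure_HB : {measure set (measurableTypeR R) -> \bar R} :=
  pullback_measure.

End PullbackMeasure.

Section Substitution.
Context {R : realType}.
Variables (T T' : R -> R) (lo hi : R).
Hypotheses (lohi : lo < hi) (dT : forall x : R, is_derive x 1 T (T' x)).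
Hypotheses (cT' : continuous T') (T'0 : forall x, lo <= x <= hi -> 0 < T' x).
Notation mu := (@lebesgue_measure R).

Let w (x : R) : R := if (lo < x) && (x <= hi) then T' x else 0.

Let w0 x : 0 <= w x.
Proof. by rewrite /w; case: ifPn => // /andP[h1 h2]; rewrite ltW // T'0 // h2 ltW. Qed.

Let cT : continuous T. Proof. by move=> x; exact: is_derive_continuous (dT x). Qed.

Let mT : measurable_fun [set: R] T.
Proof. exact: continuous_measurable_fun. Qed.

Let wE : w = T' \_ `]lo, hi].
Proof. by apply/funext => x; rewrite /w patchE mem_setE in_itv. Qed.

Let mw : measurable_fun [set: R] w.
Proof.
rewrite wE; apply/(measurable_restrictT _ _).1 => //.
by apply: measurable_funTS; exact: continuous_measurable_fun.
Qed.

Lemma substitution_increasing x y : lo <= x -> x < y -> y <= hi -> T x < T y.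
Proof.
move=> lx xy yh; have [z hz e] := @MVT _ T T' x y xy (fun x _ => dT x)
  (continuous_subspaceT cT).
rewrite -subr_gt0 e mulr_gt0 ?subr_gt0 // T'0 //.
by move: hz; rewrite in_itv /= => /andP[? ?]; apply/andP; split; lra.
Qed.

Lemma substitution_mono : {in `[lo, hi] &, {mono T : x y / x < y}}.
Proof.
move=> x y; rewrite !in_itv /= => /andP[x1 x2] /andP[y1 y2].
have [xy|yx|->] := ltgtP x y; last by rewrite !ltxx.
  by rewrite substitution_increasing.
by apply/negbTE; rewrite -leNgt ltW // substitution_increasing.
Qed.

Lemma substitution_integral x y : lo <= x -> x < y -> y <= hi ->
  (\int[mu]_(z in `]x, y]) (T' z)%:E = (T y - T x)%:E)%E.
Proof.
move=> lx xy yh; rewrite integral_itv_obnd_cbnd; last first.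
  by apply/measurable_EFinP/measurable_funTS; exact: continuous_measurable_fun.
rewrite (@continuous_FTC2 _ T' T x y xy) ?EFinB //.
- exact: continuous_subspaceT.
- by split => [z _| |]; [case: (dT z)|exact: cvg_at_right_filter (cT x)|exact: cvg_at_left_filter (cT y)].
- by move=> z _; rewrite derive1E; case: (dT z).
Qed.

Let D := `]T lo, T hi]%classic.
Let mDC : measurable (~` D). Proof. by apply: measurableC; exact: measurable_itv. Qed.

(** The fundamental theorem of calculus, after the end points have been pulled back by the
    intermediate value theorem. *)
Lemma substitution_ocitv a b : T lo <= a -> a < b -> b <= T hi ->
  (\int[mu]_(x in T @^-1` `]a, b]) (w x)%:E = (b - a)%:E)%E.
Proof.
move=> la ab bh.
have ivt y : T lo <= y <= T hi -> exists2 x, lo <= x <= hi & T x = y.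
  move=> hy; have h : T lo <= T hi by case/andP: hy => h1 /(le_trans h1).
  have hy' : Num.min (T lo) (T hi) <= y <= Num.max (T lo) (T hi) by rewrite min_l // max_r.
  have [x hx <-] := @IVT _ T lo hi y (ltW lohi) (continuous_subspaceT cT) hy'.
  by exists x => //; move: hx; rewrite in_itv.
have [xa /andP[xa1 xa2] ea] := ivt a ltac:(by rewrite la (le_trans (ltW ab))).
have [xb /andP[xb1 xb2] eb] := ivt b ltac:(by rewrite bh (le_trans la (ltW ab))).
have xab : xa < xb by rewrite -(substitution_mono xa xb) ?in_itv /= ?xa1 ?xb1 // ea eb.
rewrite -eb -ea -substitution_integral //.
rewrite [RHS]integral_mkcond [LHS]integral_mkcond; apply: eq_integral => x _.
rewrite !patchE.
rewrite (_ : (x \in T @^-1` `]T xa, T xb]) = (T xa < T x <= T xb)); last first.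
  by apply/idP/idP; rewrite inE /= in_itv.
rewrite (_ : (x \in `]xa, xb]%classic) = (xa < x <= xb)); last first.
  by apply/idP/idP; rewrite inE /= in_itv.
rewrite /w.
have [hx|hx] := boolP ((lo < x) && (x <= hi)); last first.
  rewrite if_same; case: ifPn => // /andP[h1 h2].
  by move: hx; rewrite (le_lt_trans xa1 h1) (le_trans h2 xb2).
have hx' : x \in `[lo, hi] by rewrite in_itv /=; case/andP: hx => /ltW -> ->.
rewrite (substitution_mono xa x) ?in_itv /= ?xa1 //.
by rewrite !leNgt (substitution_mono xb x) ?in_itv /= ?xb1.
Qed.

Let preE a b x : (x \in T @^-1` `]a, b]) = (a < T x <= b).
Proof. by apply/idP/idP; rewrite inE /= in_itv. Qed.

Lemma pullback_w_setI X : pullback_measure T w X = pullback_measure T w (X `&` D).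
Proof.
rewrite /pullback_measure [LHS]integral_mkcond [RHS]integral_mkcond.
apply: eq_integral => x _; rewrite !patchE preimage_setI in_setI.
case: (x \in T @^-1` X) => //=; rewrite /D preE.
have [//|xD] := boolP (T lo < T x <= T hi).
rewrite /w; case: ifPn => // /andP[h1 h2]; exfalso; move/negP: xD; apply.
rewrite substitution_increasing //=.
by move: h2; rewrite le_eqVlt => /orP[/eqP -> //|h2]; rewrite ltW // substitution_increasing // ltW.
Qed.

(** The pulled-back measure inside the range D of T, completed by Lebesgue measure outside.
    Agreement on half-open intervals then forces equality with Lebesgue measure on all measurable
    sets. *)
Let nu : {measure set (measurableTypeR R) -> \bar R} :=
  measure_add (pullback_measure_HB T w mT mw w0) (mrestr mu mDC).

Let nuE X : nu X = (pullback_measure T w X + mu (X `&` ~` D))%E.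
Proof. exact: measure_addE. Qed.

Let nu_ocitv (X : set R) : ocitv X -> mu X = nu X.
Proof.
move=> [[a b] _ <-]; rewrite nuE.
set X' := `]a, b]%classic.
have mX : measurable (X' : set (measurableTypeR R)) by exact: measurable_itv.
have mD : measurable (D : set (measurableTypeR R)) by exact: measurable_itv.
have -> : mu X' = (mu (X' `&` D) + mu (X' `&` ~` D))%E.
  rewrite -measureU; [by rewrite -setIUr setUv setIT|exact: measurableI| |].
    by apply: measurableI => //; exact: measurableC.
  by rewrite setIACA setICr setI0.
congr (_ + _)%E; rewrite pullback_w_setI.
have -> : X' `&` D = `]Num.max a (T lo), Num.min b (T hi)]%classic.
  rewrite /X' /D !set_itvE; apply/seteqP; split => x /=; rewrite gt_max le_min.
    by move=> [/andP[-> ->] /andP[-> ->]].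
  by move=> /andP[/andP[-> ->] /andP[-> ->]].
have [ab|ba] := ltP (Num.max a (T lo)) (Num.min b (T hi)).
  rewrite [RHS]substitution_ocitv //; last 2 first.
  - by rewrite le_max lexx orbT.
  - by rewrite ge_min lexx orbT.
  by rewrite lebesgue_measure_itv /= lte_fin ab EFinB.
by rewrite set_itv_ge ?measure0 ?bnd_simp -?leNgt.
Qed.

Lemma substitution_measure (A : set (measurableTypeR R)) : measurable A -> A `<=` D ->
  pullback_measure T w A = mu A.
Proof.
move=> mA AD; rewrite (lebesgue_measure_unique nu_ocitv mA) nuE.
have -> : A `&` ~` D = set0 by apply/seteqP; split => x // -[/AD].
by rewrite measure0 adde0.
Qed.

(** Layer-cake reduction to sets: g y is the length of [0, g y[, and Tonelli exchanges the level u
    with y, so that [substitution_measure] applies to each superlevel set. Measurable g is the right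
    class because the integrands below are cut off by indicators of blocks. *)
Theorem substitution (g : R -> R) : measurable_fun [set: R] g -> (forall y, 0 <= g y) ->
  (forall y, ~ T lo < y <= T hi -> g y = 0) ->
  (\int[mu]_y (g y)%:E = \int[mu]_(x in `]lo, hi]) (g (T x) * T' x)%:E)%E.
Proof.
move=> mg g0 gD.
pose B (z : R * R) := (0 <= z.2) && (z.2 < g z.1).
have mB : measurable_fun [set: R * R] B.
  apply: measurable_and; [apply: measurable_fun_ler|apply: measurable_fun_ltr] => //.
  exact: measurableT_comp.
have mA := measurable_bool_set B mB.
pose f (z : R * R) : \bar R := (\1_[set z | B z] z)%:E.
have mf : measurable_fun [set: R * R] f.
  by apply/measurable_EFinP; exact: measurable_indic.
have f0 z : (0 <= f z)%E by rewrite lee_fin.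
have secE y u : f (y, u) = (\1_(`[0, g y[%classic) u)%:E.
  by rewrite /f !indicE; congr (nat_of_bool _)%:R%:E; apply/idP/idP; rewrite !inE /= /B in_itv.
have lc y : (\int[mu]_u f (y, u) = (g y)%:E)%E.
  under eq_integral do rewrite secE.
  rewrite integral_indic // setIT; change (mu `[0, g y[%classic = (g y)%:E).
  rewrite lebesgue_measure_itv /= lte_fin; have := g0 y; rewrite le_eqVlt => /orP[/eqP <-|->].
    by rewrite ltxx.
  by rewrite oppr0 addr0.
have -> : (\int[mu]_y (g y)%:E = \int[mu]_y \int[mu]_u f (y, u))%E.
  by apply: eq_integral => y _; rewrite lc.
rewrite fubini_tonelli //.
have level u : (\int[mu]_y f (y, u) = \int[mu]_x (f (T x, u) * (w x)%:E))%E.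
  pose A := [set y | B (y, u)].
  have mAu : measurable A.
    apply: (measurable_bool_set (fun y => B (y, u))).
    exact: (measurableT_comp mB (pair2_measurable u)).
  have AD : A `<=` D.
    move=> y; rewrite /A /B /= => /andP[u0 uy]; apply: contrapT => yD.
    have : g y = 0 by apply: gD => h; apply: yD; rewrite /D /= in_itv.
    by move=> gy0; move: uy; rewrite gy0 ltNge u0.
  transitivity (mu A).
    transitivity (\int[mu]_y (\1_A y)%:E)%E; last by rewrite integral_indic // setIT.
    by apply: eq_integral => y _; rewrite /f !indicE; congr (nat_of_bool _)%:R%:E;
       apply/idP/idP; rewrite !inE.
  rewrite -substitution_measure // /pullback_measure integral_mkcond.
  apply: eq_integral => x _; rewrite patchE /f indicE.
  have -> : ((T x, u) \in [set z | B z]) = (x \in T @^-1` A) by apply/idP/idP; rewrite !inE.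
  by case: (x \in T @^-1` A); rewrite ?mul1e ?mul0e.
under eq_integral do rewrite level.
pose h (z : R * R) := (f (T z.1, z.2) * (w z.1)%:E)%E.
have mh : measurable_fun [set: R * R] h.
  apply: emeasurable_funM.
    apply: (measurableT_comp mf); apply: measurable_fun_pair => //.
    exact: measurableT_comp.
  by apply/measurable_EFinP; exact: measurableT_comp.
have h0 z : (0 <= h z)%E by rewrite mule_ge0 // lee_fin.
transitivity (\int[mu]_x \int[mu]_u h (x, u))%E; first exact: esym (@fubini_tonelli _ _ (measurableTypeR R) (measurableTypeR R) R mu mu h mh h0).
rewrite [RHS]integral_mkcond.
apply: eq_integral => x _; rewrite /h /=.
rewrite ge0_integralZr //; last 2 first.
- exact: (measurableT_comp mf (pair1_measurable (T x))).
- by rewrite lee_fin.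
rewrite lc patchE wE patchE; case: ifPn => _; first by rewrite EFinM.
by rewrite mule0.
Qed.

End Substitution.

(** * Iterated integrals in three variables *)

Section ProductSigmaFinite.
Context {R : realType}.
Notation mu := (@lebesgue_measure R).
Notation T := (measurableTypeR R).

(** Named in order to carry the sigma-finite structure that Tonelli needs for the third variable. *)
Definition plane_measure : set (T * T) -> \bar R := (mu \x mu)%E.

HB.instance Definition _ := Measure.on plane_measure.

Lemma plane_measure_sigma_finite : sigma_finite setT plane_measure.
Proof.
pose I n := `[- (n%:R : R), n%:R]%classic.
exists (fun n => I n `*` I n).
  apply/esym; rewrite predeqE => -[x y]; split => // _.
  have hN := archi_boundP (addr_ge0 (normr_ge0 x) (normr_ge0 y)).
  exists (Num.bound (`|x| + `|y|)) => //=.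
  rewrite /I !set_itvE /= -!ler_norml; split; apply: ltW; apply: le_lt_trans hN.
    by rewrite lerDl.
  by rewrite lerDr.
move=> n; have mI : measurable (I n : set T) by exact: measurable_itv.
split; first exact: measurableX.
have muI : (mu (I n) < +oo)%E.
  by rewrite /I lebesgue_measure_itv /=; case: ifP; rewrite ?ltry.
rewrite /plane_measure product_measure1E // lte_mul_pinfty //.
by rewrite ge0_fin_numE.
Qed.

HB.instance Definition _ :=
  Measure_isSigmaFinite.Build _ _ _ plane_measure plane_measure_sigma_finite.

End ProductSigmaFinite.

Section Integral3.
Context {R : realType}.
Notation mu := (@lebesgue_measure R).
Notation T := (measurableTypeR R).
Implicit Types (g h : R * R * R -> R).

Definition int3 (f : R * R * R -> \bar R) : \bar R :=
  (\int[(mu \x mu) \x mu]_u f u)%E.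

Lemma int3_iter (f : R * R * R -> \bar R) : measurable_fun [set: R * R * R] f ->
  (forall u, (0 <= f u)%E) ->
  int3 f = (\int[mu]_x \int[mu]_y \int[mu]_z f (x, y, z))%E.
Proof.
move=> mf f0; rewrite /int3.
rewrite (@fubini_tonelli1 _ _ _ T R (plane_measure : {sigma_finite_measure set (T * T)%type -> \bar R}) mu f mf f0).
rewrite (@fubini_tonelli1 _ _ T T R mu mu
  (fun a => \int[mu]_z f (a, z))%E) //.
- exact: (@measurable_fun_fubini_tonelli_F _ _ _ T R mu f mf f0).
- by move=> a; apply: integral_ge0.
Qed.

(** This transposition and the next one bring any coordinate to the last place, where the shear
    formula is proved. *)
Lemma int3_swap12 (f : R * R * R -> \bar R) : measurable_fun [set: R * R * R] f ->
  (forall u, (0 <= f u)%E) -> int3 f = int3 (fun u => f (u.1.2, u.1.1, u.2)).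
Proof.
move=> mf f0.
have mf' : measurable_fun [set: R * R * R] (fun u : R * R * R => f (u.1.2, u.1.1, u.2)).
  apply: (measurableT_comp mf); apply: measurable_fun_pair => //=.
  by apply: measurable_fun_pair => /=; apply: measurableT_comp.
rewrite (int3_iter f mf f0) (int3_iter _ mf' (fun u => f0 _)).
apply: (@fubini_tonelli _ _ T T R mu mu (fun a => \int[mu]_z f (a, z))%E).
- exact: (@measurable_fun_fubini_tonelli_F _ _ _ T R mu f mf f0).
- by move=> a; apply: integral_ge0.
Qed.

Lemma int3_swap23 (f : R * R * R -> \bar R) : measurable_fun [set: R * R * R] f ->
  (forall u, (0 <= f u)%E) -> int3 f = int3 (fun u => f (u.1.1, u.2, u.1.2)).
Proof.
move=> mf f0.
have mf' : measurable_fun [set: R * R * R] (fun u : R * R * R => f (u.1.1, u.2, u.1.2)).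
  apply: (measurableT_comp mf); apply: measurable_fun_pair => /=; last exact: measurableT_comp.
  by apply: measurable_fun_pair => //=; apply: measurableT_comp.
rewrite (int3_iter f mf f0) (int3_iter _ mf' (fun u => f0 _)).
apply: eq_integral => x _.
apply: (@fubini_tonelli _ _ T T R mu mu (fun a => f (x, a.1, a.2))); last by [].
apply: (measurableT_comp mf); apply: measurable_fun_pair => //=.
by apply: measurable_fun_pair => /=; [exact: measurable_cst|exact: measurable_fst].
Qed.

End Integral3.

(** * Shears of one coordinate *)

Section Shear.
Context {R : realType}.
Notation mu := (@lebesgue_measure R).
Variable M : R.
Hypothesis M0 : 0 < M.


Definition cube (B : R) (u : R * R * R) : bool :=
  [&& `|u.1.1| <= B, `|u.1.2| <= B & `|u.2| <= B].

Lemma measurable_cube B : measurable_fun [set: R * R * R] (cube B).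
Proof.
have mn (f : R * R * R -> R) : measurable_fun [set: R * R * R] f ->
    measurable_fun [set: R * R * R] (fun u => `|f u| <= B).
  by move=> mf; apply: measurable_fun_ler => //; exact: measurableT_comp.
rewrite /cube; apply: measurable_and.
  by apply: mn; exact: measurableT_comp.
by apply: measurable_and; apply: mn => //; exact: measurableT_comp.
Qed.

Lemma cube_swap23 B (u : R * R * R) : cube B (u.1.1, u.2, u.1.2) = cube B u.
Proof. by rewrite /cube /= [X in _ && X]andbC. Qed.

Lemma cube_swap12 B (u : R * R * R) : cube B (u.1.2, u.1.1, u.2) = cube B u.
Proof. by rewrite /cube /= andbCA. Qed.

(** A displacement of at most M / 2 makes the image of [-2M, 2M] cover [-M, M], where the integrands
    live. *)
Definition good_shear (f f' : R -> R) :=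
  [/\ forall z : R, is_derive z 1 f (f' z), continuous f' &
      forall z, `|z| <= 2 * M -> 0 < f' z /\ `|f z - z| <= M / 2].

Let lohi : - (2 * M) < 2 * M. Proof. by have := M0; lra. Qed.

Lemma good_shear_range f f' : good_shear f f' ->
  f (- (2 * M)) < - M /\ M < f (2 * M).
Proof.
move=> [_ _ h]; have h0 := M0.
have [_ h1] := h (- (2 * M)) ltac:(by rewrite normrN ger0_norm //; lra).
have [_ h2] := h (2 * M) ltac:(by rewrite ger0_norm //; lra).
by move: h1 h2; rewrite !ler_norml => /andP[? ?] /andP[? ?]; split; lra.
Qed.

Lemma measurable_swap12 : measurable_fun [set: R * R * R]
  (fun u : R * R * R => (u.1.2, u.1.1, u.2)).
Proof.
apply: measurable_fun_pair => //=.
by apply: measurable_fun_pair => /=; apply: measurableT_comp.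
Qed.

Lemma measurable_swap23 : measurable_fun [set: R * R * R]
  (fun u : R * R * R => (u.1.1, u.2, u.1.2)).
Proof.
apply: measurable_fun_pair => /=; last exact: measurableT_comp.
by apply: measurable_fun_pair => //=; apply: measurableT_comp.
Qed.

Lemma measurable_sheared (g S' : R * R * R -> R) (phi : R * R * R -> R * R * R) :
  measurable_fun [set: R * R * R] g -> measurable_fun [set: R * R * R] S' ->
  measurable_fun [set: R * R * R] phi ->
  measurable_fun [set: R * R * R]
    (fun u => if cube (2 * M) u then g (phi u) * S' u else 0).
Proof.
move=> mg mS' mphi; apply: measurable_fun_ifT; first exact: measurable_cube.
  by apply: measurable_funM => //; exact: measurableT_comp mg mphi.
exact: measurable_cst.
Qed.

Lemma shear_z (S S' g : R * R * R -> R) :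
  measurable_fun [set: R * R * R] S -> measurable_fun [set: R * R * R] S' ->
  (forall x y, `|x| <= 2 * M -> `|y| <= 2 * M ->
     good_shear (fun z => S (x, y, z)) (fun z => S' (x, y, z))) ->
  measurable_fun [set: R * R * R] g -> (forall u, 0 <= g u) ->
  (forall u, g u != 0 -> cube (2 * M) u /\ `|u.2| <= M) ->
  int3 (fun u => (g u)%:E) =
  int3 (fun u => (if cube (2 * M) u then g (u.1, S u) * S' u else 0)%:E).
Proof.
move=> mS mS' hS mg g0 gs.
have mphi : measurable_fun [set: R * R * R] (fun u => (u.1, S u)).
  by apply: measurable_fun_pair.
have mh := measurable_sheared g S' _ mg mS' mphi.
rewrite int3_iter; last 2 first.
- exact/measurable_EFinP.
- by move=> u; rewrite lee_fin.
rewrite int3_iter; last 2 first.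
- exact/measurable_EFinP.
- move=> u; rewrite lee_fin; case: ifPn => // /and3P[u1 u2 u3].
  have [_ _ /(_ u.2 u3) [h _]] := hS _ _ u1 u2.
  by rewrite mulr_ge0 // ltW //; move: h; case: (u) => [[? ?] ?].
apply: eq_integral => x _; apply: eq_integral => y _.
have [/andP[hx hy]|hxy] := boolP ((`|x| <= 2 * M) && (`|y| <= 2 * M)); last first.
  apply: eq_integral => z _.
  have nc z' : cube (2 * M) (x, y, z') = false.
    by apply/negbTE; apply: contra hxy => /and3P[-> ->].
  rewrite nc; congr (_%:E); apply/eqP; apply: contraT => /gs[].
  by rewrite nc.
have [d1 d2 d3] := hS x y hx hy.
have hpos z : - (2 * M) <= z <= 2 * M -> 0 < S' (x, y, z).
  by move=> hz; have [] := d3 z; rewrite ?ler_norml.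
have [hlo hhi] := good_shear_range _ _ (hS x y hx hy).
rewrite (@substitution R (fun z => S (x, y, z)) (fun z => S' (x, y, z))
  (- (2 * M)) (2 * M) lohi d1 d2 hpos (fun z => g (x, y, z))); last 3 first.
- exact: (measurableT_comp mg (pair1_measurable (x, y))).
- by move=> z.
- move=> z /= hz; apply/eqP; apply: contraT => /gs[_ /=]; rewrite ler_norml => /andP[z1 z2].
  by exfalso; apply: hz; rewrite (lt_le_trans hlo z1) (le_trans z2 (ltW hhi)).
rewrite integral_mkcond; apply: eq_integral => z _; rewrite patchE.
rewrite (_ : (z \in _) = (- (2 * M) < z <= 2 * M)); last first.
  by apply/idP/idP; rewrite inE /= in_itv.
rewrite /cube /= hx hy /= ler_norml.
have [hz|hz] := boolP (- (2 * M) < z <= 2 * M).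
  by case/andP: hz => h1 h2; rewrite (ltW h1) h2.
case: ifP => // /andP[z1 z2].
(* The one point of the closed interval that is missing from the half-open one; there S is below -M,
   so g vanishes. *)
have ze : z = - (2 * M).
  by apply/eqP; rewrite eq_le z1 andbT leNgt; apply: contra hz => ->; rewrite z2.
congr (_%:E); rewrite ze; apply/esym/eqP; rewrite mulf_eq0; apply/orP; left.
apply: contraT => /gs[_ /=]; rewrite ler_norml => /andP[+ _].
by rewrite leNgt hlo.
Qed.

Lemma shear_y (S S' g : R * R * R -> R) :
  measurable_fun [set: R * R * R] S -> measurable_fun [set: R * R * R] S' ->
  (forall x z, `|x| <= 2 * M -> `|z| <= 2 * M ->
     good_shear (fun y => S (x, y, z)) (fun y => S' (x, y, z))) ->
  measurable_fun [set: R * R * R] g -> (forall u, 0 <= g u) ->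
  (forall u, g u != 0 -> cube (2 * M) u /\ `|u.1.2| <= M) ->
  int3 (fun u => (g u)%:E) =
  int3 (fun u => (if cube (2 * M) u then g (u.1.1, S u, u.2) * S' u else 0)%:E).
Proof.
move=> mS mS' hS mg g0 gs.
pose s (u : R * R * R) := (u.1.1, u.2, u.1.2).
have ms : measurable_fun [set: R * R * R] s by exact: measurable_swap23.
have ss u : s (s u) = u by case: u => [[? ?] ?].
rewrite int3_swap23; last 2 first.
- exact/measurable_EFinP.
- by move=> u; rewrite lee_fin.
rewrite (@shear_z (S \o s) (S' \o s) (g \o s)); first last.
- by move=> u /gs; rewrite /s cube_swap23.
- by move=> u; exact: g0.
- exact: measurableT_comp mg ms.
- by move=> x y hx hy; exact: hS.
- exact: measurableT_comp mS' ms.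
- exact: measurableT_comp mS ms.
rewrite int3_swap23; last 2 first.
- apply/measurable_EFinP.
  apply: (measurable_sheared (g \o s) (S' \o s) (fun u => (u.1, (S \o s) u))).
  + exact: measurableT_comp mg ms.
  + exact: measurableT_comp mS' ms.
  + by apply: measurable_fun_pair => //; exact: measurableT_comp mS ms.
- move=> u; rewrite lee_fin; case: ifPn => // /and3P[u1 u2 u3].
  have [_ _ /(_ u.2 u3) [h _]] := hS _ _ u1 u2.
  by apply: mulr_ge0; [exact: g0|exact: ltW h].
congr int3; apply/funext => u /=.
by rewrite cube_swap23 /s /=; case: u => [[? ?] ?].
Qed.

Lemma shear_x (S S' g : R * R * R -> R) :
  measurable_fun [set: R * R * R] S -> measurable_fun [set: R * R * R] S' ->
  (forall y z, `|y| <= 2 * M -> `|z| <= 2 * M ->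
     good_shear (fun x => S (x, y, z)) (fun x => S' (x, y, z))) ->
  measurable_fun [set: R * R * R] g -> (forall u, 0 <= g u) ->
  (forall u, g u != 0 -> cube (2 * M) u /\ `|u.1.1| <= M) ->
  int3 (fun u => (g u)%:E) =
  int3 (fun u => (if cube (2 * M) u then g (S u, u.1.2, u.2) * S' u else 0)%:E).
Proof.
move=> mS mS' hS mg g0 gs.
pose s (u : R * R * R) := (u.1.2, u.1.1, u.2).
have ms : measurable_fun [set: R * R * R] s by exact: measurable_swap12.
rewrite int3_swap12; last 2 first.
- exact/measurable_EFinP.
- by move=> u; rewrite lee_fin.
rewrite (@shear_y (S \o s) (S' \o s) (g \o s)); first last.
- by move=> u /gs; rewrite /s cube_swap12.
- by move=> u; exact: g0.
- exact: measurableT_comp mg ms.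
- by move=> x z hx hz; exact: hS.
- exact: measurableT_comp mS' ms.
- exact: measurableT_comp mS ms.
rewrite int3_swap12; last 2 first.
- apply/measurable_EFinP.
  apply: (measurable_sheared (g \o s) (S' \o s) (fun u => (u.1.1, (S \o s) u, u.2))).
  + exact: measurableT_comp mg ms.
  + exact: measurableT_comp mS' ms.
  + apply: measurable_fun_pair => //=; apply: measurable_fun_pair => /=.
      exact: measurableT_comp.
    exact: measurableT_comp mS ms.
- move=> u; rewrite lee_fin; case: ifPn => // /and3P[u1 u2 u3].
  have [_ _ /(_ u.1.2 u2) [h _]] := hS _ _ u1 u3.
  by apply: mulr_ge0; [exact: g0|exact: ltW h].
congr int3; apply/funext => u /=.
by rewrite cube_swap12 /s /=; case: u => [[? ?] ?].
Qed.

End Shear.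

(** * Quadratic forms on a sector *)

Section NonmeasurableMonotone.
Context d (T : measurableType d) (R : realType).
Variable mu : {measure set T -> \bar R}.
Local Open Scope ereal_scope.

(* Needed because the image of the wedge under exp is not known to be measurable. *)
Lemma ge0_le_integralT_set (f g : T -> \bar R) : (forall x, 0 <= f x) ->
  (forall x, f x <= g x) -> \int[mu]_x f x <= \int[mu]_x g x.
Proof.
move=> f0 fg; have g0 x : 0 <= g x by exact: le_trans (f0 x) (fg x).
rewrite !ge0_integralTE //; apply: le_ereal_sup => _ /= [h hf <-].
by exists h => // x; exact: le_trans (hf x) (fg x).
Qed.

End NonmeasurableMonotone.

Section Reflection.
Context {R : realType}.
Notation mu := (@lebesgue_measure R).

Lemma integral_reflect (s : R) (f : R -> \bar R) : `|s| = 1 ->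
  measurable_fun [set: R] f -> (forall x, (0 <= f x)%E) ->
  (\int[mu]_x f (s * x)%R = \int[mu]_x f x)%E.
Proof.
move=> hs mf f0.
have [->|->] : s = 1 \/ s = - 1.
- by move: hs; case: (ger0P s) => _ h; [left|right; rewrite -h opprK].
- by apply: eq_integral => x _; rewrite mul1r.
transitivity (\int[mu]_x (f \o -%R) x)%E.
  by apply: eq_integral => x _; rewrite mulN1r.
have := @ge0_integral_pushforward _ _ (measurableTypeR R) (measurableTypeR R) R
  (-%R) (@oppr_measurable R setT) mu setT f measurableT mf (fun x _ => f0 x).
rewrite preimage_setT => <-.
by apply: eq_measure_integral => A mA _; exact: lebesgue_measureN.
Qed.

End Reflection.

Section Sector.
Context {R : realType}.
Notation mu := (@lebesgue_measure R).
Notation T := (measurableTypeR R).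
Variables (alpha rho : R).
Hypotheses (alpha01 : 0 < alpha < 1) (rho0 : 0 < rho).

(** Base of one quarter of the wedge, reflected into the first quadrant. *)
Definition sector (x y : R) : bool :=
  [&& 0 < x, alpha * x <= y, alpha * y <= x & x ^+ 2 + y ^+ 2 <= rho ^+ 2].

Definition quad_form (a b c x y : R) : R := a + b * (x * y) + c * (x ^+ 2 + y ^+ 2).

(** Closed form of the integral of [quad_form a b c] over the sector: the opening angle for a and c,
    and a rational term for the coefficient of x y. *)
Definition sector_value (a b c : R) : R :=
  (a * rho ^+ 2 / 2 + c * rho ^+ 4 / 4) * (atan alpha^-1 - atan alpha)
  + b * rho ^+ 4 / 8 * ((1 - alpha ^+ 2) / (1 + alpha ^+ 2)).

Lemma measurable_sector : measurable_fun [set: R * R] (fun u : R * R => sector u.1 u.2).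
Proof.
rewrite /sector; apply: measurable_and.
  by apply: measurable_fun_ltr => //; exact: measurable_cst.
apply: measurable_and.
  by apply: measurable_fun_ler => //; apply: measurable_funM => //; exact: measurable_cst.
apply: measurable_and.
  by apply: measurable_fun_ler => //; apply: measurable_funM => //; exact: measurable_cst.
apply: measurable_fun_ler; last exact: measurable_cst.
by apply: measurable_funD; apply: measurable_funX.
Qed.

Lemma measurable_quad_form a b c :
  measurable_fun [set: R * R] (fun u : R * R => quad_form a b c u.1 u.2).
Proof.
rewrite /quad_form; apply: measurable_funD; first apply: measurable_funD => //.
- by apply: measurable_funM; [exact: measurable_cst|exact: measurable_funM].
- apply: measurable_funM; first exact: measurable_cst.
  by apply: measurable_funD; apply: measurable_funX.
Qed.

Variables (a b c : R).
Hypothesis p0 : forall x y, sector x y -> 0 <= quad_form a b c x y.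

Let F (u : R * R) : R := if sector u.1 u.2 then quad_form a b c u.1 u.2 else 0.

Let mF : measurable_fun [set: R * R] F.
Proof.
apply: measurable_fun_ifT; [exact: measurable_sector|exact: measurable_quad_form|].
exact: measurable_cst.
Qed.

Let F0 u : 0 <= F u. Proof. by rewrite /F; case: ifP => // /p0. Qed.

Let X (m : R) : R := rho / Num.sqrt (1 + m ^+ 2).

Let m1 (m : R) : 0 < 1 + m ^+ 2.
Proof. by rewrite ltr_pwDl // sqr_ge0. Qed.

Let X2 m : X m ^+ 2 = rho ^+ 2 / (1 + m ^+ 2).
Proof. by rewrite /X expr_div_n sqr_sqrtr // ltW. Qed.

Let X0 m : 0 < X m.
Proof. by rewrite /X divr_gt0 // sqrtr_gt0. Qed.

(* In the coordinates (x, m) with y = m x, the sector is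
   alpha <= m <= 1 / alpha, 0 < x <= rho / sqrt (1 + m^2). *)
Let H (x m : R) : R :=
  if [&& alpha <= m, m <= alpha^-1, 0 < x & x <= X m] then
    quad_form a b c x (x * m) * x else 0.

Let sectorE x m : 0 < x -> sector x (x * m) = [&& alpha <= m, m <= alpha^-1 & x <= X m].
Proof.
move=> x0; have [al0 _] := andP alpha01; rewrite /sector x0 /=.
rewrite (mulrC alpha x) (ler_pM2l x0) mulrCA -[X in _ && ((_ <= X) && _)]mulr1 (ler_pM2l x0).
congr (_ && (_ && _)).
  by rewrite -[m <= _](ler_pM2l al0) divff // gt_eqF.
have -> : x ^+ 2 + (x * m) ^+ 2 = x ^+ 2 * (1 + m ^+ 2) by ring.
by rewrite -(ler_pdivlMr _ _ (m1 m)) -X2 ler_pXn2r ?nnegrE // ltW.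
Qed.

Let mX : measurable_fun [set: R] X.
Proof.
apply: continuous_measurable_fun => m; rewrite /X.
apply: cvgM; first exact: cvg_cst.
apply: cvgV; first by rewrite gt_eqF // sqrtr_gt0.
apply: (@continuous_comp _ _ _ (fun m : R => 1 + m ^+ 2) Num.sqrt).
  by apply: cvgD; [exact: cvg_cst|exact: exprn_continuous].
exact: sqrt_continuous.
Qed.

Let mH : measurable_fun [set: R * R] (fun u : R * R => H u.1 u.2).
Proof.
rewrite /H; apply: measurable_fun_ifT; last exact: measurable_cst.
- apply: measurable_and; first by apply: measurable_fun_ler => //; exact: measurable_cst.
  apply: measurable_and; first by apply: measurable_fun_ler => //; exact: measurable_cst.
  apply: measurable_and; first by apply: measurable_fun_ltr => //; exact: measurable_cst.
  by apply: measurable_fun_ler => //; exact: measurableT_comp.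
- apply: measurable_funM => //.
  apply: (measurableT_comp (measurable_quad_form a b c) (g := fun u : R * R => (u.1, u.1 * u.2))).
  by apply: measurable_fun_pair => //; exact: measurable_funM.
Qed.

Let H0 x m : 0 <= H x m.
Proof.
rewrite /H; case: ifP => // /and4P[h1 h2 h3 h4].
by rewrite mulr_ge0 ?(ltW h3) // p0 // sectorE // h1 h2.
Qed.

Let inner_x x : (\int[mu]_y (F (x, y))%:E = \int[mu]_m (H x m)%:E)%E.
Proof.
have [al0 al1] := andP alpha01.
have [x0|x0] := ltP 0 x; last first.
  apply: eq_integral => y _; rewrite /F /H /sector /=.
  by rewrite ltNge x0 /= !andbF.
(* The factor 2 is slack: slopes in the sector do not exceed 1 / alpha. *)
have h2 : (0 : R) < 2 / alpha by rewrite divr_gt0.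
have dT (m : R) : is_derive m 1 (fun m : R => x * m) x by der; ring.
rewrite (@substitution R (fun m => x * m) (fun _ => x) 0 (2 / alpha) h2 dT); first last.
- move=> y hy; rewrite /F; case: ifP => // /and4P[/= _ h3 h4 _]; exfalso; apply: hy.
  rewrite mulr0 (lt_le_trans _ h3) ?mulr_gt0 //=.
  rewrite mulrA ler_pdivlMr // mulrC (le_trans h4) //; lra.
- by move=> y; exact: F0.
- by apply: (measurableT_comp mF); exact: pair1_measurable.
- by [].
- by move=> m; exact: cvg_cst.
rewrite integral_mkcond; apply: eq_integral => m _; rewrite patchE.
rewrite (_ : (m \in _) = (0 < m <= 2 / alpha)); last first.
  by apply/idP/idP; rewrite inE /= in_itv.
rewrite /F /H sectorE //= x0 /=.
case: ifP => [_|/negbT hm].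
  by case: ifP => _; rewrite ?mul0r.
case: ifP => // /and3P[h3 h4 _]; exfalso; move/negP: hm; apply.
by rewrite (lt_le_trans al0 h3) (le_trans h4) // ler_peMl ?invr_ge0 ?ltW //; lra.
Qed.

Let G (m : R) : R := a * rho ^+ 2 / 2 * (1 + m ^+ 2)^-1
  + b * rho ^+ 4 / 4 * m * ((1 + m ^+ 2)^-1) ^+ 2 + c * rho ^+ 4 / 4 * (1 + m ^+ 2)^-1.

Let inner_m m :
  (\int[mu]_x (H x m)%:E = (if (alpha <= m <= alpha^-1) then G m else 0)%:E)%E.
Proof.
have [/andP[h1 h2]|hm] := boolP (alpha <= m <= alpha^-1); last first.
  apply: integral0_eq => x _; rewrite /H; case: ifP => // /and4P[h1 h2 _ _].
  by move: hm; rewrite h1 h2.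
pose P (x : R) : R := a * (x ^+ 2 / 2) + (b * m + c * (1 + m ^+ 2)) * (x ^+ 4 / 4).
pose P' (x : R) : R := quad_form a b c x (x * m) * x.
have dP (x : R) : is_derive x 1 P (P' x).
  by rewrite /P /P' /quad_form; der; field.
have cP' : continuous P'.
  have dP' (x : R) : is_derive x 1 P' (a + 3 * (b * m + c * (1 + m ^+ 2)) * x ^+ 2).
    by rewrite /P' /quad_form; der; ring.
  by move=> x; exact: is_derive_continuous (dP' x).
have hX := substitution_integral P P' 0 (X m) dP cP' 0 (X m) (lexx _) (X0 m) (lexx _).
transitivity (\int[mu]_(x in `]0%R, X m]) (P' x)%:E)%E.
  rewrite [RHS]integral_mkcond; apply: eq_integral => x _; rewrite patchE /H h1 h2 /=.
  rewrite (_ : (x \in `]0, X m]%classic) = (0 < x <= X m)); first by case: ifP.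
  by apply/idP/idP; rewrite inE /= in_itv.
rewrite hX; congr (_%:E); rewrite /P /G.
have -> : X m ^+ 4 = (X m ^+ 2) ^+ 2 by rewrite -exprM.
rewrite X2; field; exact: lt0r_neq0.
Qed.

Lemma sector_integral :
  (\int[mu]_x \int[mu]_y (if sector x y then quad_form a b c x y else 0)%:E
   = (sector_value a b c)%:E)%E.
Proof.
have [al0 al1] := andP alpha01.
transitivity (\int[mu]_x \int[mu]_m (H x m)%:E)%E.
  by apply: eq_integral => x _; exact: inner_x.
rewrite (@fubini_tonelli _ _ T T R mu mu (fun u => (H u.1 u.2)%:E)); last 2 first.
- exact/measurable_EFinP.
- by move=> u; rewrite lee_fin.
under eq_integral do rewrite inner_m.
have al2 : alpha < alpha^-1 by rewrite (lt_trans al1) // invf_gt1.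
(* Antiderivative of [G]: atan m for 1/(1 + m^2), and - 1/(2 (1 + m^2)) for m/(1 + m^2)^2. Between
   alpha and 1/alpha the latter grows by (1 - alpha^2)/(2 (1 + alpha^2)). *)
pose Q (m : R) : R := (a * rho ^+ 2 / 2 + c * rho ^+ 4 / 4) * atan m
  - b * rho ^+ 4 / 8 * (1 + m ^+ 2)^-1.
have du (m : R) : has_derive (fun m : R => (1 + m ^+ 2)^-1) m
    (- (2 * m * (1 + m ^+ 2)^-1 ^+ 2)).
  have -> : - (2 * m * (1 + m ^+ 2)^-1 ^+ 2) = - (1 + m ^+ 2) ^- 2 * (0 + 2%:R * m ^+ 1 * 1).
    by rewrite exprVn; ring.
  apply: (derV (fun m : R => 1 + m ^+ 2)); first by rewrite gt_eqF.
  by apply: derD; [exact: derc|apply: derX; exact: derid].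
have dat (m : R) : has_derive atan m ((1 + m ^+ 2)^-1) by exact: is_derive1_atan.
have dQ (m : R) : is_derive m 1 Q (G m).
  rewrite /Q /G; have := du m; have := dat m.
  set u := fun m : R => (1 + m ^+ 2)^-1; move=> h1 h2.
  apply: der_eq.
    apply: derB; (apply: derM; first exact: derc); [exact: h1|exact: h2].
  rewrite /u; field; exact: lt0r_neq0.
have cG : continuous G.
  move=> m.
  have h2 := du m; have [g' hg] : exists g', has_derive G m g'; last exact: is_derive_continuous hg.
  eexists; apply: derD; first apply: derD.
  - apply: derM; [exact: derc|exact: h2].
  - apply: derM; first by apply: derM; [exact: derc|exact: derid].
    by apply: derX; exact: h2.
  - apply: derM; [exact: derc|exact: h2].
have hG := substitution_integral Q G alpha alpha^-1 dQ cG alpha alpha^-1 (lexx _) al2 (lexx _).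
transitivity (\int[mu]_(m in `[alpha, alpha^-1%R]) (G m)%:E)%E.
  rewrite [RHS]integral_mkcond; apply: eq_integral => m _; rewrite patchE.
  rewrite (_ : (m \in `[alpha, alpha^-1]%classic) = (alpha <= m <= alpha^-1)); first by case: ifP.
  by apply/idP/idP; rewrite inE /= in_itv.
rewrite -integral_itv_obnd_cbnd; last first.
  by apply/measurable_EFinP/measurable_funTS; exact: continuous_measurable_fun.
rewrite hG; congr (_%:E); rewrite /Q /sector_value.
have e1 : (1 : R) + alpha ^+ 2 != 0 by exact: lt0r_neq0.
by field; rewrite e1 gt_eqF.
Qed.

End Sector.

(** * Integrals over a block with given signs *)

Section WedgeIntegral.
Context {R : realType}.
Notation mu := (@lebesgue_measure R).
Notation T := (measurableTypeR R).
Variables (alpha rho h s1 s2 a b c : R).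
Hypotheses (alpha01 : 0 < alpha < 1) (rho0 : 0 < rho) (h0 : 0 < h).
Hypotheses (s1E : `|s1| = 1) (s2E : `|s2| = 1).
Hypothesis p0 : forall x y, sector alpha rho x y -> 0 <= quad_form a b c x y.

Definition wedge_block (u : R * R * R) : bool :=
  sector alpha rho (s1 * u.1.1) (s2 * u.1.2) && ((- h < u.2) && (u.2 < h)).

Lemma measurable_wedge_block : measurable_fun [set: R * R * R] wedge_block.
Proof.
rewrite /wedge_block; apply: measurable_and.
  apply: (measurableT_comp (measurable_sector alpha rho)
    (g := fun u : R * R * R => (s1 * u.1.1, s2 * u.1.2))).
  by apply: measurable_fun_pair; apply: measurable_funM; try exact: measurable_cst;
    exact: measurableT_comp.
by apply: measurable_and; apply: measurable_fun_ltr => //; exact: measurable_cst.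
Qed.

Lemma measurable_quad_form3 : measurable_fun [set: R * R * R]
  (fun u : R * R * R => quad_form a b c (s1 * u.1.1) (s2 * u.1.2)).
Proof.
apply: (measurableT_comp (measurable_quad_form a b c)
    (g := fun u : R * R * R => (s1 * u.1.1, s2 * u.1.2))).
by apply: measurable_fun_pair; apply: measurable_funM; try exact: measurable_cst;
  exact: measurableT_comp.
Qed.

Let integral_slab (q : R) :
  (\int[mu]_z (if ((- h < z) && (z < h))%R then q else 0)%:E = (2 * h * q)%:E)%E.
Proof.
transitivity (\int[mu]_(z in `](- h)%R, h[) q%:E)%E.
  rewrite [RHS]integral_mkcond; apply: eq_integral => z _; rewrite patchE.
  rewrite (_ : (z \in `](- h)%R, h[%classic) = ((- h < z) && (z < h))%R); first by case: ifP.
  by apply/idP/idP; rewrite inE /= in_itv.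
rewrite integral_cst; last exact: measurable_itv.
change (q%:E * mu `](- h)%R, h[%classic = (2 * h * q)%:E)%E.
have hh : - h < h by have := h0; lra.
rewrite lebesgue_measure_itv /= lte_fin hh -EFinD -EFinM; congr (_%:E); ring.
Qed.

Lemma wedge_integral :
  int3 (fun u => (if wedge_block u then quad_form a b c (s1 * u.1.1) (s2 * u.1.2) else 0)%:E)
  = (2 * h * sector_value alpha rho a b c)%:E.
Proof.
pose f x y := if sector alpha rho x y then
  quad_form (2 * h * a) (2 * h * b) (2 * h * c) x y else 0.
have qE x y : quad_form (2 * h * a) (2 * h * b) (2 * h * c) x y = 2 * h * quad_form a b c x y.
  by rewrite /quad_form; ring.
have p0' x y : sector alpha rho x y -> 0 <= quad_form (2 * h * a) (2 * h * b) (2 * h * c) x y.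
  by move=> hs; rewrite qE mulr_ge0 ?p0 //; have := h0; lra.
have f0 x y : 0 <= f x y by rewrite /f; case: ifP => // /p0'.
have mf : measurable_fun [set: R * R] (fun u : R * R => f u.1 u.2).
  apply: measurable_fun_ifT; [exact: measurable_sector|exact: measurable_quad_form|].
  exact: measurable_cst.
rewrite int3_iter; last 2 first.
- apply/measurable_EFinP; apply: measurable_fun_ifT; [exact: measurable_wedge_block| |].
    exact: measurable_quad_form3.
  exact: measurable_cst.
- by move=> u; rewrite lee_fin; case: ifP => // /andP[/p0].
transitivity (\int[mu]_x \int[mu]_y (f (s1 * x)%R (s2 * y)%R)%:E)%E.
  apply: eq_integral => x _; apply: eq_integral => y _.
  rewrite /wedge_block /f /=; case: (sector alpha rho (s1 * x) (s2 * y)) => /=.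
    by rewrite integral_slab qE.
  by rewrite integral0.
pose F (x : R) : \bar R := (\int[mu]_y (f x y)%:E)%E.
have mF : measurable_fun [set: R] F.
  apply: (@measurable_fun_fubini_tonelli_F _ _ T T R mu (fun u => (f u.1 u.2)%:E)).
    exact/measurable_EFinP.
  by move=> u; rewrite lee_fin.
transitivity (\int[mu]_x F (s1 * x)%R)%E.
  apply: eq_integral => x _.
  apply: (@integral_reflect R s2 (fun y => (f (s1 * x)%R y)%:E)) => //; last by move=> y; rewrite lee_fin.
  by apply/measurable_EFinP; exact: (measurableT_comp mf (pair1_measurable (s1 * x))).
have F0 : forall x, (0 <= F x)%E by move=> x; apply: integral_ge0 => y _; rewrite lee_fin.
transitivity (\int[mu]_x F x)%E; first exact: (integral_reflect s1 F s1E mF F0).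
rewrite /F (sector_integral alpha rho alpha01 rho0) //; congr (_%:E).
by rewrite /sector_value; ring.
Qed.

End WedgeIntegral.

(** * Straightening the exponential map *)

Section Shears.
Context {R : realType}.
Implicit Type u : R * R * R.

Definition pt u : 'I_3 -> R := fun i => [:: u.1.1; u.1.2; u.2]`_i.

Lemma measurable_x : measurable_fun [set: R * R * R] (fun u => u.1.1).
Proof. exact: measurableT_comp. Qed.

Lemma measurable_y : measurable_fun [set: R * R * R] (fun u => u.1.2).
Proof. exact: measurableT_comp. Qed.

Lemma measurable_z : measurable_fun [set: R * R * R] (fun u => u.2).
Proof. exact: measurable_snd. Qed.

Variables kappa c1 c2 : R.

Definition shear1 u := u.1.1 - geo_acc_cubic kappa (pt u) (pt u) 0 / 6 + c1.
Definition shear2 u := u.1.2 - geo_acc_cubic kappa (pt u) (pt u) 1 / 6 + c2.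
Definition shear3 u := u.2 - geo_acc_cubic kappa (pt u) (pt u) 2 / 6.

(** Derivative of each shear in the coordinate that it moves. *)
Definition jac1 u := 1 - kappa * (u.1.1 * u.1.2) + u.1.2 ^+ 2 / 6.
Definition jac2 u := 1 - kappa * (u.1.1 * u.1.2) - u.1.1 ^+ 2 / 3.
Definition jac3 u := 1 + 2 / 3 * kappa * (u.1.1 * u.1.2).

Definition step1 u := (shear1 u, u.1.2, u.2).
Definition step2 u := (u.1.1, shear2 u, u.2).
Definition step3 u := (u.1, shear3 u).

(* Inverts v |-> v + geo_acc_cubic v v / 6 up to fourth order, then translates by
   (c1, c2, 0); the Jacobian of the three triangular shears is a product. *)
Definition straighten u := step3 (step2 (step1 u)).
Definition straighten_jac u := jac1 u * jac2 (step1 u) * jac3 (step2 (step1 u)).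

Lemma shear1E u : shear1 u = u.1.1 - (kappa * (3 * (u.1.1 ^+ 2 * u.1.2) - u.1.2 ^+ 3 + u.1.2 * u.2 ^+ 2)
  - u.1.1 * u.1.2 ^+ 2) / 6 + c1.
Proof. by rewrite /shear1 /geo_acc_cubic /pt /=; ring. Qed.

Lemma shear2E u : shear2 u = u.1.2 - (kappa * (3 * (u.1.1 * u.1.2 ^+ 2) - u.1.1 ^+ 3 + u.1.1 * u.2 ^+ 2)
  + 2 * u.1.1 ^+ 2 * u.1.2) / 6 + c2.
Proof. by rewrite /shear2 /geo_acc_cubic /pt /=; ring. Qed.

Lemma shear3E u : shear3 u = u.2 + 2 / 3 * kappa * (u.1.1 * u.1.2) * u.2.
Proof. by rewrite /shear3 /geo_acc_cubic /pt /=; field. Qed.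

Ltac meas := repeat first [exact: measurable_x|exact: measurable_y|exact: measurable_z|
  exact: measurable_cst|apply: measurable_funB|apply: measurable_funD|apply: measurable_funM|
  apply: measurable_funX].

Lemma measurable_shear1 : measurable_fun [set: R * R * R] shear1.
Proof. by rewrite (funext shear1E); meas. Qed.

Lemma measurable_shear2 : measurable_fun [set: R * R * R] shear2.
Proof. by rewrite (funext shear2E); meas. Qed.

Lemma measurable_shear3 : measurable_fun [set: R * R * R] shear3.
Proof. by rewrite (funext shear3E); meas. Qed.

Lemma measurable_jac1 : measurable_fun [set: R * R * R] jac1.
Proof. by rewrite /jac1; meas. Qed.

Lemma measurable_jac2 : measurable_fun [set: R * R * R] jac2.
Proof. by rewrite /jac2; meas. Qed.

Lemma measurable_jac3 : measurable_fun [set: R * R * R] jac3.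
Proof. by rewrite /jac3; meas. Qed.

Lemma measurable_step1 : measurable_fun [set: R * R * R] step1.
Proof.
apply: measurable_fun_pair; last exact: measurable_z.
by apply: measurable_fun_pair; [exact: measurable_shear1|exact: measurable_y].
Qed.

Lemma measurable_step2 : measurable_fun [set: R * R * R] step2.
Proof.
apply: measurable_fun_pair; last exact: measurable_z.
by apply: measurable_fun_pair; [exact: measurable_x|exact: measurable_shear2].
Qed.

Lemma measurable_step3 : measurable_fun [set: R * R * R] step3.
Proof. by apply: measurable_fun_pair => //; exact: measurable_shear3. Qed.

Lemma measurable_straighten : measurable_fun [set: R * R * R] straighten.
Proof.
apply: (measurableT_comp measurable_step3).
by apply: (measurableT_comp measurable_step2); exact: measurable_step1.
Qed.

Lemma measurable_straighten_jac : measurable_fun [set: R * R * R] straighten_jac.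
Proof.
apply: measurable_funM; first apply: measurable_funM.
- exact: measurable_jac1.
- by apply: (measurableT_comp measurable_jac2); exact: measurable_step1.
- apply: (measurableT_comp measurable_jac3).
  by apply: (measurableT_comp measurable_step2); exact: measurable_step1.
Qed.

Variable M : R.
Hypotheses (M0 : 0 < M) (M1 : 40 * (1 + `|kappa|) * M ^+ 2 <= 1).
Hypotheses (c1M : `|c1| <= M / 4) (c2M : `|c2| <= M / 4).

Let prod_le (x y B C : R) : `|x| <= B -> `|y| <= C -> `|x * y| <= B * C.
Proof. by move=> hx hy; rewrite normrM ler_pM. Qed.

Let mono3 (x y z : R) : `|x| <= 2 * M -> `|y| <= 2 * M -> `|z| <= 2 * M ->
  `|x * (y * z)| <= 8 * M ^+ 2 * M.
Proof.
move=> hx hy hz; apply: le_trans (prod_le _ _ _ _ hx (prod_le _ _ _ _ hy hz)) _.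
by rewrite le_eqVlt; apply/orP; left; apply/eqP; ring.
Qed.

Let mono2 (x y : R) : `|x| <= 2 * M -> `|y| <= 2 * M -> `|x * y| <= 4 * M ^+ 2.
Proof.
move=> hx hy; apply: le_trans (prod_le _ _ _ _ hx hy) _.
by rewrite le_eqVlt; apply/orP; left; apply/eqP; ring.
Qed.

Let small2 (a b : R) (A B : R) : `|a| <= A * M ^+ 2 -> `|b| <= B * M ^+ 2 ->
  0 <= A -> 0 <= B -> A <= 20 -> B <= 20 -> `|kappa * a + b| <= 1 / 2.
Proof.
move=> ha hb A0 B0 A1 B1; apply: le_trans (ler_normD _ _) _.
rewrite normrM; have k0 := normr_ge0 kappa; have h := M1; have m2 := sqr_ge0 M.
apply: (@le_trans _ _ (20 * (1 + `|kappa|) * M ^+ 2)); last lra.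
have h1 : `|kappa| * `|a| <= `|kappa| * (20 * M ^+ 2).
  by apply: ler_wpM2l => //; apply: le_trans ha _; exact: ler_wpM2r.
have h2 : `|b| <= 20 * M ^+ 2 by apply: le_trans hb _; exact: ler_wpM2r.
lra.
Qed.

(** The polynomials to come are sums of monomials of size 8 M^3 with total weight at most 5/6,
    whence 40/6. By [M1] they cost at most M / 6, and the translation M / 4. *)
Let small3 (a b c : R) : `|a| <= 40 / 6 * (M ^+ 2 * M) -> `|b| <= 40 / 6 * (M ^+ 2 * M) ->
  `|c| <= M / 4 -> `|- (kappa * a + b) + c| <= M / 2.
Proof.
move=> ha hb hc; apply: le_trans (ler_normD _ _) _; rewrite normrN.
suff : `|kappa * a + b| <= M / 4 by lra.
apply: le_trans (ler_normD _ _) _.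
rewrite normrM; have k0 := normr_ge0 kappa; have h := M1; have m0 := M0.
have h1 : `|kappa| * `|a| <= `|kappa| * (40 / 6 * (M ^+ 2 * M)) by exact: ler_wpM2l.
have h2 : 40 * (1 + `|kappa|) * M ^+ 2 * M <= 1 * M by apply: ler_wpM2r => //; exact: ltW.
lra.
Qed.

Lemma good_shear1 (y z : R) : `|y| <= 2 * M -> `|z| <= 2 * M ->
  good_shear M (fun x => shear1 (x, y, z)) (fun x => jac1 (x, y, z)).
Proof.
move=> hy hz; split.
- move=> x; under eq_fun do rewrite shear1E.
  by rewrite /jac1 /=; der; field.
- move=> x; rewrite /jac1 /=.
  by apply: is_derive_continuous; der; reflexivity.
move=> x hx; rewrite shear1E /jac1 /=; split.
  have := small2 (x * y) (- (y * y) / 6) 4 1.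
  rewrite mono2 // => /(_ isT); rewrite normrM normrN (ger0_norm (_ : 0 <= 6^-1)) ?invr_ge0 //.
  have := mono2 y y hy hy; have := sqr_ge0 M => h1 h2 h.
  have := h ltac:(lra) ltac:(lra) ltac:(lra) ltac:(lra) ltac:(lra).
  by rewrite ler_norml => /andP[_]; rewrite expr2; lra.
set a := (3 * (x ^+ 2 * y) - y ^+ 3 + y * z ^+ 2) / 6.
rewrite (_ : _ - x = - (kappa * a + - (x * (y * y)) / 6) + c1); last by rewrite /a; ring.
have h6 : `|6^-1 : R| = 6^-1 by rewrite ger0_norm // invr_ge0.
have m3 : 0 <= M ^+ 2 * M by rewrite mulr_ge0 ?sqr_ge0 // ltW.
have := M0; have := c1M; have := mono3 _ _ _ hx hx hy; have := mono3 _ _ _ hy hy hy.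
have := mono3 _ _ _ hy hz hz; have := mono3 _ _ _ hx hy hy.
move=> g1 g2 g3 g4 g5 g6; apply: small3 => //; last by rewrite normrM normrN h6; lra.
rewrite /a normrM h6.
have : `|3 * (x ^+ 2 * y) - y ^+ 3 + y * z ^+ 2| <=
    3 * `|x * (x * y)| + `|y * (y * y)| + `|y * (z * z)|.
  rewrite (_ : 3 * (x ^+ 2 * y) - y ^+ 3 + y * z ^+ 2 =
    3 * (x * (x * y)) - y * (y * y) + y * (z * z)); last by ring.
  apply: le_trans (ler_normD _ _) _; rewrite lerD2r.
  by apply: le_trans (ler_normB _ _) _; rewrite lerD2r normrM ger0_norm.
lra.
Qed.

Lemma good_shear2 (x z : R) : `|x| <= 2 * M -> `|z| <= 2 * M ->
  good_shear M (fun y => shear2 (x, y, z)) (fun y => jac2 (x, y, z)).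
Proof.
move=> hx hz; split.
- move=> y; under eq_fun do rewrite shear2E.
  by rewrite /jac2 /=; der; field.
- move=> y; rewrite /jac2 /=.
  by apply: is_derive_continuous; der; reflexivity.
move=> y hy; rewrite shear2E /jac2 /=; split.
  have := small2 (x * y) ((x * x) / 3) 4 2.
  rewrite mono2 // => /(_ isT); rewrite normrM (ger0_norm (_ : 0 <= 3^-1)) ?invr_ge0 //.
  have := mono2 x x hx hx; have := sqr_ge0 M => h1 h2 h.
  have := h ltac:(lra) ltac:(lra) ltac:(lra) ltac:(lra) ltac:(lra).
  by rewrite ler_norml => /andP[_]; rewrite expr2; lra.
set a := (3 * (x * y ^+ 2) - x ^+ 3 + x * z ^+ 2) / 6.
rewrite (_ : _ - y = - (kappa * a + (x * (x * y)) / 3) + c2); last by rewrite /a; field.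
have h6 : `|6^-1 : R| = 6^-1 by rewrite ger0_norm // invr_ge0.
have h3 : `|3^-1 : R| = 3^-1 by rewrite ger0_norm // invr_ge0.
have m3 : 0 <= M ^+ 2 * M by rewrite mulr_ge0 ?sqr_ge0 // ltW.
have := M0; have := c2M; have := mono3 _ _ _ hx hx hy; have := mono3 _ _ _ hx hx hx.
have := mono3 _ _ _ hx hz hz; have := mono3 _ _ _ hx hy hy.
move=> g1 g2 g3 g4 g5 g6; apply: small3 => //; last by rewrite normrM h3; lra.
rewrite /a normrM h6.
have : `|3 * (x * y ^+ 2) - x ^+ 3 + x * z ^+ 2| <=
    3 * `|x * (y * y)| + `|x * (x * x)| + `|x * (z * z)|.
  rewrite (_ : 3 * (x * y ^+ 2) - x ^+ 3 + x * z ^+ 2 =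
    3 * (x * (y * y)) - x * (x * x) + x * (z * z)); last by ring.
  apply: le_trans (ler_normD _ _) _; rewrite lerD2r.
  by apply: le_trans (ler_normB _ _) _; rewrite lerD2r normrM ger0_norm.
lra.
Qed.

Lemma good_shear3 (x y : R) : `|x| <= 2 * M -> `|y| <= 2 * M ->
  good_shear M (fun z => shear3 (x, y, z)) (fun z => jac3 (x, y, z)).
Proof.
move=> hx hy; split.
- move=> z; under eq_fun do rewrite shear3E.
  by rewrite /jac3 /=; der; ring.
- by move=> z; rewrite /jac3 /=; exact: cvg_cst.
move=> z hz; rewrite shear3E /jac3 /=; split.
  have := small2 (- (2 / 3 * (x * y))) 0 4 0.
  have := mono2 x y hx hy; have := sqr_ge0 M => h1 h2 h.
  have := h _ _ _ _ _ _; rewrite normr0 mul0r normrN normrM (ger0_norm (_ : 0 <= 2 / 3)) //.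
  move=> /(_ ltac:(lra) ltac:(lra) ltac:(lra) ltac:(lra) ltac:(lra) ltac:(lra)).
  by rewrite ler_norml => /andP[_]; lra.
rewrite (_ : _ - z = - (kappa * (- (2 / 3) * (x * (y * z))) + 0) + 0); last by ring.
have h6 : `|2 / 3 : R| = 2 / 3 by rewrite ger0_norm.
have m3 : 0 <= M ^+ 2 * M by rewrite mulr_ge0 ?sqr_ge0 // ltW.
have := M0; have := mono3 _ _ _ hx hy hz => g1 g2.
apply: small3; [|by rewrite normr0; lra|by rewrite normr0; lra].
by rewrite normrM normrN h6; lra.
Qed.

Lemma jac1_gt0 u : cube (2 * M) u -> 0 < jac1 u.
Proof.
case: u => [[x y] z] /and3P[hx hy hz].
by have [_ _ h] := good_shear1 y z hy hz; have [] := h x hx.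
Qed.

Lemma jac2_gt0 u : cube (2 * M) u -> 0 < jac2 u.
Proof.
case: u => [[x y] z] /and3P[hx hy hz].
by have [_ _ h] := good_shear2 x z hx hz; have [] := h y hy.
Qed.

Lemma jac3_gt0 u : cube (2 * M) u -> 0 < jac3 u.
Proof.
case: u => [[x y] z] /and3P[hx hy hz].
by have [_ _ h] := good_shear3 x y hx hy; have [] := h z hz.
Qed.

Let cube2 u : cube M u -> cube (2 * M) u.
Proof. by have := M0; move=> m0 /and3P[h1 h2 h3]; apply/and3P; split; lra. Qed.

(** Each coordinate moves exactly once, so every coordinate of an intermediate point is one of [u]
    or of [straighten u]. *)
Let cube_steps u : cube (2 * M) u -> cube M (straighten u) ->
  cube (2 * M) (step1 u) /\ cube (2 * M) (step2 (step1 u)).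
Proof.
have m0 := M0; move=> /and3P[h1 h2 h3] /and3P[/= g1 g2 g3].
by split; apply/and3P; split => //=; lra.
Qed.

Lemma straighten_jac_gt0 u : cube (2 * M) u -> cube M (straighten u) -> 0 < straighten_jac u.
Proof.
move=> hu hs; have [h1 h2] := cube_steps u hu hs.
by rewrite !mulr_gt0 // ?jac1_gt0 ?jac2_gt0 ?jac3_gt0.
Qed.

(** Substitutions are made in the order z, y, x, opposite to the composition. The cutoffs they
    introduce at intermediate points disappear at the end: where the integrand is nonzero they hold
    by [cube_steps]. *)
Theorem straighten_integral (g : R * R * R -> R) : measurable_fun [set: R * R * R] g ->
  (forall u, 0 <= g u) -> (forall u, g u != 0 -> cube M u) ->
  int3 (fun u => (g u)%:E) =
  int3 (fun u => (if cube (2 * M) u then g (straighten u) * straighten_jac u else 0)%:E).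
Proof.
move=> mg g0 gM.
pose g1 u := if cube (2 * M) u then g (step3 u) * jac3 u else 0.
pose g2 u := if cube (2 * M) u then g1 (step2 u) * jac2 u else 0.
have nz (A B : R) : A * B != 0 -> A != 0 by apply: contraNN => /eqP ->; rewrite mul0r.
have mg1 : measurable_fun [set: R * R * R] g1.
  by apply: measurable_sheared => //; [exact: measurable_jac3|exact: measurable_step3].
have mg2 : measurable_fun [set: R * R * R] g2.
  by apply: measurable_sheared => //; [exact: measurable_jac2|exact: measurable_step2].
have g10 u : 0 <= g1 u.
  by rewrite /g1; case: ifP => // hc; rewrite mulr_ge0 // ltW // jac3_gt0.
have g20 u : 0 <= g2 u.
  by rewrite /g2; case: ifP => // hc; rewrite mulr_ge0 // ltW // jac2_gt0.
rewrite (shear_z M M0 shear3 jac3 g measurable_shear3 measurable_jac3 good_shear3 mg g0); last first.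
  by move=> u /gM h; split; [exact: cube2|case/and3P: h].
rewrite (shear_y M M0 shear2 jac2 g1 measurable_shear2 measurable_jac2 good_shear2 mg1 g10); last first.
  move=> u; rewrite /g1; case: ifP => [hc /nz/gM /and3P[_ h _]|_]; last by rewrite eqxx.
  by split.
rewrite (shear_x M M0 shear1 jac1 g2 measurable_shear1 measurable_jac1 good_shear1 mg2 g20); last first.
  move=> u; rewrite /g2; case: ifP => [hc /nz|_]; last by rewrite eqxx.
  rewrite /g1; case: ifP => [hc' /nz/gM /and3P[h _ _]|_]; last by rewrite eqxx.
  by split.
congr int3; apply/funext => u; case: ifP => // hu; congr (_%:E).
change (g2 (step1 u) * jac1 u = g (straighten u) * straighten_jac u).
rewrite /g2 /g1 /straighten_jac.
have [e|/gM hs] := eqVneq (g (straighten u)) 0.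
  by rewrite e; case: ifP; rewrite ?mul0r //; case: ifP; rewrite ?mul0r.
have [-> ->] := cube_steps u hu hs.
by rewrite /straighten; ring.
Qed.

End Shears.

Section StraightenFlow.
Context {R : realType}.
Variable kappa : R.

(** P has order 3 in the sense of [order_at0]; balls of radius 8 t give the factor 512 = 8^3. *)
Lemma cubic_perturb : exists2 C : R, 0 <= C & forall t (a b : 'I_3 -> R) M i,
  0 < t -> 8 * t <= geo_radius kappa -> (forall j, `|a j| <= 8 * t) -> (forall j, `|b j| <= 8 * t) ->
  0 <= M -> (forall j, `|a j - b j| <= M) ->
  `|geo_acc_cubic kappa a a i / 6| <= C * t ^+ 3 /\
  `|geo_acc_cubic kappa a a i / 6 - geo_acc_cubic kappa b b i / 6| <= C * t ^+ 2 * M.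
Proof.
have hr := geo_radius_le1 kappa.
have ho i : order_at0 (geo_radius kappa) 3 (fun p => geo_acc_cubic kappa p.1 p.1 i / 6).
  move: i; apply: ord3_case; rewrite /geo_acc_cubic /=;
    by (apply: (order_le _ hr); [order_at0_tac|]).
have [C0 p0 h0] := ho 0; have [C1 p1 h1] := ho 1; have [C2 p2 h2] := ho 2.
pose C := C0 + C1 + C2; exists (512 * C); first by rewrite /C; lra.
move=> t a b M i t0 tr ha hb M0 hab.
have [C' [C'0 C'C H]] : exists C', [/\ 0 <= C', C' <= C & forall d : R, 0 < d -> d <= geo_radius kappa ->
    (forall p, in_ball d p -> `|geo_acc_cubic kappa p.1 p.1 i / 6| <= C' * d ^+ 3) /\
    (forall p q (M : R), in_ball d p -> in_ball d q -> 0 <= M -> close M p q ->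
       d * `|geo_acc_cubic kappa p.1 p.1 i / 6 - geo_acc_cubic kappa q.1 q.1 i / 6| <= C' * d ^+ 3 * M)].
  rewrite /C; move: i; apply: ord3_case.
  - by exists C0; split => //; lra.
  - by exists C1; split => //; lra.
  - by exists C2; split => //; lra.
have t8 : 0 < 8 * t by lra.
have [g1 g2] := H (8 * t) t8 tr.
have pa : in_ball (8 * t) (a, fun=> 0) by move=> j; split => //=; rewrite normr0 ltW.
have pb : in_ball (8 * t) (b, fun=> 0) by move=> j; split => //=; rewrite normr0 ltW.
have cl : close M (a, fun=> 0) (b, fun=> 0) by move=> j; split => //=; rewrite subrr normr0.
split.
  apply: le_trans (g1 _ pa) _; rewrite exprMn.
  rewrite (_ : C' * (8 ^+ 3 * t ^+ 3) = 512 * C' * t ^+ 3); last by ring.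
  by apply: ler_wpM2r; [rewrite exprn_ge0 // ltW|lra].
have := g2 _ _ M pa pb M0 cl; rewrite /=.
set X := `|_|; rewrite (_ : C' * (8 * t) ^+ 3 * M = 8 * t * (64 * C' * t ^+ 2 * M)); last by ring.
rewrite ler_pM2l // => h; apply: le_trans h _; apply: ler_wpM2r => //; apply: ler_wpM2r; [exact: sqr_ge0|lra].
Qed.

End StraightenFlow.

(** Replacing v in P by a point within A t^3 of it costs about t^2 t^3 = t^5, so P taken at the
    image w, or at a partly corrected point, equals P(v) to fourth order. The constants alternate:
    A, A1, A2 bound the distance to v before each of the three shears, B, B1, B2 the error left in
    the coordinate just corrected; a translation of size t^3 adds 1. *)
Lemma straighten_flow {R : realType} (kappa eps m Cf : R) (c d : ('I_3 -> R) -> 'I_3 -> R -> R) :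
  is_flow kappa eps m Cf c d -> 0 < m -> 0 <= Cf -> exists K t0 : R, [/\ 0 <= K, 0 < t0 & forall t c1 c2 v (w : R * R * R),
  0 < t -> t <= t0 -> `|c1| <= t ^+ 3 -> `|c2| <= t ^+ 3 -> (forall i, `|v i| <= t) ->
  (forall i, pt w i = c v i 1) ->
  let s := straighten kappa c1 c2 w in
  [/\ `|s.1.1 - v 0 - c1| <= K * t ^+ 4, `|s.1.2 - v 1 - c2| <= K * t ^+ 4,
      `|s.2 - v 2| <= K * t ^+ 4 & forall i, `|pt s i - pt w i| <= K * t ^+ 3]].
Proof.
move=> fl m0 Cf0; have [C C0 HC] := cubic_perturb kappa.
have [A AE] : exists x : R, x = C + Cf + 1 by exists (C + Cf + 1).
have [B BE] : exists x : R, x = Cf + C * A by exists (Cf + C * A).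
have [A1 A1E] : exists x : R, x = A + B + 1 by exists (A + B + 1).
have [B1 B1E] : exists x : R, x = Cf + C * A1 by exists (Cf + C * A1).
have [A2 A2E] : exists x : R, x = A1 + B1 + 1 by exists (A1 + B1 + 1).
have [B2 B2E] : exists x : R, x = Cf + C * A2 by exists (Cf + C * A2).
have A0 : 1 <= A by rewrite AE; clear -C0 Cf0; lra.
have B0 : 0 <= B by rewrite BE addr_ge0 // mulr_ge0 //; clear -A0; lra.
have A10 : 1 <= A1 by rewrite A1E; clear -A0 B0; lra.
have B10 : 0 <= B1 by rewrite B1E addr_ge0 // mulr_ge0 //; clear -A10; lra.
have A20 : 1 <= A2 by rewrite A2E; clear -A10 B10; lra.
have B20 : 0 <= B2 by rewrite B2E addr_ge0 // mulr_ge0 //; clear -A20; lra.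
(* [A2^-1] gives A2 t^3 <= t, which keeps the intermediate points in the ball of radius 8 t; m / 4
   is the range of [flow_cubic]. *)
pose t0 := Num.min (A2^-1) (Num.min (geo_radius kappa / 8) (m / 4)).
have t00 : 0 < t0.
  have g0 := geo_radius_gt0 kappa.
  by rewrite !lt_min invr_gt0 !divr_gt0 // (lt_le_trans ltr01).
exists (A + A2 + B2), t0; split => //; first by clear -A0 A20 B20; lra.
move=> t c1 c2 v w t_gt0 tt0 hc1 hc2 hv hw s.
have [ht1 ht2 ht3] : [/\ t <= A2^-1, t <= geo_radius kappa / 8 & t <= m / 4].
  by split; apply: le_trans tt0 _; rewrite /t0 !ge_min lexx ?orbT.
have tr : 8 * t <= geo_radius kappa by clear -ht2; lra.
have tm : 4 * t <= m by clear -ht3; lra.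
have t1 : t <= 1 by have := geo_radius_le1 kappa; clear -tr t_gt0; lra.
have At : A2 * t <= 1 by rewrite mulrC -ler_pdivlMr // ?mul1r //; clear -A20; lra.
have t2p : 0 <= t ^+ 2 by exact: sqr_ge0.
have t3p : 0 <= t ^+ 3 by rewrite exprn_ge0 // ltW.
have t4p : 0 <= t ^+ 4 by rewrite exprn_ge0 // ltW.
have t32 : t ^+ 3 <= t ^+ 2 by rewrite ler_wiXn2l // ltW.
have t43 : t ^+ 4 <= t ^+ 3 by rewrite ler_wiXn2l // ltW.
have t54 : t ^+ 5 <= t ^+ 4 by rewrite ler_wiXn2l // ltW.
have A2t3 : A2 * t ^+ 3 <= t.
  rewrite (_ : A2 * t ^+ 3 = A2 * t * t ^+ 2); last by ring.
  have h1 : A2 * t * t ^+ 2 <= 1 * t ^+ 2 by apply: ler_wpM2r.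
  have h2 : t ^+ 2 <= t by rewrite expr2 ler_piMr // ltW.
  by clear -h1 h2; lra.
have le_mul (X Y : R) : X <= Y -> X * t ^+ 3 <= Y * t ^+ 3 by move=> h; exact: ler_wpM2r.
have A13 : A * t ^+ 3 <= A1 * t ^+ 3 by apply: le_mul; rewrite A1E; clear -B0; lra.
have A23 : A1 * t ^+ 3 <= A2 * t ^+ 3 by apply: le_mul; rewrite A2E; clear -B10; lra.
have hv8 j : `|v j| <= 8 * t by apply: le_trans (hv j) _; clear -t_gt0; lra.
have F i : `|pt w i - v i - geo_acc_cubic kappa v v i / 6| <= Cf * t ^+ 4.
  by rewrite hw; exact: (flow_cubic _ _ _ _ _ _ fl).
have pert (a : 'I_3 -> R) X i : 1 <= X -> X * t ^+ 3 <= A2 * t ^+ 3 ->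
    (forall j, `|v j - a j| <= X * t ^+ 3) ->
    `|geo_acc_cubic kappa v v i / 6 - geo_acc_cubic kappa a a i / 6| <= C * X * t ^+ 4.
  move=> X1 XA ha.
  have ha8 j : `|a j| <= 8 * t.
    rewrite (_ : a j = v j - (v j - a j)); last by ring.
    by apply: le_trans (ler_normB _ _) _; have := hv j; have := ha j; clear -XA A2t3 t_gt0; lra.
  have Xp : 0 <= X * t ^+ 3 by rewrite mulr_ge0 //; clear -X1; lra.
  have [_ h] := HC t v a (X * t ^+ 3) i t_gt0 tr hv8 ha8 Xp ha.
  apply: le_trans h _; rewrite (_ : _ * _ = C * X * t ^+ 5); last by ring.
  by apply: ler_wpM2l => //; rewrite mulr_ge0 //; clear -X1; lra.
have step (w' : R * R * R) X i z : 1 <= X -> X * t ^+ 3 <= A2 * t ^+ 3 ->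
    (forall j, `|v j - pt w' j| <= X * t ^+ 3) -> pt w' i = pt w i ->
    z = pt w' i - geo_acc_cubic kappa (pt w') (pt w') i / 6 ->
    `|z - v i| <= (Cf + C * X) * t ^+ 4.
  move=> X1 XA hX e ->; rewrite e.
  rewrite (_ : _ - v i = (pt w i - v i - geo_acc_cubic kappa v v i / 6) +
     (geo_acc_cubic kappa v v i / 6 - geo_acc_cubic kappa (pt w') (pt w') i / 6)); last by ring.
  by apply: le_trans (ler_normD _ _) _; rewrite mulrDl; apply: lerD; [exact: F|exact: pert].
have hw0 j : `|v j - pt w j| <= A * t ^+ 3.
  have [h _] := HC t v v 0 j t_gt0 tr hv8 hv8 (lexx _) (fun j => ltac:(by rewrite subrr normr0)).
  rewrite distrC (_ : pt w j - v j = (pt w j - v j - geo_acc_cubic kappa v v j / 6) +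
    geo_acc_cubic kappa v v j / 6); last by ring.
  apply: le_trans (ler_normD _ _) _; have := F j.
  have : Cf * t ^+ 4 <= Cf * t ^+ 3 by exact: ler_wpM2l.
  by move: h; rewrite AE; clear -t3p; lra.
pose w1 := step1 kappa c1 w.
have e1 : `|w1.1.1 - c1 - v 0| <= B * t ^+ 4.
  rewrite BE; apply: (step w A 0) => //; first by clear -A13 A23; lra.
  by rewrite /w1 /= /shear1 addrK.
have hw1 j : `|v j - pt w1 j| <= A1 * t ^+ 3.
  move: j; apply: ord3_case; last 2 first.
  - by apply: le_trans (hw0 1) _.
  - by apply: le_trans (hw0 2) _.
  rewrite distrC (_ : _ - v 0 = (w1.1.1 - c1 - v 0) + c1); last by rewrite /pt /=; ring.
  apply: le_trans (ler_normD _ _) _.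
  have : B * t ^+ 4 <= B * t ^+ 3 by exact: ler_wpM2l.
  have : 0 <= A * t ^+ 3 by rewrite mulr_ge0 //; clear -A0; lra.
  by rewrite A1E; clear -hc1 e1; lra.
pose w2 := step2 kappa c2 w1.
have e2 : `|w2.1.2 - c2 - v 1| <= B1 * t ^+ 4.
  rewrite B1E; apply: (step w1 A1 1) => //.
  by rewrite /w2 /= /shear2 addrK.
have hw2 j : `|v j - pt w2 j| <= A2 * t ^+ 3.
  move: j; apply: ord3_case; [exact: le_trans (hw1 0) _| |exact: le_trans (hw1 2) _].
  rewrite distrC (_ : _ - v 1 = (w2.1.2 - c2 - v 1) + c2); last by rewrite /pt /=; ring.
  apply: le_trans (ler_normD _ _) _.
  have : B1 * t ^+ 4 <= B1 * t ^+ 3 by exact: ler_wpM2l.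
  have : 0 <= A1 * t ^+ 3 by rewrite mulr_ge0 //; clear -A10; lra.
  by rewrite A2E; clear -hc2 e2; lra.
have e3 : `|s.2 - v 2| <= B2 * t ^+ 4.
  by rewrite B2E; apply: (step w2 A2 2) => //; rewrite ?lexx.
have BK : B * t ^+ 4 <= (A + A2 + B2) * t ^+ 4.
  by apply: ler_wpM2r => //; rewrite A2E A1E; clear -A0 B0 B10 B20; lra.
have B1K : B1 * t ^+ 4 <= (A + A2 + B2) * t ^+ 4.
  by apply: ler_wpM2r => //; rewrite A2E; clear -A0 A10 B20; lra.
have B2K : B2 * t ^+ 4 <= (A + A2 + B2) * t ^+ 4.
  by apply: ler_wpM2r => //; clear -A0 A20; lra.
split.
- by rewrite addrAC; exact: le_trans e1 BK.
- by rewrite addrAC; exact: le_trans e2 B1K.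
- exact: le_trans e3 B2K.
move=> j; rewrite (_ : _ - _ = (v j - pt w j) - (v j - pt s j)); last by ring.
apply: le_trans (ler_normB _ _) _; rewrite addrAC 2!mulrDl -addrA.
have Ap : 0 <= A2 * t ^+ 3 by rewrite mulr_ge0 //; clear -A20; lra.
have Bp : 0 <= B2 * t ^+ 3 by rewrite mulr_ge0 //.
apply: lerD => //.
move: j; apply: ord3_case.
- by apply: le_trans (hw2 0) _; clear -Bp; lra.
- by apply: le_trans (hw2 1) _; clear -Bp; lra.
- rewrite distrC; apply: le_trans e3 _.
  have : B2 * t ^+ 4 <= B2 * t ^+ 3 by exact: ler_wpM2l.
  by clear -Ap; lra.
Qed.

(** * Volume density against the Jacobian of the shears *)

Section DensityEstimate.
Context {R : realType}.
Variable kappa : R.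
Notation order := (@order_at0 R 'I_3 (geo_radius kappa)).

(** [p.1] stands for w and [p.2] for its straightened point: x is already the new one in [jac2], and
    both x and y are new in [jac3]. *)
Let jac (p : ('I_3 -> R) * ('I_3 -> R)) : R :=
  (1 - kappa * (p.1 0 * p.1 1) + p.1 1 * p.1 1 * 6^-1) *
  (1 - kappa * (p.2 0 * p.1 1) - p.2 0 * p.2 0 * 3^-1) *
  (1 + 2 / 3 * kappa * (p.2 0 * p.2 1)).

(** For kappa = 0 this is - Ric / 6 of the round product, the classical second-order term of the
    volume density in normal coordinates. *)
Let quad (p : ('I_3 -> R) * ('I_3 -> R)) : R :=
  2 * kappa * 6^-1 * (p.2 0 * p.2 1) - 6^-1 * (p.2 0 * p.2 0 + p.2 1 * p.2 1).

Let hr := geo_radius_le1 kappa.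

Let order_quad : order 2 quad.
Proof. by apply: (order_le _ hr); [have h := hr; rewrite /quad; order_at0_tac|]. Qed.

Let order_jac : order 2 (fun p => jac p - 1).
Proof.
have h := hr.
pose a (p : ('I_3 -> R) * ('I_3 -> R)) := - (kappa * (p.1 0 * p.1 1)) + p.1 1 * p.1 1 * 6^-1.
pose b (p : ('I_3 -> R) * ('I_3 -> R)) := - (kappa * (p.2 0 * p.1 1)) - p.2 0 * p.2 0 * 3^-1.
pose e (p : ('I_3 -> R) * ('I_3 -> R)) := 2 / 3 * kappa * (p.2 0 * p.2 1).
apply: (@order_ext _ _ _ _ (fun p => a p + (1 + a p) * (b p + (1 + b p) * e p))).
  by rewrite /a /b /e; apply: (order_le _ hr); [order_at0_tac|].
by move=> p _; rewrite /jac /a /b /e; ring.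
Qed.

Let order_density : order 2 (fun p => jac p * (1 + quad p) - 1).
Proof.
have h := hr; have hj := order_jac; have hq := order_quad.
apply: (@order_ext _ _ _ _ (fun p => (jac p - 1) + (1 + (jac p - 1)) * quad p)).
  by apply: (order_le _ hr); [order_at0_tac|].
by move=> p _; ring.
Qed.

(** To second order both sides are 1 - kappa x y - x^2 / 2: the Jacobian contributes -4/3 kappa x y
    + y^2 / 6 - x^2 / 3 and [quad] the rest. This balance determines the quadratic form. *)
Let order_diag : order 3 (fun p => (1 - p.1 0 * p.1 0 * 2^-1) * (1 + kappa * (p.1 0 * p.1 1))^-1
  - jac (p.1, p.1) * (1 + quad (p.1, p.1))).
Proof.
have h := hr; have hi := order_invphi kappa.
pose x (p : ('I_3 -> R) * ('I_3 -> R)) := p.1 0.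
pose y (p : ('I_3 -> R) * ('I_3 -> R)) := p.1 1.
pose i (p : ('I_3 -> R) * ('I_3 -> R)) := (1 + kappa * (p.1 0 * p.1 1))^-1.
pose a (p : ('I_3 -> R) * ('I_3 -> R)) := - (kappa * (x p * y p)) + y p * y p * 6^-1.
pose b (p : ('I_3 -> R) * ('I_3 -> R)) := - (kappa * (x p * y p)) - x p * x p * 3^-1.
pose e (p : ('I_3 -> R) * ('I_3 -> R)) := 2 / 3 * kappa * (x p * y p).
pose q (p : ('I_3 -> R) * ('I_3 -> R)) :=
  2 * kappa * 6^-1 * (x p * y p) - 6^-1 * (x p * x p + y p * y p).
apply: (@order_ext _ _ _ _ (fun p =>
  (1 - x p * x p * 2^-1) * ((kappa * (x p * y p)) * (kappa * (x p * y p)) * i p)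
  + kappa * (x p * y p) * (x p * x p * 2^-1)
  - (a p * b p + e p * (a p + b p + a p * b p)
     + q p * (a p + b p + a p * b p + e p * (1 + a p + b p + a p * b p))))).
  by rewrite /a /b /e /q /x /y /i; apply: (order_le _ hr); [order_at0_tac|].
move=> p hp; rewrite /jac /quad /a /b /e /q /i /x /y /=.
have nz : 1 + kappa * (p.1 0 * p.1 1) != 0.
  by apply/eqP; have := phi_ge_half _ _ _ (hp 0).1 (hp 1).1; lra.
by field.
Qed.

(** Three errors: [cos r] against its Taylor polynomial, the comparison on the diagonal at w, and
    the passage from the straightened point to w, which moves a function of order 2 by a multiple of
    t A t^3. *)
Lemma density_estimate (A : R) : 0 <= A -> exists K t0 : R, [/\ 0 <= K, 0 < t0 &
  forall t c1 c2 (w : R * R * R), 0 < t -> t <= t0 ->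
  let s := straighten kappa c1 c2 w in
  let q := 2 * kappa / 6 * (s.1.1 * s.1.2) - (s.1.1 ^+ 2 + s.1.2 ^+ 2) / 6 in
  (forall i, `|pt w i| <= 4 * t) -> (forall i, `|pt s i| <= 4 * t) ->
  (forall i, `|pt s i - pt w i| <= A * t ^+ 3) ->
  [/\ `|cos w.1.1 / (1 + kappa * (w.1.1 * w.1.2)) - straighten_jac kappa c1 c2 w * (1 + q)|
        <= K * t ^+ 3,
      1 / 2 <= straighten_jac kappa c1 c2 w & `|q| <= 1 / 2]].
Proof.
move=> A0; have [Cj Cj0 hj] := order_jac; have [Cq Cq0 hq] := order_quad.
have [Cd Cd0 hd] := order_density; have [Ce Ce0 he] := order_diag.
have g0 := geo_radius_gt0 kappa.
pose t0 := Num.min (geo_radius kappa / 4) (Num.min ((32 * (Cj + 1))^-1) ((32 * (Cq + 1))^-1)).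
have t00 : 0 < t0.
  by rewrite !lt_min divr_gt0 // !invr_gt0 !mulr_gt0 //; apply: ltr_wpDl.
exists (128 + 4 * Cd * A + 64 * Ce), t0; split => //.
  have : 0 <= Cd * A by rewrite mulr_ge0.
  by lra.
move=> t c1 c2 w tp tt0 s q hw hs hsw.
have [ht1 ht2 ht3] : [/\ t <= geo_radius kappa / 4, t <= (32 * (Cj + 1))^-1 & t <= (32 * (Cq + 1))^-1].
  by split; apply: le_trans tt0 _; rewrite /t0 !ge_min lexx ?orbT.
have dp : 0 < 4 * t by lra.
have dr : 4 * t <= geo_radius kappa by lra.
have t1 : t <= 1 by have := hr; lra.
have t21 : t ^+ 2 <= t by rewrite expr2 ler_piMr // ltW.
have t3p : 0 <= t ^+ 3 by rewrite exprn_ge0 // ltW.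
pose p := (pt w, pt s); pose p' := (pt w, pt w).
have bp : in_ball (4 * t) p by move=> i; split; [exact: hw|exact: hs].
have bp' : in_ball (4 * t) p' by move=> i; split; exact: hw.
have jE : straighten_jac kappa c1 c2 w = jac p.
  by rewrite /straighten_jac /jac1 /jac2 /jac3 /jac /p /s /straighten /pt /=; ring.
have qE : q = quad p by rewrite /q /quad /p /pt /=; field.
have small (C : R) : 0 <= C -> t <= (32 * (C + 1))^-1 -> C * (4 * t) ^+ 2 <= 1 / 2.
  move=> C0 htC; have : t * (32 * (C + 1)) <= 1.
    by rewrite -ler_pdivlMr ?mul1r // mulr_gt0 // ltr_wpDl.
  have : C * t ^+ 2 <= C * t by exact: ler_wpM2l.
  by rewrite exprMn; lra.
split.
- rewrite jE qE.
  rewrite (_ : _ - _ = (cos w.1.1 - 1 + w.1.1 ^+ 2 / 2) * (1 + kappa * (w.1.1 * w.1.2))^-1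
    + ((1 - w.1.1 * w.1.1 * 2^-1) * (1 + kappa * (w.1.1 * w.1.2))^-1
       - jac p' * (1 + quad p'))
    - ((jac p * (1 + quad p) - 1) - (jac p' * (1 + quad p') - 1))); last by ring.
  apply: le_trans (ler_normB _ _) _.
  have h3 : `|(jac p * (1 + quad p) - 1) - (jac p' * (1 + quad p') - 1)| <= 4 * Cd * A * t ^+ 3.
    have [_ h] := hd (4 * t) dp dr.
    have cl : close (A * t ^+ 3) p p'.
      by move=> i; rewrite /p /p' /= subrr normr0 mulr_ge0.
    have := h p p' (A * t ^+ 3) bp bp' (mulr_ge0 A0 t3p) cl.
    rewrite (_ : Cd * (4 * t) ^+ 2 * (A * t ^+ 3) = 4 * t * (4 * Cd * A * (t ^+ 3 * t))); last by ring.
    rewrite ler_pM2l // => h'; apply: le_trans h' _; apply: ler_wpM2l.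
      by rewrite !mulr_ge0.
    by rewrite ler_piMr.
  have h2 : `|(1 - w.1.1 * w.1.1 * 2^-1) * (1 + kappa * (w.1.1 * w.1.2))^-1
       - jac p' * (1 + quad p')| <= 64 * Ce * t ^+ 3.
    have [h _] := he (4 * t) dp dr.
    have := h p' bp'; rewrite {1 2}/p' /=.
    by rewrite (_ : Ce * (4 * t) ^+ 3 = 64 * Ce * t ^+ 3) //; ring.
  have h1 : `|(cos w.1.1 - 1 + w.1.1 ^+ 2 / 2) * (1 + kappa * (w.1.1 * w.1.2))^-1| <= 128 * t ^+ 3.
    rewrite normrM (_ : 128 * t ^+ 3 = (4 * t) ^+ 3 * 2); last by ring.
    apply: ler_pM => //.
      apply: le_trans (cos_taylor2 _) _.
      by rewrite lerXn2r ?nnegrE ?(ltW dp) //; exact: (hw 0).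
    have hp := phi_ge_half kappa w.1.1 w.1.2 (le_trans (hw 0) dr) (le_trans (hw 1) dr).
    have hp0 : 0 < 1 + kappa * (w.1.1 * w.1.2) by lra.
    by rewrite gtr0_norm ?invr_gt0 // -[2]invrK lef_pV2 // posrE invr_gt0.
  have := lerD (le_trans (ler_normD _ _) (lerD h1 h2)) h3.
  by lra.
- have [h _] := hj (4 * t) dp dr.
  have := le_trans (h p bp) (small Cj Cj0 ht2).
  by rewrite jE ler_norml => /andP[? _]; lra.
- have [h _] := hq (4 * t) dp dr.
  by rewrite qE; exact: le_trans (h p bp) (small Cq Cq0 ht3).
Qed.

End DensityEstimate.

(** * Sandwich of the image of a quarter wedge *)

Section WedgeShift.
Context {R : realType}.
Variables (alpha s1 s2 : R).
Hypotheses (alpha01 : 0 < alpha < 1) (hs1 : `|s1| = 1) (hs2 : `|s2| = 1).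

(* Shifting by (c, c) leaves enough room in the cone for an error e. *)
Lemma sector_shift rho c e x y x' y' : 0 <= rho -> 0 <= e -> e * (1 + alpha) <= c * (1 - alpha) ->
  sector alpha rho x y -> `|x' - x - c| <= e -> `|y' - y - c| <= e ->
  sector alpha (rho + 2 * (c + e)) x' y'.
Proof.
move: alpha01 => /andP[a0 a1] r0 e0 hc /and4P[x0 h1 h2 h3].
rewrite !ler_norml => /andP[g1 g2] /andP[g3 g4].
have ec : e <= c by nra.
have y0 : 0 <= y by apply: le_trans h1; rewrite mulr_ge0 // ltW.
have xr : x <= rho.
  rewrite -(@ler_pXn2r _ 2) ?nnegrE ?(ltW x0) //; apply: le_trans h3.
  by rewrite lerDl sqr_ge0.
have yr : y <= rho.
  rewrite -(@ler_pXn2r _ 2) ?nnegrE //; apply: le_trans h3.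
  by rewrite lerDr sqr_ge0.
have ae : alpha * x' <= alpha * (x + c + e) by rewrite ler_pM2l //; lra.
have ae' : alpha * y' <= alpha * (y + c + e) by rewrite ler_pM2l //; lra.
apply/and4P; split; [lra|lra|lra|].
have sq (z z' : R) : 0 <= z -> z <= rho -> - e <= z' - z - c -> z' - z - c <= e ->
    z' ^+ 2 <= z ^+ 2 + 2 * rho * (c + e) + (c + e) ^+ 2.
  move=> z0 zr k1 k2.
  have : z' ^+ 2 <= (z + (c + e)) ^+ 2 by rewrite ler_pXn2r ?nnegrE //; lra.
  have : z * (c + e) <= rho * (c + e) by apply: ler_wpM2r => //; lra.
  by rewrite sqrrD; lra.
(* The two coordinates together add 4 rho (c + e) + 2 (c + e)^2, within the expansion of (rho + 2 (c
   + e))^2. *)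
have := sq x x' (ltW x0) xr g1 g2; have := sq y y' y0 yr g3 g4.
have := sqr_ge0 (c + e).
rewrite (_ : (rho + 2 * (c + e)) ^+ 2 = rho ^+ 2 + 4 * rho * (c + e) + 4 * (c + e) ^+ 2); last by ring.
by lra.
Qed.

Lemma sector_le rho rho' x y : 0 <= rho -> rho <= rho' ->
  sector alpha rho x y -> sector alpha rho' x y.
Proof.
move=> r0 rr /and4P[h0 h1 h2 h3]; apply/and4P; split => //; apply: le_trans h3 _.
by rewrite ler_pXn2r ?nnegrE // (le_trans r0).
Qed.

Lemma wedge_block_shift rho rho' h h' c e (u u' : R * R * R) : 0 <= rho -> 0 <= e ->
  e * (1 + alpha) <= c * (1 - alpha) -> rho + 2 * (c + e) <= rho' -> h + e <= h' ->
  wedge_block alpha rho h s1 s2 u ->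
  `|u'.1.1 - u.1.1 - s1 * c| <= e -> `|u'.1.2 - u.1.2 - s2 * c| <= e -> `|u'.2 - u.2| <= e ->
  wedge_block alpha rho' h' s1 s2 u'.
Proof.
move=> r0 e0 hc hr hh /andP[hs /andP[z1 z2]] h1 h2; rewrite ler_norml => /andP[h3 h4].
have scal (s x y : R) : `|s| = 1 -> `|x - y - s * c| <= e -> `|s * x - s * y - c| <= e.
  move=> s1' hx; rewrite (_ : _ - c = s * (x - y - s * c)); first by rewrite normrM s1' mul1r.
  by rewrite -{1}[c]mul1r -(sign_sq s s1'); ring.
have c0 : 0 <= c.
  have /andP[a0 a1] := alpha01.
  have ea : 0 <= e * alpha by rewrite mulr_ge0 // ltW.
  by nra.
apply/andP; split; last by apply/andP; split; lra.
apply: (@sector_le (rho + 2 * (c + e))) => //; first lra.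
exact: (sector_shift _ _ _ _ _ _ _ r0 e0 hc hs (scal _ _ _ hs1 h1) (scal _ _ _ hs2 h2)).
Qed.

Lemma wedge_block_bound rho h (t : R) (u : R * R * R) : 0 <= rho -> rho <= t -> h <= t ->
  wedge_block alpha rho h s1 s2 u -> forall i, `|pt u i| <= t.
Proof.
move=> r0 rt ht /andP[/and4P[h0 h1 h2 h3] /andP[z1 z2]].
have t0 : 0 <= t by exact: le_trans r0 rt.
have sq (s x y : R) : `|s| = 1 -> (s * x) ^+ 2 + y <= rho ^+ 2 -> 0 <= y -> `|x| <= t.
  move=> hs hx y0; apply: le_trans rt.
  rewrite -(@ler_pXn2r _ 2) ?nnegrE // real_normK ?num_real //.
  by apply: le_trans hx; rewrite exprMn (expr2 s) (sign_sq s hs) mul1r lerDl.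
apply: ord3_case; rewrite /pt /=.
- exact: (sq s1 _ _ hs1 h3 (sqr_ge0 _)).
- by apply: (sq s2 _ _ hs2 _ (sqr_ge0 (s1 * u.1.1))); rewrite addrC.
- by rewrite ler_norml; apply/andP; split; lra.
Qed.

Lemma wedge_block_cone_pt rho h (t : R) (u : R * R * R) : 0 <= rho -> rho <= t -> h <= t ->
  wedge_block alpha rho h s1 s2 u -> cone_pt alpha s1 s2 t (pt u).
Proof.
move=> r0 rt ht hu; have hb := wedge_block_bound _ _ _ _ r0 rt ht hu.
by case/andP: hu => /and4P[h0 h1 h2 _] _; split.
Qed.

End WedgeShift.

Lemma sqrt3_half (R : realType) : 1 / 2 <= Num.sqrt (3 : R) / 2 <= 1.
Proof.
have h : Num.sqrt (3 : R) ^+ 2 = 3 by rewrite sqr_sqrtr.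
have := sqrtr_ge0 (3 : R); set s := Num.sqrt _ in h * => s0.
by apply/andP; split; nra.
Qed.

(** Here e is the error of [straighten_flow] at scale 8 t: image points have size 4 t, and
    [flow_surjective] doubles this for preimages. The shift cc = 2 e / (1 - alpha) is at least e (1
    + alpha) / (1 - alpha), as the cone requires. K absorbs the shift into the radius through rho0 K
    >= 2 (c0 + E0), and twice the density constant because the Jacobian is only known to be at least
    1/2. *)
Lemma sandwich_constants (R : realType) (alpha k rho0 : R) (alpha01 : 0 < alpha < 1)
  (rho0_gt0 : 0 < rho0) (Ks Kd ts td g : R) : 0 <= Ks -> 0 <= Kd -> 0 < ts -> 0 < td ->
  0 < g -> g <= 2^-1 -> exists K t0 : R, [/\ 0 <= K, 0 < t0, 2 * Kd <= K & forall t, 0 < t -> t <= t0 ->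
  let e := Ks * (8 * t) ^+ 4 in exists cc : R,
  [/\ 8 * t <= ts, t <= td, 4 * t <= g & 160 * (1 + `|k|) * t ^+ 2 <= 1] /\
  [/\ 0 <= e, e * (1 + alpha) <= cc * (1 - alpha), 0 <= cc, cc <= t / 2 & cc <= (8 * t) ^+ 3] /\
  [/\ rho0 * (t - K * t ^+ 4) + 2 * (cc + e) <= rho0 * t,
      rho0 * t + 2 * (cc + e) <= rho0 * (t + K * t ^+ 4),
      Num.sqrt 3 / 2 * (rho0 * (t - K * t ^+ 4)) + e <= Num.sqrt 3 / 2 * (rho0 * t) &
      Num.sqrt 3 / 2 * (rho0 * t) + e <= Num.sqrt 3 / 2 * (rho0 * (t + K * t ^+ 4))] /\
  [/\ 0 < t - K * t ^+ 4, t - K * t ^+ 4 <= 2 * t, t + K * t ^+ 4 <= 2 * t,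
      3 / 4 <= 1 - K * t ^+ 3 & 3 / 4 <= 1 + K * t ^+ 3]].
Proof.
move=> Ks0 Kd0 ts0 td0 g0 g1.
have [a0 a1] := andP alpha01; have k0 := normr_ge0 k; have r0 := rho0_gt0.
have p8 n : (1 : R) <= 8 ^+ n by rewrite exprn_ege1 // ler1n.
have p80 n : (0 : R) <= 8 ^+ n by exact: le_trans (p8 n).
have [E0 E0E] : exists E0 : R, E0 = Ks * 8 ^+ 4 by exists (Ks * 8 ^+ 4).
have E00 : 0 <= E0 by rewrite E0E; exact: mulr_ge0.
have [c0 c0E] : exists c0 : R, c0 = 2 * E0 / (1 - alpha) by exists (2 * E0 / (1 - alpha)).
have c00 : 0 <= c0 by rewrite c0E; apply: divr_ge0; clear -E00 a1; lra.
have [K KE] : exists K : R, K = 2 * Kd + 2 * (c0 + E0) / rho0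
  by exists (2 * Kd + 2 * (c0 + E0) / rho0).
have cE0 : 0 <= 2 * (c0 + E0) / rho0 by apply: divr_ge0; clear -c00 E00 r0; lra.
have K0 : 0 <= K by rewrite KE; clear -Kd0 cE0; lra.
have KrE : 2 * (c0 + E0) <= rho0 * K.
  have : 2 * (c0 + E0) / rho0 <= K by rewrite KE; clear -Kd0; lra.
  by rewrite ler_pdivrMr // (mulrC rho0).
pose t0 := Num.min (ts / 8) (Num.min td (Num.min ((160 * (1 + `|k|))^-1)
  (Num.min ((2 * c0 + 4 * K + 1)^-1) (g / 4)))).
have p160 : 0 < 160 * (1 + `|k|) by rewrite mulr_gt0 // ltr_pwDl.
have pcK : 0 < 2 * c0 + 4 * K + 1 by clear -c00 K0; lra.
have t00 : 0 < t0 by rewrite !lt_min !divr_gt0 // td0 !invr_gt0 p160 pcK.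
exists K, t0; split => //; first by rewrite KE; clear -cE0; lra.
move=> t tp tt0 e; exists (c0 * t ^+ 4).
have [ht1 ht2 ht3 [ht4 ht5]] : [/\ t <= ts / 8, t <= td, t <= (160 * (1 + `|k|))^-1 &
    t <= (2 * c0 + 4 * K + 1)^-1 /\ t <= g / 4].
  by split; [| | |split]; apply: le_trans tt0 _; rewrite /t0 !ge_min lexx ?orbT.
clearbody t0.
have t1 : t <= 1 by move: ht5 g1; clear; lra.
have t2p : 0 <= t ^+ 2 by exact: sqr_ge0.
have t3p : 0 <= t ^+ 3 by rewrite exprn_ge0 // ltW.
have t4p : 0 <= t ^+ 4 by rewrite exprn_ge0 // ltW.
have t21 : t ^+ 2 <= t by rewrite expr2 ler_piMr // ltW.
have t31 : t ^+ 3 <= t by rewrite exprS; apply: ler_piMr; [exact: ltW|exact: le_trans t21 t1].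
have ckt : (2 * c0 + 4 * K + 1) * t <= 1 by rewrite mulrC -ler_pdivlMr ?mul1r.
have c0t : 0 <= c0 * t by rewrite mulr_ge0 // ltW.
have K0t : 0 <= K * t by rewrite mulr_ge0 // ltW.
have c0t1 : c0 * t <= 1 / 2 by clear -ckt c0t K0t tp; lra.
have K0t1 : K * t <= 1 / 4 by clear -ckt c0t K0t tp; lra.
have eE : e = E0 * t ^+ 4 by rewrite /e exprMn E0E mulrA.
clearbody e.
have cc3 : c0 * t ^+ 4 <= 1 / 2 * t ^+ 3.
  by rewrite (_ : c0 * t ^+ 4 = c0 * t * t ^+ 3); [apply: ler_wpM2r|ring].
have Kt3 : K * t ^+ 3 <= 1 / 4 by apply: le_trans K0t1; exact: ler_wpM2l.
have s3 : 1 / 2 <= Num.sqrt (3 : R) / 2 by case/andP: (sqrt3_half R).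
have radE : 2 * (c0 * t ^+ 4 + e) <= rho0 * (K * t ^+ 4).
  have := ler_wpM2r t4p KrE; rewrite eE; clear; lra.
have h1 : 1 / 2 * (rho0 * (K * t ^+ 4)) <= Num.sqrt 3 / 2 * (rho0 * (K * t ^+ 4)).
  by apply: ler_wpM2r => //; apply: mulr_ge0; [exact: ltW|exact: mulr_ge0].
have h2 : 0 <= c0 * t ^+ 4 by exact: mulr_ge0.
(* Since sqrt 3 / 2 >= 1/2, half of the slack in [radE] already pays for e in the height. *)
have hgtE : e <= Num.sqrt 3 / 2 * (rho0 * (K * t ^+ 4)) by clear -radE h1 h2; lra.
have Kt3p : 0 <= K * t ^+ 3 by exact: mulr_ge0.
have Kt4p : 0 <= K * t ^+ 4 by exact: mulr_ge0.
have Kt4 : K * t ^+ 4 <= 1 / 4 * t.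
  rewrite (_ : K * t ^+ 4 = K * t ^+ 3 * t); last by ring.
  by apply: ler_wpM2r => //; exact: ltW.
split; first split => //.
- by clear -ht1; lra.
- by clear -ht5; lra.
- have : t * (160 * (1 + `|k|)) <= 1 by rewrite -ler_pdivlMr ?mul1r.
  have : 160 * (1 + `|k|) * t ^+ 2 <= 160 * (1 + `|k|) * t by rewrite ler_pM2l.
  by clear; lra.
split; first split.
- by rewrite eE mulr_ge0.
- rewrite eE c0E (_ : 2 * E0 / (1 - alpha) * t ^+ 4 * (1 - alpha) = E0 * t ^+ 4 * 2); last first.
    by field; apply/eqP; clear -a1; lra.
  by apply: ler_wpM2l; [exact: mulr_ge0|clear -a1; lra].
- exact: mulr_ge0.
- by clear -cc3 t31 t3p; lra.
- rewrite exprMn; apply: (@le_trans _ _ (1 * t ^+ 3)); first by clear -cc3 t3p; lra.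
  by apply: ler_wpM2r => //; exact: p8.
split; split; rewrite ?mulrBr ?mulrDr; rewrite ?mulrBr ?mulrDr.
- by clear -radE; lra.
- by clear -radE; lra.
- by clear -hgtE; lra.
- by clear -hgtE; lra.
- by clear -Kt4 tp; lra.
- by clear -Kt4p tp; lra.
- by clear -Kt4 tp; lra.
- by clear -Kt3; lra.
- by clear -Kt3p; lra.
Qed.

Lemma sandwich_arith (R : realType) (D J q x y : R) : `|D - J * (1 + q)| <= x -> x <= y * J ->
  (1 - y + q) * J <= D /\ D <= (1 + y + q) * J.
Proof. by rewrite ler_norml => /andP[h1 h2] h3; split; lra. Qed.

Section Quadrant.
Context {R : realType}.
Variables (alpha k rho0 s1 s2 : R).
Hypotheses (alpha01 : 0 < alpha < 1) (hs1 : `|s1| = 1) (hs2 : `|s2| = 1).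
Hypotheses (rho0_gt0 : 0 < rho0) (rho0_le1 : rho0 <= 1).
Let kappa := s1 * s2 * k.

Definition block_height (tau : R) : R := Num.sqrt 3 / 2 * (rho0 * tau).

Definition block (tau : R) : R * R * R -> bool :=
  wedge_block alpha (rho0 * tau) (block_height tau) s1 s2.

(** In reflected coordinates the coefficient is k / 3 in every quadrant, as kappa x y = k (s1 x) (s2
    y). The constant term a = 1 -+ K t^3 carries the error of the density. *)
Definition block_integrand (a tau : R) (u : R * R * R) : R :=
  if block tau u then quad_form a (k / 3) (- 6^-1) (s1 * u.1.1) (s2 * u.1.2) else 0.

Definition block_value (a tau : R) : R :=
  2 * block_height tau * sector_value alpha (rho0 * tau) a (k / 3) (- 6^-1).

(** Right-hand side of the shear formula for M = 2 t. *)
Definition pulled_integrand (a tau t c1 c2 : R) (w : R * R * R) : R :=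
  if cube (2 * (2 * t)) w then
    block_integrand a tau (straighten kappa c1 c2 w) * straighten_jac kappa c1 c2 w else 0.

Lemma block_height_le tau : 0 <= tau -> block_height tau <= tau.
Proof.
move=> t0; have /andP[_ h] := (sqrt3_half R); rewrite /block_height.
have h1 : rho0 * tau <= 1 * tau by apply: ler_wpM2r.
have h2 : Num.sqrt 3 / 2 * (rho0 * tau) <= 1 * (rho0 * tau).
  by apply: ler_wpM2r => //; rewrite mulr_ge0 // ltW.
lra.
Qed.

Lemma block_height_gt0 tau : 0 < tau -> 0 < block_height tau.
Proof.
move=> t0; have /andP[h _] := (sqrt3_half R).
by rewrite /block_height mulr_gt0 ?mulr_gt0 //; lra.
Qed.

Lemma block_bound tau u : 0 <= tau -> block tau u -> forall i, `|pt u i| <= tau.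
Proof.
move=> t0; apply: (wedge_block_bound _ _ _ hs1 hs2).
- by rewrite mulr_ge0 // ltW.
- by rewrite -[leRHS]mul1r; apply: ler_wpM2r.
- exact: block_height_le.
Qed.

Lemma measurable_block_integrand a tau :
  measurable_fun [set: R * R * R] (block_integrand a tau).
Proof.
apply: measurable_fun_ifT; [exact: measurable_wedge_block|exact: measurable_quad_form3|].
exact: measurable_cst.
Qed.

Section Pulled.
Variables (a tau t c1 c2 : R).
Hypotheses (t0 : 0 < t) (tau0 : 0 < tau) (taut : tau <= 2 * t).
Hypotheses (kt : 160 * (1 + `|k|) * t ^+ 2 <= 1) (a34 : 3 / 4 <= a).
Hypotheses (c1t : `|c1| <= t / 2) (c2t : `|c2| <= t / 2).

(** On the block x^2 + y^2 <= 4 t^2, so the smallness of (1 + |k|) t^2 lets a >= 3/4 dominate. *)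
Let quad_ge0 x y : sector alpha (rho0 * tau) x y -> 0 <= quad_form a (k / 3) (- 6^-1) x y.
Proof.
move=> /and4P[x0 h1 _ hxy]; have [al0 _] := andP alpha01.
have y0 : 0 <= y by apply: le_trans h1; rewrite mulr_ge0 // ltW.
have h : (rho0 * tau) ^+ 2 <= (2 * t) ^+ 2.
  have r := ltW rho0_gt0; have tt := ltW tau0; have ttt := ltW t0.
  rewrite ler_pXn2r ?nnegrE ?mulr_ge0 //; apply: le_trans taut.
  by rewrite -[leRHS]mul1r; apply: ler_wpM2r.
have xy : 2 * (x * y) <= x ^+ 2 + y ^+ 2 by have := sqr_ge0 (x - y); rewrite sqrrB; lra.
have xy0 : 0 <= x * y by rewrite mulr_ge0 // ltW.
have kxy : `|k * (x * y)| <= `|k| * (2 * t ^+ 2).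
  rewrite normrM (ger0_norm xy0); apply: ler_wpM2l => //.
  by move: h; rewrite exprMn; lra.
have := kt; have := a34; move: kxy h; rewrite /quad_form exprMn ler_norml => /andP[? _].
by have := sqr_ge0 t; have := mulr_ge0 (normr_ge0 k) (sqr_ge0 t); lra.
Qed.

Lemma block_integrand_ge0 u : 0 <= block_integrand a tau u.
Proof. by rewrite /block_integrand; case: ifP => // /andP[/quad_ge0]. Qed.

Let kappaE : `|kappa| = `|k|. Proof. by rewrite /kappa !normrM hs1 hs2 !mul1r. Qed.

Let M0 : 0 < 2 * t. Proof. by rewrite mulr_gt0. Qed.

Let M1 : 40 * (1 + `|kappa|) * (2 * t) ^+ 2 <= 1.
Proof. by rewrite kappaE exprMn; have := kt; lra. Qed.

Let c1M : `|c1| <= 2 * t / 4. Proof. by have := c1t; lra. Qed.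
Let c2M : `|c2| <= 2 * t / 4. Proof. by have := c2t; lra. Qed.

Lemma block_cube u : block tau u -> cube (2 * t) u.
Proof.
move=> /(block_bound _ _ (ltW tau0)) h.
by apply/and3P; split; [have := h 0|have := h 1|have := h 2]; have := taut; rewrite /pt /=; lra.
Qed.

Lemma pulled_integrand_ge0 w : 0 <= pulled_integrand a tau t c1 c2 w.
Proof.
rewrite /pulled_integrand; case: ifP => // hc.
have [/block_cube hb|/negbTE hb] := boolP (block tau (straighten kappa c1 c2 w)).
  apply: mulr_ge0; first exact: block_integrand_ge0.
  exact/ltW/(straighten_jac_gt0 _ _ _ _ M0 M1 c1M c2M _ hc hb).
by rewrite /block_integrand hb mul0r.
Qed.

Lemma measurable_pulled_integrand :
  measurable_fun [set: R * R * R] (pulled_integrand a tau t c1 c2).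
Proof.
apply: measurable_sheared; [exact: measurable_block_integrand| |].
  exact: measurable_straighten_jac.
exact: measurable_straighten.
Qed.

Lemma pulled_integral :
  int3 (fun w => (pulled_integrand a tau t c1 c2 w)%:E) = (block_value a tau)%:E.
Proof.
rewrite -(straighten_integral kappa c1 c2 (2 * t) M0 M1 c1M c2M (block_integrand a tau)).
- apply: (wedge_integral _ _ _ _ _ _ _ _ alpha01 _ _ hs1 hs2 quad_ge0).
    exact: mulr_gt0.
  exact: block_height_gt0.
- exact: measurable_block_integrand.
- exact: block_integrand_ge0.
- move=> u; rewrite /block_integrand; case: ifP => [/block_cube //|_].
  by rewrite eqxx.
Qed.

End Pulled.

Variables (m Cf : R) (c d : ('I_3 -> R) -> 'I_3 -> R -> R).
Hypotheses (fl : is_flow kappa (alpha / 32) m Cf c d) (m0 : 0 < m) (Cf0 : 0 <= Cf).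

Definition flow_image (t : R) (w : R * R * R) : Prop :=
  exists2 v, block t v & forall i, pt w i = c (pt v) i 1.

Definition density (w : R * R * R) : R := cos w.1.1 / (1 + kappa * (w.1.1 * w.1.2)).

Lemma flow_image_bound t w : 0 <= t -> flow_image t w -> forall i, `|pt w i| <= 4 * t.
Proof.
move=> t0 [v hv hw] i; rewrite hw.
have h1 : `|1 : R| <= 3 / 2 by rewrite normr1; lra.
exact: (flow_small _ _ _ _ _ _ fl _ t 1 i (block_bound _ _ t0 hv) h1).1.
Qed.

Lemma pt_cube (t : R) (w : R * R * R) : cube (2 * (2 * t)) w <-> forall i, `|pt w i| <= 4 * t.
Proof.
have -> : 2 * (2 * t) = 4 * t by ring.
split=> [/and3P[h1 h2 h3]|h]; first by apply: ord3_case.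
by apply/and3P; split; [exact: h 0|exact: h 1|exact: h 2].
Qed.

Lemma density_ge0 (t : R) (w : R * R * R) : 4 * t <= geo_radius kappa -> (forall i, `|pt w i| <= 4 * t) ->
  0 <= density w.
Proof.
move=> dr hw; have h1 := phi_ge_half kappa w.1.1 w.1.2 (le_trans (hw 0) dr) (le_trans (hw 1) dr).
have h2 := cos_ge_half kappa w.1.1 (le_trans (hw 0) dr).
by apply: divr_ge0; lra.
Qed.

Theorem quadrant_sandwich : exists K t0 : R, [/\ 0 <= K, 0 < t0 & forall t, 0 < t -> t <= t0 ->
  exists lo up : R * R * R -> R,
  [/\ measurable_fun [set: R * R * R] lo, measurable_fun [set: R * R * R] up,
      forall w, 0 <= lo w & forall w, 0 <= up w] /\
  [/\ forall w, lo w != 0 -> flow_image t w,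
      forall w, flow_image t w -> lo w <= density w <= up w,
      int3 (fun w => (lo w)%:E) = (block_value (1 - K * t ^+ 3) (t - K * t ^+ 4))%:E &
      int3 (fun w => (up w)%:E) = (block_value (1 + K * t ^+ 3) (t + K * t ^+ 4))%:E]].
Proof.
have [Ks [ts [Ks0 ts0 hs]]] := straighten_flow _ _ _ _ _ _ fl m0 Cf0.
have A0 : 0 <= Ks * 8 ^+ 3 by apply: mulr_ge0 => //; exact: exprn_ge0.
have [Kd [td [Kd0 td0 hd]]] := density_estimate kappa _ A0.
have [K [t0 [K0 t00 KdK hK]]] := sandwich_constants R alpha k rho0 alpha01 rho0_gt0 Ks Kd ts td (geo_radius kappa) Ks0 Kd0 ts0 td0
  (geo_radius_gt0 kappa) (geo_radius_le kappa).
exists K, t0; split => // t tp tt0.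
have [cc [[t8s ttd tg kt] [[e0 ec cc0 cct cc8] [[radE1 radE2 hgtE1 hgtE2] [lo_t0 lo_tt up_tt lo_a up_a]]]]] := hK t tp tt0.
set e := Ks * (8 * t) ^+ 4 in e0 ec radE1 radE2 hgtE1 hgtE2.
have A8 : Ks * (8 * t) ^+ 3 = Ks * 8 ^+ 3 * t ^+ 3 by rewrite exprMn mulrA.
have t8 : 0 < 8 * t by rewrite mulr_gt0.
have t3p : 0 <= t ^+ 3 by rewrite exprn_ge0 // ltW.
have Kt4p : 0 <= K * t ^+ 4 by apply: mulr_ge0 => //; rewrite exprn_ge0 // ltW.
have rt0 t' : 0 <= t' -> 0 <= rho0 * t' by move=> h; apply: mulr_ge0 => //; exact: ltW.
have signc (s : R) : `|s| = 1 -> `|s * cc| = cc.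
  by move=> h; rewrite normrM h mul1r ger0_norm.
have qfE (a : R) (s : R * R * R) : quad_form a (k / 3) (- 6^-1) (s1 * s.1.1) (s2 * s.1.2) =
    a + (2 * kappa / 6 * (s.1.1 * s.1.2) - (s.1.1 ^+ 2 + s.1.2 ^+ 2) / 6).
  rewrite /quad_form !exprMn (expr2 s1) (expr2 s2) (sign_sq s1 hs1) (sign_sq s2 hs2) /kappa.
  by field.
have le24 : 2 * t <= 4 * t by rewrite ler_pM2r // ler_nat.
have le28 : 2 * t <= 8 * t by rewrite ler_pM2r // ler_nat.
have le2 : t <= 2 * t by rewrite ler_peMl ?ler1n // ltW.
have imgP w : flow_image t w -> (forall i, `|pt w i| <= 4 * t) /\
    exists v, [/\ block t v, forall i, `|pt v i| <= 8 * t & forall i, pt w i = c (pt v) i 1].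
  move=> hw; split; first exact: flow_image_bound (ltW tp) hw.
  have [v hv hvw] := hw; exists v; split => // i.
  exact: le_trans (block_bound _ _ (ltW tp) hv i) (le_trans le2 le28).
(* Opposite translations. For [lo] the straightened point is v moved back by the shift, so
   recovering v moves into the cone; for [up] the straightened point is itself v moved into the
   cone. Either way the shift absorbs e, at the cost of changing the size by K t^4. *)
pose lo := pulled_integrand (1 - K * t ^+ 3) (t - K * t ^+ 4) t (- (s1 * cc)) (- (s2 * cc)).
pose up := pulled_integrand (1 + K * t ^+ 3) (t + K * t ^+ 4) t (s1 * cc) (s2 * cc).
have up_t0 : 0 < t + K * t ^+ 4 by rewrite ltr_wpDr.
have u1 : `|s1 * cc| <= t / 2 by rewrite signc.
have u2 : `|s2 * cc| <= t / 2 by rewrite signc.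
have l1 : `|- (s1 * cc)| <= t / 2 by rewrite normrN signc.
have l2 : `|- (s2 * cc)| <= t / 2 by rewrite normrN signc.
have dens w c1 c2 (s : R * R * R) : `|c1| <= (8 * t) ^+ 3 -> `|c2| <= (8 * t) ^+ 3 ->
    flow_image t w -> s = straighten kappa c1 c2 w -> (forall i, `|pt s i| <= 4 * t) ->
    quad_form (1 - K * t ^+ 3) (k / 3) (- 6^-1) (s1 * s.1.1) (s2 * s.1.2) *
      straighten_jac kappa c1 c2 w <= density w /\
    density w <= quad_form (1 + K * t ^+ 3) (k / 3) (- 6^-1) (s1 * s.1.1) (s2 * s.1.2) *
      straighten_jac kappa c1 c2 w.
  move=> h1 h2 /imgP[hw4 [v [hv hv8 hw]]] -> hs4.
  have [_ _ _ hsw] := hs (8 * t) c1 c2 (pt v) w t8 t8s h1 h2 hv8 hw.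
  rewrite A8 in hsw.
  have [] := hd t c1 c2 w tp ttd hw4 hs4 hsw.
  rewrite !qfE -/(density w); set J := straighten_jac _ _ _ _; set q := (_ - _ / 6).
  move=> hD J0 _; apply: sandwich_arith hD _.
  rewrite (_ : Kd * t ^+ 3 = 2 * Kd * t ^+ 3 * (1 / 2)); last by field.
  by apply: ler_pM => //; [apply: mulr_ge0 => //; exact: mulr_ge0|exact: ler_wpM2r].
exists lo, up; split; first split.
- exact: measurable_pulled_integrand.
- exact: measurable_pulled_integrand.
- exact: (pulled_integrand_ge0 _ _ _ _ _ tp lo_t0 lo_tt kt lo_a l1 l2).
- exact: (pulled_integrand_ge0 _ _ _ _ _ tp up_t0 up_tt kt up_a u1 u2).
split.
- move=> w; rewrite /lo /pulled_integrand; case: ifP => [/pt_cube hw4|_]; last by rewrite eqxx.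
  rewrite /block_integrand; case: ifP => [hb _|_]; last by rewrite mul0r eqxx.
  (* A point of the support of [lo] must be an image: surjectivity gives a preimage, and the shift
     places it in the block of size t. *)
  have [v hv hv2] := flow_surjective _ _ _ _ _ _ _ _ fl (pt w).
  have hv8 i : `|v i| <= 8 * t by apply: le_trans (hv2 _ hw4 i) _; rewrite mulrA -natrM.
  have n1 : `|- (s1 * cc)| <= (8 * t) ^+ 3 by rewrite normrN signc.
  have n2 : `|- (s2 * cc)| <= (8 * t) ^+ 3 by rewrite normrN signc.
  have hvw i : pt w i = c v i 1 by rewrite hv.
  have [g1 g2 g3 _] := hs (8 * t) _ _ v w t8 t8s n1 n2 hv8 hvw.
  rewrite -/e in g1 g2 g3.
  pose v3 : R * R * R := (v 0, v 1, v 2).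
  have v3E : pt v3 = v by apply/funext; apply: ord3_case.
  exists v3; last by rewrite v3E.
  have swap (x y z : R) : x - y - - z = - (y - x - z) by ring.
  rewrite swap normrN in g1; rewrite swap normrN in g2.
  apply: (wedge_block_shift _ _ _ alpha01 hs1 hs2 _ _ _ _ _ _ _ _ _ e0 ec _ _ hb) => //.
  + by apply: rt0; exact: ltW.
  + by rewrite distrC.
- move=> w hw; have [hw4 [v [hv hv8 hvw]]] := imgP w hw.
  have hc : cube (2 * (2 * t)) w by apply/pt_cube.
  apply/andP; split.
    rewrite /lo /pulled_integrand hc /block_integrand; case: ifP => [hb|_]; last first.
      by rewrite mul0r; exact: density_ge0 tg hw4.
    apply: (dens w _ _ _ _ _ hw erefl _).1; rewrite ?normrN ?signc //.
    by move=> i; exact: le_trans (block_bound _ _ (ltW lo_t0) hb i) (le_trans lo_tt le24).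
  have n1 : `|s1 * cc| <= (8 * t) ^+ 3 by rewrite signc.
  have n2 : `|s2 * cc| <= (8 * t) ^+ 3 by rewrite signc.
  have [g1 g2 g3 _] := hs (8 * t) _ _ (pt v) w t8 t8s n1 n2 hv8 hvw.
  rewrite -/e in g1 g2 g3.
  have hb : block (t + K * t ^+ 4) (straighten kappa (s1 * cc) (s2 * cc) w).
    apply: (wedge_block_shift _ _ _ alpha01 hs1 hs2 _ _ _ _ _ _ _ _ _ e0 ec _ _ hv) => //.
    + by apply: rt0; exact: ltW.
  rewrite /up /pulled_integrand hc /block_integrand hb.
  apply: (dens w _ _ _ n1 n2 hw erefl _).2.
  by move=> i; exact: le_trans (block_bound _ _ (ltW up_t0) hb i) (le_trans up_tt le24).
- exact: (pulled_integral _ _ _ _ _ tp lo_t0 lo_tt kt lo_a l1 l2).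
- exact: (pulled_integral _ _ _ _ _ tp up_t0 up_tt kt up_a u1 u2).
Qed.

End Quadrant.

(** * Volume of the image of the wedge *)

Section BlockValue.
Context {R : realType}.
Variables (alpha k rho0 : R).

Definition quarter_volume : R := Num.sqrt 3 * rho0 ^+ 3 / 2 * (atan alpha^-1 - atan alpha).

(** Homogeneity in tau. The four quadrants contribute equally, because k enters through |x y|; hence
    the quarter of [coef5]. *)
Lemma block_valueE a tau : block_value alpha k rho0 a tau =
  a * quarter_volume * tau ^+ 3 + coef5 alpha k rho0 / 4 * tau ^+ 5.
Proof.
rewrite /block_value /sector_value /block_height /quarter_volume /coef5.
set q := (1 - _) / (1 + _); set L := atan _ - atan _.
by field.
Qed.

(** 15 = 2^4 - 1 and 31 = 2^5 - 1. With x = s K t^3 both a = 1 + x and tau = t (1 + x), so a tau^3 =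
    t^3 (1 + x)^4 and tau^5 = t^5 (1 + x)^5. *)
Lemma binomial_bounds (x : R) : `|x| <= 1 ->
  `|(1 + x) ^+ 4 - 1| <= 15 * `|x| /\ `|(1 + x) ^+ 5 - 1| <= 31 * `|x|.
Proof.
move=> hx; have pw n : `|x ^+ n| <= 1 by rewrite normrX exprn_ile1.
have h2 := pw 2%N; have h3 := pw 3%N; have h4 := pw 4%N.
have -> : (1 + x) ^+ 4 - 1 = (4 + 6 * x + 4 * x ^+ 2 + x ^+ 3) * x by ring.
have -> : (1 + x) ^+ 5 - 1 = (5 + 10 * x + 10 * x ^+ 2 + 5 * x ^+ 3 + x ^+ 4) * x by ring.
have mulx (y c : R) : `|y| <= c -> `|y * x| <= c * `|x|.
  by move=> hy; rewrite normrM; exact: ler_wpM2r.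
move: hx h2 h3 h4; rewrite ![`|_| <= 1]ler_norml => /andP[? ?] /andP[? ?] /andP[? ?] /andP[? ?].
by split; apply: mulx; rewrite ler_norml; apply/andP; split; lra.
Qed.

Lemma block_value_approx (K : R) : 0 <= K -> exists2 C : R, 0 <= C &
  forall t s : R, 0 < t -> t <= 1 -> K * t ^+ 3 <= 1 -> `|s| = 1 ->
  `|block_value alpha k rho0 (1 + s * (K * t ^+ 3)) (t + s * (K * t ^+ 4))
    - (quarter_volume * t ^+ 3 + coef5 alpha k rho0 / 4 * t ^+ 5)| <= C * t ^+ 6.
Proof.
move=> K0; set V := quarter_volume; set W := coef5 _ _ _ / 4.
exists (K * (15 * `|V| + 31 * `|W|)).
  by apply: mulr_ge0 => //; apply: addr_ge0; apply: mulr_ge0.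
move=> t s t0 t1 Kt hs; rewrite block_valueE -/V -/W; clearbody V W.
have t3 : 0 <= K * t ^+ 3 by apply: mulr_ge0 => //; rewrite exprn_ge0 // ltW.
set x := s * (K * t ^+ 3).
have xE : `|x| = K * t ^+ 3 by rewrite /x normrM hs mul1r ger0_norm.
have [b4 b5] := binomial_bounds x ltac:(by rewrite xE).
rewrite (_ : _ - _ = V * t ^+ 3 * ((1 + x) ^+ 4 - 1) + W * t ^+ 5 * ((1 + x) ^+ 5 - 1)); last first.
  by rewrite /x; ring.
apply: le_trans (ler_normD _ _) _.
rewrite (_ : K * _ * _ = K * (15 * `|V|) * t ^+ 6 + K * (31 * `|W|) * t ^+ 6); last by ring.
have tp n : 0 <= t ^+ n by rewrite exprn_ge0 // ltW.
have nm (A B Y : R) : 0 <= B -> `|A * B * Y| = `|A| * B * `|Y|.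
  by move=> B0; rewrite !normrM (ger0_norm B0).
rewrite !nm //; apply: lerD.
  apply: le_trans (ler_wpM2l _ b4) _; first exact: mulr_ge0.
  by rewrite xE le_eqVlt; apply/orP; left; apply/eqP; ring.
apply: le_trans (ler_wpM2l _ b5) _; first exact: mulr_ge0.
rewrite xE (_ : `|W| * t ^+ 5 * _ = K * (31 * `|W|) * t ^+ 6 * t ^+ 2); last by ring.
rewrite ler_piMr //; last by rewrite exprn_ile1 // ltW.
by apply: mulr_ge0 => //; apply: mulr_ge0 => //; exact: mulr_ge0.
Qed.

End BlockValue.

Section QuadrantGeometry.
Context {R : realType}.
Variables (alpha k rho0 : R) (b : R -> R) (chi : R * R -> R) (p e1 e2 : 'rV[R]_3).
Hypotheses (frame : orthonormal3 p e1 e2) (alpha01 : 0 < alpha < 1).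
Hypotheses (hb : cutoff1 b) (hchi : cutoff2 chi).
Hypotheses (rho0_gt0 : 0 < rho0) (rho0_le1 : rho0 <= 1).
Notation volume_density w := (Num.sqrt (\det (gram alpha k b chi p e1 e2 (row3 w)))).

Lemma row3_0 (w : R * R * R) : row3 w 0 = pt w.
Proof. by apply/funext => i; rewrite mxE. Qed.

Lemma det_diag (f : 'I_3 -> R) :
  \det (\matrix_(i < 3, j < 3) (if i == j then f i else 0)) = f 0 * f 1 * f 2.
Proof.
rewrite (_ : \matrix_(i, j) _ = diag_mx (\row_i f i)); last first.
  by apply/matrixP => i j; rewrite !mxE; case: eqVneq => [->|]; rewrite ?mulr1n ?mulr0n.
by rewrite det_diag big_ord_recl big_ord_recl big_ord1 !mxE mulrA; congr (_ * f _ * f _); exact: val_inj.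
Qed.

Lemma volume_densityE (w : R * R * R) (s1 s2 eta : R) : `|s1| = 1 -> `|s2| = 1 ->
  eta <= 1 -> eta <= geo_radius k ->
  (1 + k * chi_rho chi (rho_star alpha k) w.1.1 w.1.2 * psi alpha b w.1.1 w.1.2 =
   1 + s1 * s2 * k * (w.1.1 * w.1.2)) -> `|w.1.1| <= eta -> `|w.1.2| <= eta ->
  volume_density w = density k s1 s2 w.
Proof.
move=> hs1 hs2 eta1 etak phiE h1 h2.
have kE : geo_radius k = geo_radius (s1 * s2 * k) by rewrite /geo_radius !normrM hs1 hs2 !mul1r.
have i1 := phi_ge_half (s1 * s2 * k) w.1.1 w.1.2.
rewrite -kE in i1; have {i1}ph := i1 (le_trans h1 etak) (le_trans h2 etak).
have co := cos_ge_half k w.1.1 (le_trans h1 etak).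
have dom : sphere_dom (row3 w 0 0, row3 w 0 1).
  have gr := geo_radius_le k.
  by rewrite row3_0; apply: sphere_dom_le1; rewrite /pt /=; lra.
rewrite (gramE _ _ _ _ _ _ _ frame) // det_diag row3_0 /gram_diag /pt /= phiE.
set f := 1 + _ in ph *; have f0 : 0 < f by lra.
rewrite (_ : _ * _ = (cos w.1.1 / f) ^+ 2); last by field; exact: lt0r_neq0.
rewrite sqrtr_sqr ger0_norm /density -/f // divr_ge0 ?(ltW f0) //; lra.
Qed.

(** What the summation has to know of one quadrant: [I] is the set of time-one positions, x and y
    are the integrals of the two bounds. The flow and its constants, which depend on the quadrant
    through kappa, stay hidden. *)
Record quadrant_sandwiched (s1 s2 C t : R) (I : set (R * R * R)) (lo up : R * R * R -> R)
    (x y : R) : Prop := QuadrantSandwiched {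
  lo_measurable : measurable_fun [set: R * R * R] lo;
  up_measurable : measurable_fun [set: R * R * R] up;
  lo_ge0 : forall w, 0 <= lo w;
  up_ge0 : forall w, 0 <= up w;
  lo_support : forall w, lo w != 0 -> I w;
  lo_up : forall w, I w -> lo w <= volume_density w <= up w;
  lo_integral : int3 (fun w => (lo w)%:E) = x%:E;
  up_integral : int3 (fun w => (up w)%:E) = y%:E;
  lo_value : `|x - (quarter_volume alpha rho0 * t ^+ 3 + coef5 alpha k rho0 / 4 * t ^+ 5)| <= C * t ^+ 6;
  up_value : `|y - (quarter_volume alpha rho0 * t ^+ 3 + coef5 alpha k rho0 / 4 * t ^+ 5)| <= C * t ^+ 6;
  block_exp : forall v, block alpha rho0 s1 s2 t v -> exp_defined alpha k b chi p e1 e2 (row3 v) /\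
    exists2 w, I w & exp_q alpha k b chi p e1 e2 (row3 v) = chart p e1 e2 (row3 w);
  image_quadrant : forall w, I w -> [/\ 0 < s1 * w.1.1, 0 < s2 * w.1.2 & chart_dom (row3 w)];
  image_exp : forall w, I w -> exists2 v, block alpha rho0 s1 s2 t v &
    exp_q alpha k b chi p e1 e2 (row3 v) = chart p e1 e2 (row3 w) }.

Theorem quadrant_volume (s1 s2 : R) : `|s1| = 1 -> `|s2| = 1 ->
  exists2 C : R, 0 <= C & \forall t \near (0 : R)^'+,
    exists I lo up x y, quadrant_sandwiched s1 s2 C t I lo up x y.
Proof.
move=> hs1 hs2; have [a0 a1] := andP alpha01.
have [eta [eta0 eta1 etak phiE]] := phi_wedge alpha k b chi alpha01 hb hchi.
(* [flow_horizontal] multiplies this Lipschitz bound by 8, which yields the alpha / 4 of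
   [cone_pt_wedge]. *)
have al : 0 < alpha / 32 by lra.
have al' : alpha / 32 <= 1 / 16 by lra.
have [m [Cf [c [d [m0 _ Cf0 fl]]]]] := geo_flow_exists (s1 * s2 * k) _ al al'.
have [K [t0 [K0 t00 hK]]] := quadrant_sandwich _ _ _ _ _ alpha01 hs1 hs2 rho0_gt0 rho0_le1
  _ _ _ _ fl m0 Cf0.
have [C C0 hC] := block_value_approx alpha k rho0 K K0.
exists C => //; near=> t.
have tp : 0 < t by near: t; exact: nbhs_right_gt.
have tt0 : t <= t0 by near: t; exact: nbhs_right_le.
have t1 : t <= 1 by near: t; exact: nbhs_right_le.
have tm : 4 * t < m.
  by rewrite mulrC -ltr_pdivlMr //; near: t; apply: nbhs_right_lt; rewrite divr_gt0.
have te : 4 * t < eta.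
  by rewrite mulrC -ltr_pdivlMr //; near: t; apply: nbhs_right_lt; rewrite divr_gt0.
have tK : t <= (K + 1)^-1.
  by near: t; apply: nbhs_right_le; rewrite invr_gt0 ltr_wpDl.
have Kt : K * t ^+ 3 <= 1.
  have K1 : 0 < K + 1 by rewrite ltr_wpDl.
  have : t * (K + 1) <= 1 by rewrite -ler_pdivlMr ?mul1r.
  have : K * t ^+ 3 <= K * t.
    apply: ler_wpM2l => //; rewrite exprS; apply: ler_piMr; first exact: ltW.
    by rewrite exprn_ile1 // ltW.
  by lra.
have [lo [up [[l1 l2 l3 l4] [l5 l6 l7 l8]]]] := hK t tp tt0.
have cone v : block alpha rho0 s1 s2 t v -> cone_pt alpha s1 s2 t (pt v).
  apply: wedge_block_cone_pt => //.
  - by rewrite mulr_ge0 // ltW.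
  - by rewrite -[leRHS]mul1r; apply: ler_wpM2r => //; exact: ltW.
  - by apply: block_height_le => //; exact: ltW.
have s32 : `|1 : R| <= 3 / 2 by rewrite normr1; lra.
have img_wedge w : flow_image alpha rho0 s1 s2 c t w -> wedge alpha eta s1 s2 w.1.1 w.1.2.
  move=> [v hv hw]; have hc := cone v hv; have [_ _ _ hvt] := hc.
  have lt_eta i : `|c (pt v) i 1| < eta.
    by apply: le_lt_trans te; exact: (flow_small _ _ _ _ _ _ fl _ _ _ i hvt s32).1.
  have cl i : i != 2 -> `|c (pt v) i 1 - 1 * pt v i| <= alpha / 4 * Num.max `|pt v 0| `|pt v 1| * 1.
    move=> i2; rewrite (_ : alpha / 4 = 8 * (alpha / 32)); last by field.
    rewrite -[X in _ * _ * X](normr1 R).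
    by apply: (flow_horizontal _ _ _ _ _ _ fl) => //; rewrite le_max lexx ?orbT.
  have -> : w.1.1 = c (pt v) 0 1 by rewrite -hw.
  have -> : w.1.2 = c (pt v) 1 1 by rewrite -hw.
  exact: (cone_pt_wedge _ alpha01 _ _ _ hs1 hs2 _ _ 1 _ _ hc ltr01 (cl 0 isT) (cl 1 isT)).
have exps v := exp_flow _ _ _ _ _ _ _ frame alpha01 _ _ _ hs1 hs2 eta0 eta1 etak phiE
  _ _ _ _ fl t tm te (row3 v).
have curve v w : (forall i, pt w i = c (pt v) i 1) -> flow_curve c (row3 v) 1 = row3 w.
  by move=> hw; apply/rowP => i; rewrite !mxE row3_0 -hw.
exists (flow_image alpha rho0 s1 s2 c t), lo, up, (block_value alpha k rho0 (1 - K * t ^+ 3) (t - K * t ^+ 4)),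
  (block_value alpha k rho0 (1 + K * t ^+ 3) (t + K * t ^+ 4)); split => //.
- move=> w hw; have [[w1 w1'] [w2 w2'] _ _] := img_wedge w hw.
  have ns (s z : R) : `|s| = 1 -> 0 < s * z -> s * z < eta -> `|z| <= eta.
    by move=> hs h1 h2; rewrite -[`|z|]mul1r -hs -normrM gtr0_norm // ltW.
  rewrite (volume_densityE w s1 s2 eta) //.
  + exact: l6.
  + by apply: phiE => //; exact: img_wedge.
  + exact: ns w1 w1'.
  + exact: ns w2 w2'.
- have := hC t (-1) tp t1 Kt; rewrite !mulN1r; apply.
  by rewrite normrN1.
- have := hC t 1 tp t1 Kt; rewrite !mul1r; apply.
  exact: normr1.
- move=> v hv; have := exps v; rewrite row3_0 => /(_ (cone v hv)) [h1 _ h3]; split => //.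
  pose w : R * R * R := (c (pt v) 0 1, c (pt v) 1 1, c (pt v) 2 1).
  have hw i : pt w i = c (pt v) i 1 by move: i; apply: ord3_case.
  exists w; first by exists v.
  by rewrite h3 (curve v w hw).
- move=> w hw; have [[w1 _] [w2 _] _ _] := img_wedge w hw; split => //.
  have [v hv hvw] := hw; rewrite -(curve v w hvw).
  by have := exps v; rewrite row3_0 => /(_ (cone v hv)) [].
- move=> w [v hv hvw]; exists v => //; rewrite -(curve v w hvw).
  by have := exps v; rewrite row3_0 => /(_ (cone v hv)) [].
Unshelve. all: by end_near. Qed.

End QuadrantGeometry.

(** * Summation over the four quadrants *)

Section QuadrantSums.
Context {R : realType}.
Notation mu := (@lebesgue_measure R).

(** Indexing signs by booleans makes the quadrants a finite type. *)
Definition sgb (b : bool) : R := if b then 1 else - 1.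

Lemma normr_sgb b : `|sgb b| = 1.
Proof. by case: b; rewrite /sgb ?normrN normr1. Qed.

Lemma sgb_inj (b b' : bool) (x : R) : 0 < sgb b * x -> 0 < sgb b' * x -> b = b'.
Proof. by case: b b' => -[] //; rewrite /sgb !mul1r !mulN1r => h1 h2; exfalso; lra. Qed.

Lemma int3_sum (I : finType) (f : I -> R * R * R -> R) :
  (forall i, measurable_fun [set: R * R * R] (f i)) -> (forall i u, 0 <= f i u) ->
  int3 (fun u => (\sum_i f i u)%:E) = (\sum_i int3 (fun u => (f i u)%:E))%E.
Proof.
move=> mf f0; rewrite /int3.
under eq_integral do rewrite -sumEFin.
rewrite ge0_integral_sum //; first by move=> i; apply/measurable_EFinP; exact: mf.
by move=> i u _; rewrite lee_fin.
Qed.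

Lemma sum_disjoint (I : finType) (F : I -> R) j :
  (forall i, F i != 0 -> i = j) -> \sum_i F i = F j.
Proof.
move=> h; rewrite (bigD1 j) //= big1 ?addr0 // => i ij.
by apply/eqP; apply: contraT => /h e; rewrite e eqxx in ij.
Qed.

Lemma row3_inj : injective (@row3 R).
Proof.
move=> [[x y] z] [[x' y'] z'] /(congr1 (fun M : 'rV[R]_3 => M 0)); rewrite !row3_0 => e.
by have := congr1 (@^~ 0) e; have := congr1 (@^~ 1) e; have := congr1 (@^~ 2) e; rewrite /pt /= => -> -> ->.
Qed.

Lemma row3_surj (v : 'rV[R]_3) : v = row3 (v 0 0, v 0 1, v 0 2).
Proof.
by apply/rowP; apply: ord3_case; rewrite row3_0.
Qed.

Lemma chart_inj (p e1 e2 u v : 'rV[R]_3) : orthonormal3 p e1 e2 -> chart_dom u -> chart_dom v ->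
  chart p e1 e2 u = chart p e1 e2 v -> u = v.
Proof.
move=> frame [u1 u2] [v1 v2] [h1 h2].
have [h01 h02] := sphere_chart_inj _ _ _ frame _ _ u1 v1 h1.
have h3 := circle_chart_inj _ _ u2 v2 h2.
by apply/rowP; apply: ord3_case.
Qed.

End QuadrantSums.

Section OmegaBlocks.
Context {R : realType}.
Variables (alpha rho0 : R).
Hypotheses (alpha01 : 0 < alpha < 1) (rho0_gt0 : 0 < rho0).
Notation blk i := (block alpha rho0 (sgb i.1) (sgb i.2)).

Lemma block_scale s1 s2 (t x y z : R) : 0 < t ->
  block alpha rho0 s1 s2 t (t * x, t * y, t * z) = block alpha rho0 s1 s2 1 (x, y, z).
Proof.
move=> t0; rewrite /block /wedge_block /sector /block_height /= !mulr1.
rewrite (_ : Num.sqrt 3 / 2 * (rho0 * t) = t * (Num.sqrt 3 / 2 * rho0)); last by ring.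
rewrite -mulrN !(ltr_pM2l t0) !(mulrCA _ t) (pmulr_rgt0 _ t0) !(ler_pM2l t0).
rewrite (_ : (t * (s1 * x)) ^+ 2 + (t * (s2 * y)) ^+ 2 = t ^+ 2 * ((s1 * x) ^+ 2 + (s2 * y) ^+ 2)); last by ring.
by rewrite (mulrC rho0 t) [(t * rho0) ^+ 2]exprMn (ler_pM2l (exprn_gt0 2 t0)).
Qed.

Lemma block_disjoint (i j : bool * bool) t v : blk i t v -> blk j t v -> i = j.
Proof.
have [a0 _] := andP alpha01.
have pos s1 s2 : block alpha rho0 s1 s2 t v -> 0 < s1 * v.1.1 /\ 0 < s2 * v.1.2.
  move=> /andP[/and4P[h1 h2 _ _] _]; split => //.
  by apply: lt_le_trans h2; rewrite mulr_gt0.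
move=> /pos[i1 i2] /pos[j1 j2].
case: i j i1 i2 j1 j2 => [i1 i2] [j1 j2] /= h1 h2 h3 h4.
by rewrite (sgb_inj _ _ _ h1 h3) (sgb_inj _ _ _ h2 h4).
Qed.

(** [Omega_pm] fixes the sign of x y; separating the signs of x and y turns its two pieces into four
    blocks. *)
Lemma Omega_block (v : R * R * R) : Omega alpha rho0 (row3 v) <-> exists i, blk i 1 v.
Proof.
have [a0 a1] := andP alpha01; case: v => [[x y] z].
have rE : Num.sqrt (x ^+ 2 + y ^+ 2) <= rho0 <-> x ^+ 2 + y ^+ 2 <= rho0 ^+ 2.
  rewrite -{1}(ger0_norm (ltW rho0_gt0)) -sqrtr_sqr ler_sqrt //; exact: sqr_ge0.
have aE (X Y : R) : Y <= alpha^-1 * X <-> alpha * Y <= X.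
  by rewrite mulrC ler_pdivlMr // mulrC.
have sn (b : bool) (X : R) : 0 < sgb b * X -> `|X| = sgb b * X.
  by move=> h; rewrite -(gtr0_norm h) normrM normr_sgb mul1r.
rewrite /Omega /Omega_pm /setU /= !row3_0 /pt /=; split.
- move=> h; exists (0 < x, 0 < y).
  have [h1 h2 /andP[h3 h4] h5] : [/\ Num.sqrt (x ^+ 2 + y ^+ 2) <= rho0, x * y != 0,
      alpha * `|x| <= `|y| <= alpha^-1 * `|x| &
      - (Num.sqrt 3 / 2 * rho0) < z < Num.sqrt 3 / 2 * rho0].
    case: h => -[g1 g2 g3 g4]; split => //; move: g2.
      by rewrite mul1r; exact: lt0r_neq0.
    by rewrite mulN1r oppr_gt0; exact: ltr0_neq0.
  move: h2; rewrite mulf_eq0 negb_or => /andP[x0 y0].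
  have sg (w : R) : w != 0 -> sgb (0 < w) * w = `|w|.
    move=> w0; rewrite /sgb; case: ltrP => hw; first by rewrite mul1r gtr0_norm.
    by rewrite mulN1r ler0_norm.
  rewrite /block /wedge_block /sector /block_height /= !mulr1 !sg // normr_gt0 x0 h3 /=.
  by rewrite (aE _ _).1 // !real_normK ?num_real // rE.1.
- move=> [[i j]]; rewrite /block /wedge_block /sector /block_height /= !mulr1.
  move=> /andP[/and4P[h1 h2 h3 h4] h5].
  have h6 : 0 < sgb j * y by apply: lt_le_trans h2; rewrite mulr_gt0.
  have hr : Num.sqrt (x ^+ 2 + y ^+ 2) <= rho0.
    apply: rE.2; move: h4; rewrite -(sn _ _ h1) -(sn _ _ h6) !real_normK ?num_real //.
  have ha : alpha * `|x| <= `|y| <= alpha^-1 * `|x|.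
    by rewrite (sn _ _ h1) (sn _ _ h6) h2 /=; apply: (aE _ _).2.
  have hxy : 0 < (sgb i * sgb j) * (x * y) by rewrite mulrACA mulr_gt0.
  have hij : sgb i * sgb j = sgb (i == j) :> R.
    by rewrite /sgb; case: (i); case: (j); rewrite /= ?mulrNN ?mulr1 ?mul1r.
  by move: hxy; rewrite hij; case: (i == j) => hxy; [left|right].
Qed.

Lemma scaled_Omega_block (t : R) (v : R * R * R) : 0 < t ->
  scaled t (Omega alpha rho0) (row3 v) <-> exists i, blk i t v.
Proof.
move=> t0; split.
- move=> [v' hv' e]; rewrite (row3_surj v') in hv' e.
  have {e} -> : v = (t * v' 0 0, t * v' 0 1, t * v' 0 2).
    apply: row3_inj; rewrite -e; apply/rowP; apply: ord3_case; by rewrite !mxE.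
  by have [i hi] := (Omega_block _).1 hv'; exists i; rewrite block_scale.
- case: v => [[x y] z] [i hi].
  have xE (w : R) : w = t * (w / t) by rewrite mulrC divfK // gt_eqF.
  move: hi; rewrite {1}(xE x) {1}(xE y) {1}(xE z) block_scale // => hi.
  exists (row3 (x / t, y / t, z / t)); first by apply/Omega_block; exists i.
  by apply/rowP; apply: ord3_case; rewrite !mxE /= -xE.
Qed.

Lemma volE_Omega : volE (Omega alpha rho0) = (4 * quarter_volume alpha rho0)%:E.
Proof.
pose f (i : bool * bool) (u : R * R * R) : R := if blk i 1 u then quad_form 1 0 0 (sgb i.1 * u.1.1) (sgb i.2 * u.1.2) else 0.
have q1 x y : quad_form (1 : R) 0 0 x y = 1 by rewrite /quad_form; ring.
have mb (i : bool * bool) : measurable_fun [set: R * R * R] (blk i 1) by exact: measurable_wedge_block.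
have mf i : measurable_fun [set: R * R * R] (f i).
  apply: measurable_fun_ifT; [exact: mb|exact: measurable_quad_form3|].
  exact: measurable_cst.
have f0 i u : 0 <= f i u by rewrite /f; case: ifP => // _; rewrite q1.
pose A := [set u | [|| blk (true, true) 1 u, blk (true, false) 1 u, blk (false, true) 1 u | blk (false, false) 1 u]].
have AP u : A u <-> exists i, blk i 1 u.
  split; first by case/or4P => h; [exists (true, true)|exists (true, false)|exists (false, true)|exists (false, false)].
  by move=> [[[] []] h]; apply/or4P; [constructor 1|constructor 2|constructor 3|constructor 4].
have mA : measurable A.
  apply: (measurable_bool_set (fun u => [|| blk (true, true) 1 u, blk (true, false) 1 u,
    blk (false, true) 1 u | blk (false, false) 1 u])).
  by apply: measurable_or => //; apply: measurable_or => //; apply: measurable_or.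
have -> : volE (Omega alpha rho0) = leb3 A.
  rewrite /volE; congr leb3; apply/seteqP; split => u /=.
    by move/Omega_block => h; apply/AP.
  by move/AP => h; apply/Omega_block.
transitivity (int3 (fun u => (\sum_i f i u)%:E)).
  rewrite /leb3 /int3 -[LHS]/((@plane_measure R \x @lebesgue_measure R)%E A) -[A]setIT -integral_indic //.
  apply: eq_integral => u _; congr (_%:E).
  have [/AP[j hj]|hA] := pselect (A u).
    rewrite (sum_disjoint _ _ j).
      by rewrite indicE mem_set ?/f ?hj ?q1 //; apply/AP; exists j.
    by move=> i; rewrite /f; case: ifP => [hi _|]; [exact: block_disjoint hi hj|rewrite eqxx].
  rewrite indicE memNset // big1 // => i _; rewrite /f; case: ifP => // hi.
  by exfalso; apply: hA; apply/AP; exists i.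
rewrite int3_sum //.
have hh : 0 < block_height rho0 1 by exact: block_height_gt0.
have h1 i : int3 (fun u => (f i u)%:E) = (quarter_volume alpha rho0)%:E.
  rewrite /f (wedge_integral _ _ _ _ _ _ _ _ alpha01 _ hh (normr_sgb _) (normr_sgb _)); last 2 first.
  - by rewrite mulr1.
  - by move=> x y _; rewrite q1.
  congr (_%:E); rewrite /block_height /sector_value /quarter_volume.
  by set q := (1 - _) / (1 + _); field.
under eq_bigr do rewrite h1.
by rewrite sumEFin sumr_const card_prod card_bool mulr_natl.
Qed.

End OmegaBlocks.

Lemma coef5_gt0 (R : realType) (alpha k rho0 : R) : 0 < alpha < 1 -> 0 < rho0 ->
  0 < coef5 alpha k rho0 <-> K_star alpha < k.
Proof.
move=> /andP[a0 a1] r0; rewrite /coef5 /K_star.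
set L := atan _ - atan _; set q := (1 - alpha ^+ 2) / (1 + alpha ^+ 2).
have n0 : 0 < 1 - alpha ^+ 2 by rewrite subr_gt0 expr_lt1 // ltW.
have d0 : 0 < 1 + alpha ^+ 2 by rewrite ltr_pwDl // sqr_ge0.
have q0 : 0 < q by exact: divr_gt0.
have c0 : 0 < Num.sqrt 3 * rho0 ^+ 5 / 6.
  apply: divr_gt0 => //; apply: mulr_gt0; last exact: exprn_gt0.
  by rewrite sqrtr_gt0.
rewrite (pmulr_rgt0 _ c0) subr_gt0 -(ltr_pdivrMr _ _ q0).
rewrite (_ : (1 + alpha ^+ 2) / (1 - alpha ^+ 2) * L = L / q) //.
by rewrite /q invf_div mulrC.
Qed.

Section VolumeExpansion.
Context {R : realType}.
Variables (alpha k rho0 : R) (b : R -> R) (chi : R * R -> R) (p e1 e2 : 'rV[R]_3).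
Hypotheses (frame : orthonormal3 p e1 e2) (alpha01 : 0 < alpha < 1).
Hypotheses (hb : cutoff1 b) (hchi : cutoff2 chi).
Hypotheses (rho0_gt0 : 0 < rho0) (rho0_le1 : rho0 <= 1).
Notation volume_density w := (Num.sqrt (\det (gram alpha k b chi p e1 e2 (row3 w)))).
Notation sandwiched i := (quadrant_sandwiched alpha k rho0 b chi p e1 e2 (sgb i.1) (sgb i.2)).

(** The domain of integration need not be measurable, so monotonicity on the whole space compares
    its integral with sums of measurable bounds. The supports of the lower bounds lie in different
    open quadrants, so at most one of them is nonzero at a point. *)
Lemma volume_sandwich (t : R) (C : bool * bool -> R) (I : bool * bool -> set (R * R * R))
    (lo up : bool * bool -> R * R * R -> R) (x y : bool * bool -> R) : 0 < t ->
  (forall i, sandwiched i (C i) t (I i) (lo i) (up i) (x i) (y i)) ->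
  ((\sum_i x i)%:E <= vol_g alpha k b chi p e1 e2
     (exp_q alpha k b chi p e1 e2 @` scaled t (Omega alpha rho0)) <= (\sum_i y i)%:E)%E.
Proof.
move=> t0 H.
have disj i j w : I i w -> I j w -> i = j.
  move=> /(image_quadrant _ _ _ _ _ _ _ _ _ _ _ _ _ _ _ _ _ (H i)) [i1 i2 _].
  move=> /(image_quadrant _ _ _ _ _ _ _ _ _ _ _ _ _ _ _ _ _ (H j)) [j1 j2 _].
  move: i1 i2 j1 j2; case: i => i1 i2; case: j => j1 j2 /= h1 h2 h3 h4.
  by rewrite (sgb_inj _ _ _ h1 h3) (sgb_inj _ _ _ h2 h4).
(* Injectivity of the chart identifies u with a time-one position, so the domain of integration is
   the union of the sets [I i]. *)
have domE u : chart_dom (row3 u) /\ (exp_q alpha k b chi p e1 e2 @` scaled t (Omega alpha rho0))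
    (chart p e1 e2 (row3 u)) <-> exists i, I i u.
  split.
  - move=> [du [v hv e]]; rewrite (row3_surj v) in hv e.
    have [i hi] := (scaled_Omega_block _ _ alpha01 rho0_gt0 _ _ t0).1 hv.
    have [_ [w hw ew]] := block_exp _ _ _ _ _ _ _ _ _ _ _ _ _ _ _ _ _ (H i) _ hi.
    have [_ _ dw] := image_quadrant _ _ _ _ _ _ _ _ _ _ _ _ _ _ _ _ _ (H i) _ hw.
    exists i; rewrite (_ : u = w) //; apply: row3_inj.
    by apply: (chart_inj _ _ _ _ _ frame) => //; rewrite -e ew.
  - move=> [i hi]; have [_ _ du] := image_quadrant _ _ _ _ _ _ _ _ _ _ _ _ _ _ _ _ _ (H i) _ hi.
    have [v hv ev] := image_exp _ _ _ _ _ _ _ _ _ _ _ _ _ _ _ _ _ (H i) _ hi.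
    split => //; exists (row3 v) => //.
    by apply/(scaled_Omega_block _ _ alpha01 rho0_gt0 _ _ t0); exists i.
rewrite /vol_g integral_mkcond.
set D := (X in X \_ _).
set S := [set u | _].
have SP u : u \in S <-> exists i, I i u by rewrite inE; exact: domE.
have D0 u : (0 <= (D \_ S) u)%E.
  by rewrite patchE; case: ifP => // _; rewrite lee_fin sqrtr_ge0.
have lo0 i u : 0 <= lo i u := lo_ge0 _ _ _ _ _ _ _ _ _ _ _ _ _ _ _ _ _ (H i) u.
have up0 i u : 0 <= up i u := up_ge0 _ _ _ _ _ _ _ _ _ _ _ _ _ _ _ _ _ (H i) u.
apply/andP; split.
- rewrite -sumEFin (eq_bigr (fun i => int3 (fun w => (lo i w)%:E))); last first.
    by move=> i _; rewrite (lo_integral _ _ _ _ _ _ _ _ _ _ _ _ _ _ _ _ _ (H i)).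
  rewrite -int3_sum //; last by move=> i; exact: (lo_measurable _ _ _ _ _ _ _ _ _ _ _ _ _ _ _ _ _ (H i)).
  rewrite /int3; apply: ge0_le_integralT_set => u.
    by rewrite lee_fin sumr_ge0.
  have [[j hj]|hn] := pselect (exists j, lo j u != 0); last first.
    rewrite [X in X%:E]big1; first exact: D0.
    by move=> i _; apply/eqP; apply: contraT => h; exfalso; apply: hn; exists i.
  have Ij := lo_support _ _ _ _ _ _ _ _ _ _ _ _ _ _ _ _ _ (H j) _ hj.
  rewrite (sum_disjoint _ _ j); last first.
    by move=> i /(lo_support _ _ _ _ _ _ _ _ _ _ _ _ _ _ _ _ _ (H i)) hi; exact: disj hi Ij.
  rewrite patchE (SP u).2; last by exists j.
  by rewrite lee_fin; case/andP: (lo_up _ _ _ _ _ _ _ _ _ _ _ _ _ _ _ _ _ (H j) _ Ij).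
- rewrite -sumEFin (eq_bigr (fun i => int3 (fun w => (up i w)%:E))); last first.
    by move=> i _; rewrite (up_integral _ _ _ _ _ _ _ _ _ _ _ _ _ _ _ _ _ (H i)).
  rewrite -int3_sum //; last by move=> i; exact: (up_measurable _ _ _ _ _ _ _ _ _ _ _ _ _ _ _ _ _ (H i)).
  rewrite /int3; apply: ge0_le_integralT_set => u; first exact: D0.
  rewrite patchE; case: ifPn => [/SP [j hj]|_]; last by rewrite lee_fin sumr_ge0.
  rewrite lee_fin (bigD1 j) //=.
  have /andP[_ h] := lo_up _ _ _ _ _ _ _ _ _ _ _ _ _ _ _ _ _ (H j) _ hj.
  by apply: le_trans h _; rewrite lerDl sumr_ge0.
Qed.

Lemma volume_expansion : exists C : R, \forall t \near 0^'+,
  (forall v, scaled t (Omega alpha rho0) v -> exp_defined alpha k b chi p e1 e2 v) /\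
  (`| vol_g alpha k b chi p e1 e2
        (exp_q alpha k b chi p e1 e2 @` scaled t (Omega alpha rho0))
      - (t ^+ 3)%:E * volE (Omega alpha rho0)
      - (coef5 alpha k rho0 * t ^+ 5)%:E | <= (C * t ^+ 6)%:E)%E.
Proof.
have HQ (i : bool * bool) : exists C : R, 0 <= C /\ \forall t \near (0 : R)^'+,
    exists I lo up x y, sandwiched i C t I lo up x y.
  have [C C0 h] := quadrant_volume alpha k rho0 b chi p e1 e2 frame alpha01 hb hchi rho0_gt0
    rho0_le1 _ _ (normr_sgb i.1) (normr_sgb i.2).
  by exists C.
have [C hC] := choice HQ.
exists (\sum_i C i).
have near_all : \forall t \near (0 : R)^'+,
    forall i, exists I lo up x y, sandwiched i (C i) t I lo up x y.
  by apply: filter_forall => i; exact: (hC i).2.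
near=> t.
have t0 : 0 < t by near: t; exact: nbhs_right_gt.
have h : forall i, exists z : set (R * R * R) * (R * R * R -> R) * (R * R * R -> R) * R * R,
    sandwiched i (C i) t z.1.1.1.1 z.1.1.1.2 z.1.1.2 z.1.2 z.2.
  move=> i; have H : forall i, exists I lo up x y, sandwiched i (C i) t I lo up x y.
    by near: t.
  have [I [lo [up [x [y hz]]]]] := H i.
  by exists (I, lo, up, x, y).
have [z hz] := choice h.
split.
  move=> v; rewrite (row3_surj v) => /(scaled_Omega_block _ _ alpha01 rho0_gt0 _ _ t0) [i hi].
  by have [] := block_exp _ _ _ _ _ _ _ _ _ _ _ _ _ _ _ _ _ (hz i) _ hi.
have := volume_sandwich t C _ _ _ _ _ t0 hz.
set V := vol_g _ _ _ _ _ _ _ _.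
(* The finite bounds on both sides exclude infinite volume. *)
case: V => [r|/andP[]|/andP[]] //; rewrite !lee_fin => /andP[r1 r2].
rewrite volE_Omega // -!EFinM -!EFinB lee_fin.
pose w := quarter_volume alpha rho0 * t ^+ 3 + coef5 alpha k rho0 / 4 * t ^+ 5.
have sumw : \sum_(i : bool * bool) w = 4 * w by rewrite sumr_const card_prod card_bool mulr_natl.
rewrite (_ : r - _ - _ = r - 4 * w); last by rewrite /w; field.
rewrite -sumw mulr_suml ler_norml -opprB.
have b1 : \sum_i (w - C i * t ^+ 6) <= \sum_i (z i).1.2.
  apply: ler_sum => i _; have := lo_value _ _ _ _ _ _ _ _ _ _ _ _ _ _ _ _ _ (hz i).
  by rewrite -/w ler_norml => /andP[? _]; lra.
have b2 : \sum_i (z i).2 <= \sum_i (w + C i * t ^+ 6).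
  apply: ler_sum => i _; have := up_value _ _ _ _ _ _ _ _ _ _ _ _ _ _ _ _ _ (hz i).
  by rewrite -/w ler_norml => /andP[_ ?]; lra.
rewrite sumrB in b1; rewrite big_split /= in b2.
by apply/andP; split; lra.
Unshelve. all: by end_near. Qed.

End VolumeExpansion.

Theorem lemma6p10 (R : realType) (alpha k rho0 : R)
    (b : R -> R) (chi : R * R -> R) (p e1 e2 : 'rV[R]_3)
    (halpha : 0 < alpha < 1)
    (hb : cutoff1 b) (hchi : cutoff2 chi)
    (hframe : orthonormal3 p e1 e2)
    (hrho0 : 0 < rho0)
    (hrho0_le : rho0 <= Num.min (2^-1 * rho_star alpha k)
        (Num.sqrt (1 + alpha ^+ 2) * (alpha `^ (alpha / (1 - alpha))))) :
  (exists C : R, \forall t \near 0^'+,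
     (forall v, scaled t (Omega alpha rho0) v ->
        exp_defined alpha k b chi p e1 e2 v) /\
     (`| vol_g alpha k b chi p e1 e2
           (exp_q alpha k b chi p e1 e2 @` scaled t (Omega alpha rho0))
         - (t ^+ 3)%:E * volE (Omega alpha rho0)
         - (coef5 alpha k rho0 * t ^+ 5)%:E | <= (C * t ^+ 6)%:E)%E) /\
  (0 < coef5 alpha k rho0 <-> K_star alpha < k).
Proof.
split; last exact: coef5_gt0.
apply: volume_expansion => //.
(* With [h2] this gives rho0 <= 1/8, hence rho0 <= 1, by which a block of scale tau has coordinates
   at most tau. *)
have h1 : rho0 <= 2^-1 * rho_star alpha k by move: hrho0_le; rewrite le_min => /andP[].
have h2 : rho_star alpha k <= 4^-1 by rewrite /rho_star ge_min lexx.
lra.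
Qed.
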